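(* The non-symmetric operad $K'$ is isomorphic to the quotient of the free non-symmetric operad on its arity $2$ component $K'(2)$ (with basis $(1<2)$, $(1>2)$ in dimension $0$ and $(1|2)$ in dimension $1$) by the ideal generated by the relations \begin{align*} (1 > 2)\circ_2 (1 < 2)&=(1 < 2)\circ_1 (1 > 2),\\ (1 > 2)\circ_2 (1 > 2)&=(1 > 2)\circ_1 (1 > 2)+(1 > 2)\circ_1 (1 < 2),\\ (1 < 2)\circ_1 (1 < 2)&=(1 < 2)\circ_2 (1 < 2)+(1 < 2)\circ_2 (1 > 2),\\ (1 > 2)\circ_2 (1 | 2)&= (1 | 2)\circ_1 (1 > 2),\\ (1 < 2)\circ_1 (1 | 2) &= (1 | 2)\circ_2 (1 < 2),\\ (1 | 2)\circ_1 (1 < 2)&=(1 | 2)\circ_2 (1 > 2),\\ (1 | 2)\circ_1 (1 | 2)&=-(1 | 2)\circ_2 (1 | 2). \end{align*} In particular $K'$ is a binary quadratic (non-symmetric) operad.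
   Context: $K'$ is a non-symmetric differential graded operad over $\mathbb{Z}$ such that $K'(n)$ is the cellular cochain complex of the associahedron (Stasheff polytope) of dimension $n-1$, whose cells are in bijection with plane rooted trees with $n+1$ leaves in which every internal vertex has at least two children. An explicit model is as follows. The ambient operad $\Pi$: $\Pi(n)$ is the free $\mathbb{Z}$-module generated by expressions $\pi=\pi_1\otimes\dots\otimes\pi_p$, where each $\pi_j$ is an exterior product of $p_j\ge1$ elements of $\{1,\dots,n\}$, every element of $\{1,\dots,n\}$ appearing exactly once in total, modulo antisymmetry of exterior products. Put $\dim\pi_j=p_j-1$, $\dim\pi=\sum_j\dim\pi_j$ and $d(\pi)=\sum_{j=1}^{p-1}(-1)^{\dim\pi_1+\dots+\dim\pi_j}\pi_1\otimes\dots\otimes\pi_j\wedge\pi_{j+1}\otimes\dots\otimes\pi_p$. For $\pi\in\Pi(m)$, $\mu=\mu_1\otimes\dots\otimes\mu_q\in\Pi(n)$ and $1\le i\le m$, renumber labels in the standard way (labels of $\mu$ become $i,\dots,i+n-1$, labels of $\pi$ larger than $i$ are increased by $n-1$); if $i$ occurs in $\pi_\ell$, write (up to sign) $\pi_\ell=\pi'_\ell\wedge i$ and set $$\pi\circ_i\mu=\sum_\sigma\varepsilon(\sigma)\,\pi_1\otimes\dots\otimes\pi_{\ell-1}\otimes\pi'_\ell\wedge\mu_1\otimes\sigma(\pi_{\ell+1}\otimes\dots\otimes\pi_p,\mu_2\otimes\dots\otimes\mu_q),$$ the sum being over shuffles $\sigma$ of $\pi_{\ell+1},\dots,\pi_p$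 with $\mu_2,\dots,\mu_q$ and $\varepsilon(\sigma)$ being the Koszul sign (for $\dim$) of passing from $\pi_{\ell+1}\otimes\dots\otimes\pi_p\otimes\mu_1\otimes\dots\otimes\mu_q$ to $\mu_1\otimes\sigma(\cdots)$. Trees: number the leaves of a plane tree $T$ from left to right by $0,\dots,n$. The sector $i$ ($1\le i\le n$) is the pair of consecutive leaves $i-1,i$; it belongs to the internal vertex at which these two leaves are separated (their lowest common ancestor). For an internal vertex $v$ with sectors $s_1<\dots<s_k$ put $\pi_v=s_1\wedge\dots\wedge s_k$, of dimension $k-1$. Let $t_T\in\Pi(n)$ be the sum $\sum \varepsilon\,\pi_{v_1}\otimes\dots\otimes\pi_{v_p}$ over all total orderings $(v_1,\dots,v_p)$ of the internal vertices of $T$ in which each vertex comes after its parent, where $\varepsilon$ is the Koszul sign (for $\dim$) for passing from the depth-first left-to-right ordering of the blocks to the ordering $(v_1,\dots,v_p)$. Then $K'(n)\subset\Pi(n)$ is the free $\mathbb{Z}$-submodule with basis the $t_T$, for $T$ a plane tree with $n+1$ leaves; these submodules are stable under $d$ and under the compositions $\circ_i$, and contain the unit $1\in\Pi(1)$. In arity $2$ the basis elements are denoted $(1<2)=1\otimes2$, $(1>2)=2\otimes 1$ (the two binary trees, dimension $0$) and $(1|2)=1\wedge 2$ (the corolla, dimension $1$). A non-symmetric operad is binary quadratic if it is the quotient of the free non-symmetric operad on a module concentrated in arity $2$ by an ideal generated by elements of arity $3$. *)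

(* Defs.v *)
From HB Require Import structures.
From mathcomp Require Import all_boot all_order all_algebra.
From mathcomp Require Import generic_quotient ring_quotient.
From mathcomp Require Import boolp.
From mathcomp Require Import freeg.

Set Implicit Arguments.
Unset Strict Implicit.
Unset Printing Implicit Defensive.

Import GRing.Theory.
Local Open Scope ring_scope.
Local Open Scope quotient_scope.

(** ** Non-symmetric differential graded operads over [int] *)

(* [x] of arity [m] and degree [a], [y] of arity [n] and degree [b]: the     *)
(* composite at the input [i], numbered from 1, has arity [m + n - 1] and    *)
(* degree [a + b]. Keeping [r] and [c] as variables avoids transporting      *)
(* along equalities of indices in the associativity axioms.                  *)
Definition composable (m a n b r c i : nat) : bool :=
  [&& (0 < i <= m)%N, r.+1 == (m + n)%N & c == (a + b)%N].

Record dgop := DGOp {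
  op :> nat -> nat -> zmodType;
  op_one : op 1 0;
  op_comp : forall m a n b r c i,
    composable m a n b r c i -> op m a -> op n b -> op r c;
  op_d : forall n a, op n a -> op n a.+1
}.

Arguments op_one P : rename.
Arguments op_comp P {m a n b r c i} h x y : rename.
Arguments op_d P {n a} x : rename.

Record dgop_axioms (P : dgop) : Prop := {
  comp_addl : forall m a n b r c i (h : composable m a n b r c i)
    (x x' : P m a) (y : P n b),
    op_comp P h (x + x') y = op_comp P h x y + op_comp P h x' y;
  comp_addr : forall m a n b r c i (h : composable m a n b r c i)
    (x : P m a) (y y' : P n b),
    op_comp P h x (y + y') = op_comp P h x y + op_comp P h x y';
  comp_1l : forall n a (h : composable 1 0 n a n a 1) (x : P n a),
    op_comp P h (op_one P) x = x;
  comp_1r : forall m a i (h : composable m a 1 0 m a i) (x : P m a),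
    op_comp P h x (op_one P) = x;
  comp_seq : forall m a n b p e r c s f t g i j
    (h1 : composable m a n b r c i)
    (h2 : composable r c p e t g (i.-1 + j))
    (h3 : composable n b p e s f j)
    (h4 : composable m a s f t g i)
    (x : P m a) (y : P n b) (z : P p e),
    op_comp P h2 (op_comp P h1 x y) z = op_comp P h4 x (op_comp P h3 y z);
  comp_par : forall m a n b p e r c s f t g i k
    (h1 : composable m a n b r c i)
    (h2 : composable r c p e t g (k + n).-1)
    (h3 : composable m a p e s f k)
    (h4 : composable s f n b t g i)
    (x : P m a) (y : P n b) (z : P p e),
    (i < k)%N ->
    op_comp P h2 (op_comp P h1 x y) z =
      op_comp P h4 (op_comp P h3 x z) y *~ (-1) ^+ (b * e);
  d_add : forall n a (x y : P n a), op_d P (x + y) = op_d P x + op_d P y;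
  d_d : forall n a (x : P n a), op_d P (op_d P x) = 0;
  d_comp : forall m a n b r c i
    (h : composable m a n b r c i)
    (h1 : composable m a.+1 n b r c.+1 i)
    (h2 : composable m a n b.+1 r c.+1 i)
    (x : P m a) (y : P n b),
    op_d P (op_comp P h x y) =
      op_comp P h1 (op_d P x) y + op_comp P h2 x (op_d P y) *~ (-1) ^+ a
}.

Definition op_family (P Q : dgop) := forall n k, {additive P n k -> Q n k}.

Record op_morphism (P Q : dgop) (f : op_family P Q) : Prop := {
  morph_one : f 1%N 0%N (op_one P) = op_one Q;
  morph_comp : forall m a n b r c i (h : composable m a n b r c i)
    (x : P m a) (y : P n b),
    f r c (op_comp P h x y) = op_comp Q h (f m a x) (f n b y);
  morph_d : forall n a (x : P n a), f n a.+1 (op_d P x) = op_d Q (f n a x)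
}.

Definition op_isomorphism (P Q : dgop) (f : op_family P Q) : Prop :=
  op_morphism f /\ forall n k, bijective (f n k).

(** ** Suboperads *)

Record zsub (V : zmodType) (S : zmodClosed V) := ZSub {
  zval :> V;
  _ : zval \in S
}.

HB.instance Definition _ (V : zmodType) (S : zmodClosed V) :=
  [isSub for @zval V S].
HB.instance Definition _ (V : zmodType) (S : zmodClosed V) :=
  [Choice of zsub S by <:].
HB.instance Definition _ (V : zmodType) (S : zmodClosed V) :=
  [SubChoice_isSubZmodule of zsub S by <:].

Record op_stable (P : dgop) (S : forall n k, zmodClosed (P n k)) : Prop := {
  stable_one : op_one P \in S 1%N 0%N;
  stable_comp : forall m a n b r c i (h : composable m a n b r c i)
    (x : P m a) (y : P n b),
    x \in S m a -> y \in S n b -> op_comp P h x y \in S r c;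
  stable_d : forall n a (x : P n a), x \in S n a -> op_d P x \in S n a.+1
}.

Definition op_sub (P : dgop) (S : forall n k, zmodClosed (P n k))
    (st : op_stable S) : dgop :=
  @DGOp (fun n k => zsub (S n k))
    (ZSub (stable_one st))
    (fun m a n b r c i h x y => ZSub (stable_comp st h (valP x) (valP y)))
    (fun n a x => ZSub (stable_d st (valP x))).

(** ** Ideals and quotients *)

Definition op_ideal (P : dgop) (I : forall n k, zmodClosed (P n k)) : Prop :=
  forall m a n b r c i (h : composable m a n b r c i) (x : P m a) (y : P n b),
    x \in I m a \/ y \in I n b -> op_comp P h x y \in I r c.

Definition d_stable (P : dgop) (I : forall n k, zmodClosed (P n k)) : Prop :=
  forall n a (x : P n a), x \in I n a -> op_d P x \in I n a.+1.

(* [I] is the smallest ideal, for the compositions alone, containing [R].    *)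
Definition generated_by (P : dgop) (R : forall n k, P n k -> Prop)
    (I : forall n k, zmodClosed (P n k)) : Prop :=
  [/\ op_ideal I,
      forall n k (x : P n k), R n k x -> x \in I n k
    & forall J : forall n k, zmodClosed (P n k),
        op_ideal J ->
        (forall n k (x : P n k), R n k x -> x \in J n k) ->
        forall n k (x : P n k), x \in I n k -> x \in J n k].

(* The operations on classes are computed on representatives; the result is  *)
(* independent of them when [op_ideal I] and [d_stable I] hold and [P]       *)
(* satisfies [dgop_axioms].                                                  *)
Definition op_quot (P : dgop) (I : forall n k, zmodClosed (P n k)) : dgop :=
  @DGOp (fun n k => Quotient.quot (I n k))
    (\pi_(Quotient.quot (I 1%N 0%N)) (op_one P))
    (fun m a n b r c i h x y =>
       \pi_(Quotient.quot (I r c)) (op_comp P h (repr x) (repr y)))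
    (fun n a x => \pi_(Quotient.quot (I n a.+1)) (op_d P (repr x))).

Definition op_proj (P : dgop) (I : forall n k, zmodClosed (P n k)) n k
    (x : P n k) : op_quot I n k :=
  \pi_(Quotient.quot (I n k)) x.

(** ** Free operads on a module concentrated in arity 2 *)

Definition dgmodule (M : nat -> zmodType) (dM : forall k, M k -> M k.+1) :
    Prop :=
  (forall k (x y : M k), dM k (x + y) = dM k x + dM k y) /\
  (forall k (x : M k), dM k.+1 (dM k x) = 0).

Definition chain_map (M : nat -> zmodType) (dM : forall k, M k -> M k.+1)
    (P : dgop) (g : forall k, {additive M k -> P 2%N k}) : Prop :=
  forall k (x : M k), op_d P (g k x) = g k.+1 (dM k x).

(* [F], together with [iota], is the free operad on the differential graded  *)
(* module [M] placed in arity 2.                                             *)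
Definition free_dgop (M : nat -> zmodType) (dM : forall k, M k -> M k.+1)
    (F : dgop) (iota : forall k, {additive M k -> F 2%N k}) : Prop :=
  [/\ dgop_axioms F,
      chain_map dM iota
    & forall (Q : dgop) (g : forall k, {additive M k -> Q 2%N k}),
        dgop_axioms Q -> chain_map dM g ->
        exists f : op_family F Q,
          [/\ op_morphism f,
              forall k (x : M k), f 2%N k (iota k x) = g k x
            & forall f' : op_family F Q,
                op_morphism f' ->
                (forall k (x : M k), f' 2%N k (iota k x) = g k x) ->
                forall n k (x : F n k), f' n k x = f n k x]].

Definition binary_quadratic (P : dgop) : Prop :=
  exists (M : nat -> zmodType) (dM : forall k, M k -> M k.+1)
         (F : dgop) (iota : forall k, {additive M k -> F 2%N k})
         (R : forall n k, F n k -> Prop)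
         (I : forall n k, zmodClosed (F n k)),
    [/\ dgmodule dM,
        free_dgop dM iota,
        (forall n k (x : F n k), R n k x -> n = 3%N),
        generated_by R I /\ d_stable I
      & exists f : op_family (op_quot I) P, op_isomorphism f].

(** ** Koszul signs *)

(* The sign of passing from the sequence [xs] to its rearrangement [ys]: the *)
(* entries of [ys] are moved to the front one after the other. The entries   *)
(* of [xs] are meant to be pairwise distinct.                                *)
Fixpoint koszul (T : eqType) (deg : T -> nat) (xs ys : seq T) : int :=
  if ys is y :: ys' then
    (-1) ^+ (deg y * sumn (map deg (take (index y xs) xs)))
      * koszul deg (rem y xs) ys'
  else 1.

(* The sign of the permutation taking the word [xs] to [ys].                 *)
Definition wedge_sign (xs ys : seq nat) : int := koszul (fun=> 1%N) xs ys.

(** ** The operad [Pi] *)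

(* A block [:: s_1; ...; s_k] stands for the exterior product of the s_i, a  *)
(* sequence of blocks for their tensor product.                              *)
Definition dim (b : seq nat) : nat := (size b).-1.
Definition dims (w : seq (seq nat)) : nat := sumn (map dim w).

(* The arities are at least 1: [Pi 0 k] is zero.                             *)
Definition is_expr (n k : nat) (w : seq (seq nat)) : bool :=
  [&& (0 < n)%N, all (fun b => b != [::]) w,
      perm_eq (flatten w) (iota 1 n) & dims w == k].

(* Modulo antisymmetry the expressions with increasing blocks form a basis.  *)
Definition pi_basis (n k : nat) :=
  {w : seq (seq nat) | is_expr n k w && all (sorted ltn) w}.

Definition Pi_mod (n k : nat) : zmodType := {freeg (pi_basis n k) / int}.

(* The class in [Pi] of an expression whose blocks need not be increasing,   *)
(* and 0 if [w] is not an expression of arity [n] and dimension [k].         *)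
Definition expr (n k : nat) (w : seq (seq nat)) : Pi_mod n k :=
  if insub (map (sort leq) w) is Some b then
    << \prod_(s <- w) wedge_sign s (sort leq s) *g b >>
  else 0.

Definition pi_d (n k : nat) (x : Pi_mod n k) : Pi_mod n k.+1 :=
  fglift (fun b : pi_basis n k =>
    let w := val b in
    \sum_(0 <= j < (size w).-1)
      expr n k.+1
        (take j w ++ (nth [::] w j ++ nth [::] w j.+1) :: drop j.+2 w)
      *~ (-1) ^+ dims (take j.+1 w)) x.

Definition shuffles (T : eqType) (s t : seq T) : seq (seq T) :=
  [seq u <- permutations (s ++ t) | subseq s u && subseq t u].

(* [l] is the position of the block of [p] containing [i]; moving [i] to the *)
(* end of this block accounts for the factor [wedge_sign].                   *)
Definition pi_comp_expr (r c i : nat) (w v : seq (seq nat)) : Pi_mod r c :=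
  let n := size (flatten v) in
  let p := map (map (fun x => if (i < x)%N then (x + n).-1 else x)) w in
  let q := map (map (fun x => (x + i).-1)) v in
  let l := find (fun b => i \in b) p in
  let b := nth [::] p l in
  let b' := rem i b in
  let q1 := head [::] q in
  \sum_(u <- shuffles (drop l.+1 p) (behead q))
    expr r c (take l p ++ (b' ++ q1) :: u)
    *~ (wedge_sign b (rcons b' i) * koszul dim (drop l.+1 p ++ q) (q1 :: u)).

Definition pi_comp (m a n b r c i : nat) (x : Pi_mod m a) (y : Pi_mod n b) :
    Pi_mod r c :=
  fglift (fun w : pi_basis m a =>
    fglift (fun v : pi_basis n b => pi_comp_expr r c i (val w) (val v)) y) x.

Definition Pi : dgop :=
  @DGOp Pi_mod (expr 1 0 [:: [:: 1%N]])
    (fun m a n b r c i _ => @pi_comp m a n b r c i)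
    pi_d.

(** ** Plane trees and the suboperad [K'] *)

Inductive ptree := Leaf | Node of seq ptree.

Fixpoint branching (t : ptree) : bool :=
  if t is Node ts then (1 < size ts)%N && all branching ts else true.

Fixpoint leaves (t : ptree) : nat :=
  if t is Node ts then sumn (map leaves ts) else 1.

(* The internal vertices of a tree whose leftmost leaf is numbered [o], in   *)
(* depth-first left-to-right order, the root being at the address [a]. Each  *)
(* vertex is given by its address and the list of its sectors; the sector    *)
(* separating two consecutive children is the number of the leftmost leaf of *)
(* the second one.                                                           *)
Fixpoint vertices (a : seq nat) (o : nat) (t : ptree) {struct t} :
    seq (seq nat * seq nat) :=
  if t is Node ts then
    (a, take (size ts).-1 (scanl addn o (map leaves ts)))
    :: (fix children (j o : nat) (us : seq ptree) {struct us} :=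
          if us is u :: us' then
            vertices (rcons a j) o u ++ children j.+1 (o + leaves u)%N us'
          else [::]) 0%N o ts
  else [::].

Definition tree_vertices (t : ptree) := vertices [::] 0 t.

Definition is_parent (v w : seq nat * seq nat) : bool :=
  (w.1 != [::]) && (v.1 == take (size w.1).-1 w.1).

Definition parents_first (o : seq (seq nat * seq nat)) : bool :=
  pairwise (fun v w => ~~ is_parent w v) o.

Definition tree_elt (n k : nat) (t : ptree) : Pi n k :=
  \sum_(o <- permutations (tree_vertices t) | parents_first o)
    expr n k (unzip2 o) *~ koszul (fun v => dim v.2) (tree_vertices t) o.

Definition is_cell (n k : nat) (t : ptree) : bool :=
  [&& branching t, leaves t == n.+1 & dims (unzip2 (tree_vertices t)) == k].

Definition K_pred (n k : nat) : {pred Pi n k} := fun x =>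
  `[< exists s : seq (int * ptree),
        all (fun p => is_cell n k p.2) s /\
        x = \sum_(p <- s) tree_elt n k p.2 *~ p.1 >].

Arguments K_pred : clear implicits.

Lemma K_pred_closed n k : zmod_closed (K_pred n k).
Proof.
split; first by apply/asboolP; exists [::]; rewrite big_nil.
move=> x y /asboolP[s [cs ->]] /asboolP[t [ct ->]]; apply/asboolP.
exists (s ++ [seq (- p.1, p.2) | p <- t]); split.
  by rewrite all_cat cs all_map.
rewrite big_cat big_map /= -sumrN; congr (_ + _).
by apply: eq_bigr => p _; rewrite mulrNz.
Qed.

HB.instance Definition _ n k :=
  GRing.isZmodClosed.Build (Pi n k) (K_pred n k) (K_pred_closed n k).

Definition K_sub (n k : nat) : zmodClosed (Pi n k) := K_pred n k.

Lemma tree_elt_K n k t : is_cell n k t -> tree_elt n k t \in K_sub n k.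
Proof.
move=> ct; apply/asboolP; exists [:: (1, t)].
by rewrite /= ct big_seq1.
Qed.

Ltac tree_elt_calc :=
  rewrite /tree_elt -big_filter;
  match goal with |- context [filter ?p (permutations ?s)] =>
    have -> : filter p (permutations s) = [:: s] by vm_compute
  end;
  by rewrite big_seq1.

Lemma tree_elt_lt :
  tree_elt 2 0 (Node [:: Leaf; Node [:: Leaf; Leaf]]) =
  expr 2 0 [:: [:: 1%N]; [:: 2%N]].
Proof. tree_elt_calc. Qed.

Lemma tree_elt_gt :
  tree_elt 2 0 (Node [:: Node [:: Leaf; Leaf]; Leaf]) =
  expr 2 0 [:: [:: 2%N]; [:: 1%N]].
Proof. tree_elt_calc. Qed.

Lemma tree_elt_bar :
  tree_elt 2 1 (Node [:: Leaf; Leaf; Leaf]) = expr 2 1 [:: [:: 1%N; 2%N]].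
Proof. tree_elt_calc. Qed.

Lemma K_lt_in : expr 2 0 [:: [:: 1%N]; [:: 2%N]] \in K_sub 2 0.
Proof. by rewrite -tree_elt_lt tree_elt_K. Qed.

Lemma K_gt_in : expr 2 0 [:: [:: 2%N]; [:: 1%N]] \in K_sub 2 0.
Proof. by rewrite -tree_elt_gt tree_elt_K. Qed.

Lemma K_bar_in : expr 2 1 [:: [:: 1%N; 2%N]] \in K_sub 2 1.
Proof. by rewrite -tree_elt_bar tree_elt_K. Qed.

(* (1 < 2), (1 > 2) and (1 | 2).                                             *)
Definition K_lt : zsub (K_sub 2 0) := ZSub K_lt_in.
Definition K_gt : zsub (K_sub 2 0) := ZSub K_gt_in.
Definition K_bar : zsub (K_sub 2 1) := ZSub K_bar_in.

Definition Kprime (st : op_stable K_sub) : dgop := op_sub st.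

Definition K2_basis : Prop :=
  [/\ forall x : zsub (K_sub 2 0),
        exists! c : int * int, x = K_lt *~ c.1 + K_gt *~ c.2,
      forall x : zsub (K_sub 2 1), exists! c : int, x = K_bar *~ c
    & forall k (x : zsub (K_sub 2 k.+2)), x = 0].

(** ** The quadratic relations *)

Definition comp2 (P : dgop) a b i (hi : (0 < i <= 2)%N)
    (x : P 2%N a) (y : P 2%N b) : P 3%N (a + b)%N :=
  @op_comp P 2 a 2 b 3 (a + b) i
    (introT and3P (And3 hi (eqxx 4%N) (eqxx (a + b)%N))) x y.

Local Notation "x \o_1 y" := (comp2 (i := 1) isT x y)
  (at level 40, no associativity).
Local Notation "x \o_2 y" := (comp2 (i := 2) isT x y)
  (at level 40, no associativity).

Inductive K_relations (P : dgop) (lt gt : P 2%N 0%N) (bar : P 2%N 1%N) :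
    forall n k, P n k -> Prop :=
| K_rel1 : K_relations lt gt bar (gt \o_2 lt - lt \o_1 gt)
| K_rel2 : K_relations lt gt bar (gt \o_2 gt - (gt \o_1 gt + gt \o_1 lt))
| K_rel3 : K_relations lt gt bar (lt \o_1 lt - (lt \o_2 lt + lt \o_2 gt))
| K_rel4 : K_relations lt gt bar (gt \o_2 bar - bar \o_1 gt)
| K_rel5 : K_relations lt gt bar (lt \o_1 bar - bar \o_2 lt)
| K_rel6 : K_relations lt gt bar (bar \o_1 lt - bar \o_2 gt)
| K_rel7 : K_relations lt gt bar (bar \o_1 bar - - (bar \o_2 bar)).

(* Main.v *)
From HB Require Import structures.
Require Import Defs.
From mathcomp Require Import all_boot all_algebra.
From mathcomp Require Import zify ssrAC generic_quotient ring_quotient.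
From mathcomp Require Import boolp freeg.

Set Implicit Arguments.
Unset Strict Implicit.
Unset Printing Implicit Defensive.

Import GRing.Theory.
Local Open Scope ring_scope.
Local Open Scope quotient_scope.
Local Notation dim := Defs.dim.

(** The operad [K'] is compared with the free operad [F] on three generators,
    whose basis consists of the binary trees with vertices labelled [Glt],
    [Ggt], [Gbar]. By the universal property of [F], the expressions
    [1 (x) 2], [2 (x) 1] and [1 /\ 2] of [Pi] define a morphism [phi] from [F]
    to [Pi], and [phi] kills the seven relations ([phi_relations]).

    The proof rests on a family of binary trees [nf T], one for every plane
    tree [T] other than a leaf. If the root of [T] carries the subtrees
    [T_0, ..., T_k], then
      [nf T = nf T_0 > (c_1 | (c_2 | ... | c_k))]  with  [c_j = (1 < nf T_j)],
    where a subtree reduced to a leaf contributes nothing to the product (so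
    that [c_j] is then [1], and [nf T] is [c_1 | ...] if [T_0] is a leaf).
    These trees have two properties.

    - Modulo any ideal containing the relations, every binary tree is a
      combination of trees [nf T] ([spans_all]). By induction it suffices to
      multiply [nf T] by [nf S]; each relation says how one of the three
      products moves through another one, and their repeated use leads to
      products in which fewer leaves are involved.

    - [phi (nf T)] is [t_T] up to sign ([phi_nf]), because the word of the
      root is put first and the words of the subtrees are shuffled behind it.
      The elements [t_T] are linearly independent: the depth-first word of [T]
      occurs in [t_T] with coefficient 1 and does not occur in the element of
      another tree ([pcoef_tree]).

    By the first property the image of [phi] is spanned by the elements
    [phi (nf T)], so by the second it is exactly [K']. In particular [K'] is
    closed under the compositions and the differential ([K_stable]). Now let
    [J] be an ideal containing the relations. The first property, applied to
    the intersection of [J] and the kernel of [phi], writes every [x] as an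
    element of that intersection plus a combination of trees [nf T], and the
    coefficients can be read off [phi x] by the second property. If [phi x] is
    zero they all vanish, so [x] is in [J] ([ker_phi_min]). Hence the kernel of
    [phi] is the ideal generated by the relations, and [K'] is its quotient.

    All this requires that [Pi] is an operad ([Pi_axioms]). A signed sum of
    words is handled as the operation that sends a function [f] on words to
    the corresponding sum of the values of [f]: [sh] does so for the shuffles
    of two words, [wcomp] for a composition and [wdiff] for the differential.
    The associativity of shuffles, the two associativity axioms of the
    composition and the Leibniz rule then become identities between iterated
    operations of this kind, proved by induction on words. Signs are given by
    natural numbers modulo 2, so that the comparison of two signs is an
    equality of parities. *)

(** * Signs and additive maps *)

Section Sign.
Variable A : zmodType.
Implicit Types (x y : A).

(** Only the parity of [n] counts, and [n] is left unreduced: the sign attached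
    to an operation is then visible as the product of dimensions it is. *)
Definition sg (n : nat) x : A := if odd n then - x else x.

Lemma sgE n x : x *~ (-1) ^+ n = sg n x.
Proof.
rewrite /sg -signr_odd; case: odd; last by rewrite expr0 mulr1z.
by rewrite expr1 mulrN1z.
Qed.

Lemma sgD n x y : sg n (x + y) = sg n x + sg n y.
Proof. by rewrite /sg; case: odd; rewrite ?opprD. Qed.

Lemma sg_sg m n x : sg m (sg n x) = sg (m + n) x.
Proof. by rewrite /sg oddD; do 2!case: odd; rewrite ?opprK. Qed.

Lemma sg_0 n : sg n 0 = 0.
Proof. by rewrite /sg; case: odd; rewrite ?oppr0. Qed.

Lemma sg0 x : sg 0 x = x. Proof. by []. Qed.

Lemma sg_sum n I (r : seq I) (P : pred I) (F : I -> A) :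
  sg n (\sum_(i <- r | P i) F i) = \sum_(i <- r | P i) sg n (F i).
Proof. by elim/big_rec2: _ => [|i x y _ <-]; rewrite ?sg_0 ?sgD. Qed.

Lemma sg_parity m n x : odd m = odd n -> sg m x = sg n x.
Proof. by rewrite /sg => ->. Qed.

Lemma sg_even n x : odd n = false -> sg n x = x.
Proof. by rewrite /sg => ->. Qed.

Lemma sg_inj n x y : sg n x = y -> x = sg n y.
Proof. by move=> <-; rewrite sg_sg /sg oddD addbb. Qed.

Lemma sg_odd_opp m n x : odd m != odd n -> sg m x + sg n x = 0.
Proof. by rewrite /sg; do 2!case: odd; rewrite // (addNr, subrr). Qed.
End Sign.

Lemma raddf_sg (A B : zmodType) (h : {additive A -> B}) n x :
  h (sg n x) = sg n (h x).
Proof. by rewrite /sg; case: odd; rewrite ?raddfN. Qed.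

Lemma sgB (A : zmodType) n (x y : A) : sg n (x - y) = sg n x - sg n y.
Proof. by rewrite /sg; case: odd; rewrite // opprD. Qed.

Lemma subr_add (U V : zmodType) (f : U -> V) :
  (forall x y, f (x - y) = f x - f y) -> forall x y, f (x + y) = f x + f y.
Proof.
move=> fB x y; pose f' := GRing.isAdditive.Build _ _ f fB.
pose F : {additive U -> V} := HB.pack f f'.
exact: (raddfD F).
Qed.

Lemma sub_morph0 (U V : zmodType) (f : U -> V) :
  (forall x y, f (x - y) = f x - f y) -> f 0 = 0.
Proof. by move=> fB; rewrite -(subrr 0) fB subrr. Qed.

Lemma sub_morphN (U V : zmodType) (f : U -> V) :
  (forall x y, f (x - y) = f x - f y) -> forall x, f (- x) = - f x.
Proof. by move=> fB x; rewrite -sub0r fB (sub_morph0 fB) sub0r. Qed.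

Lemma sub_morph_sg (U V : zmodType) (f : U -> V) :
  (forall x y, f (x - y) = f x - f y) -> forall n x, f (sg n x) = sg n (f x).
Proof. by move=> fB n x; rewrite /sg; case: odd; rewrite ?(sub_morphN fB). Qed.

Lemma add_morphB (U V : zmodType) (f : U -> V) :
  (forall x y, f (x + y) = f x + f y) -> forall x y, f (x - y) = f x - f y.
Proof.
move=> fD x y; apply/eqP; rewrite eq_sym subr_eq -fD subrK; exact/eqP.
Qed.

(** Several maps below are given by case distinctions, or depend on parameters
    that make a global additive structure awkward; this packs them at their
    point of use. *)
Definition pack_additive (U V : zmodType) (f : U -> V)
  (fB : forall x y, f (x - y) = f x - f y) : {additive U -> V} :=
  HB.pack f (GRing.isAdditive.Build U V f fB).

Lemma pack_additiveE (U V : zmodType) (f : U -> V) fB x :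
  @pack_additive U V f fB x = f x.
Proof. by []. Qed.

(** Compares two sign exponents by checking all parities of their variables. *)
Ltac parity :=
  rewrite ?(oddD, oddM, oddS, size_cat, negb_add, negbK) /=;
  repeat match goal with |- context [odd ?x] => case: (odd x) end; by [].

(** ** Signed shuffles *)
Section Shuffle.
Variables (T : eqType) (deg : T -> nat).

Definition degs (w : seq T) : nat := sumn (map deg w).

Lemma degs_cat x y : degs (x ++ y) = (degs x + degs y)%N.
Proof. by rewrite /degs map_cat sumn_cat. Qed.

Lemma degs_cons a x : degs (a :: x) = (deg a + degs x)%N.
Proof. by []. Qed.

Lemma degs_perm x y : perm_eq x y -> degs x = degs y.
Proof. by move=> h; apply: perm_sumn; apply: perm_map. Qed.

Section Target.
Variable A : zmodType.
Implicit Types (f g : seq T -> A) (x y z u : seq T).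

(** Shuffling [b :: y] with [x] either takes the first letter of [x] or moves
    [b] in front of [x], which costs the Koszul sign [deg b * degs x]. *)
Fixpoint sh_rec x : (seq T -> A) -> seq T -> A :=
  if x is a :: x' then
    fix sh_a f y :=
      if y is b :: y' then
        sh_rec x' (fun u => f (a :: u)) y
          + sg (deg b * degs x) (sh_a (fun u => f (b :: u)) y')
      else f x
  else fun f y => f y.

Definition sh f x y := sh_rec x f y.

Lemma sh0s f y : sh f [::] y = f y. Proof. by []. Qed.

Lemma shs0 f x : sh f x [::] = f x. Proof. by case: x. Qed.

Lemma sh_cons f a x b y :
  sh f (a :: x) (b :: y) =
    sh (fun u => f (a :: u)) x (b :: y)
      + sg (deg b * degs (a :: x)) (sh (fun u => f (b :: u)) (a :: x) y).
Proof. by []. Qed.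

Definition shuffled x y u := [&& perm_eq u (x ++ y), subseq x u & subseq y u].

Lemma shuffled0s y : shuffled [::] y y.
Proof. by rewrite /shuffled perm_refl sub0seq subseq_refl. Qed.

Lemma shuffleds0 x : shuffled x [::] x.
Proof. by rewrite /shuffled cats0 perm_refl sub0seq subseq_refl. Qed.

Lemma shuffled_consl a x y u :
  shuffled x y u -> shuffled (a :: x) y (a :: u).
Proof.
move=> /and3P[p sx sy]; apply/and3P; split; first by rewrite /= perm_cons.
  by rewrite /= eqxx.
exact: subseq_trans sy (subseq_cons _ _).
Qed.

Lemma shuffled_consr b x y u :
  shuffled x y u -> shuffled x (b :: y) (b :: u).
Proof.
move=> /and3P[p sx sy]; apply/and3P; split; last by rewrite /= eqxx.
  by rewrite perm_sym perm_catC /= perm_cons perm_catC perm_sym.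
exact: subseq_trans sx (subseq_cons _ _).
Qed.

(** Since [f] is only evaluated on shuffles, two functions that agree there
    may be exchanged; this is how a sign depending on the total degree of a
    shuffle is replaced by a constant one. *)
Lemma sh_ext f g x y :
  (forall u, shuffled x y u -> f u = g u) -> sh f x y = sh g x y.
Proof.
elim: x f g y => [|a x IHx] f g y; first by move=> h; apply/h/shuffled0s.
elim: y f g => [|b y IHy] f g h; first exact/h/shuffleds0.
rewrite !sh_cons; congr (_ + sg _ _).
  by apply: IHx => u hu; apply: h; apply: shuffled_consl.
by apply: IHy => u hu; apply: h; apply: shuffled_consr.
Qed.

Lemma eq_sh f g x y : f =1 g -> sh f x y = sh g x y.
Proof. by move=> h; apply: sh_ext. Qed.

Lemma shD f g x y : sh (fun u => f u + g u) x y = sh f x y + sh g x y.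
Proof.
elim: x f g y => [|a x IHx] f g y //.
elim: y f g => [|b y IHy] f g //.
by rewrite !sh_cons IHx IHy sgD addrACA.
Qed.

Lemma sh_sg n f x y : sh (fun u => sg n (f u)) x y = sg n (sh f x y).
Proof.
elim: x f y => [|a x IHx] f y //; elim: y f => [|b y IHy] f //.
by rewrite !sh_cons IHx IHy sgD !sg_sg addnC.
Qed.

Lemma sh_0 x y : sh (fun=> 0 : A) x y = 0.
Proof.
elim: x y => [|a x IHx] y //; elim: y => [|b y IHy] //.
by rewrite sh_cons IHx IHy sg_0 addr0.
Qed.

Lemma sh_comm f x y : sh f x y = sg (degs x * degs y) (sh f y x).
Proof.
elim: x f y => [|a x IHx] f y; first by rewrite mul0n shs0.
elim: y f => [|b y IHy] f; first by rewrite muln0.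
rewrite !sh_cons IHx IHy sgD !sg_sg addrC; congr (_ + _);
  by apply: sg_parity; rewrite !degs_cons; parity.
Qed.

Lemma shuffled_degs x y u : shuffled x y u -> degs u = (degs x + degs y)%N.
Proof. by case/and3P=> p _ _; rewrite (degs_perm p) degs_cat. Qed.

(** Both sides are the sum over the shuffles of three words: they obey the
    same recursion on the first letters [a], [b], [c]. *)
Lemma sh_assoc f x y z :
  sh (fun u => sh f u z) x y = sh (fun u => sh f x u) y z.
Proof.
elim: x f y z => [|a x IHx] f y z //.
elim: y f z => [|b y IHy] f z //.
elim: z f => [|c z IHz] f.
  by rewrite shs0; apply: eq_sh => u; rewrite shs0.
have E1 : sh (fun u => sh f (a :: u) (c :: z)) x (b :: y) =
    sh (fun u => sh (fun v => f (a :: v)) u (c :: z)) x (b :: y)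
  + sg (deg c * (degs (a :: x) + degs (b :: y)))
      (sh (fun u => sh (fun v => f (c :: v)) (a :: u) z) x (b :: y)).
  rewrite -sh_sg -shD; apply: sh_ext => u /shuffled_degs du.
  by rewrite sh_cons !degs_cons du degs_cons !addnA.
have E2 : sh (fun u => sh f (b :: u) (c :: z)) (a :: x) y =
    sh (fun u => sh (fun v => f (b :: v)) u (c :: z)) (a :: x) y
  + sg (deg c * (degs (a :: x) + degs (b :: y)))
      (sh (fun u => sh (fun v => f (c :: v)) (b :: u) z) (a :: x) y).
  rewrite -sh_sg -shD; apply: sh_ext => u /shuffled_degs du.
  by rewrite sh_cons !degs_cons du degs_cons; congr (_ + sg (_ * _) _); lia.
have F1 : sh (fun u => sh f (a :: x) (b :: u)) y (c :: z) =
    sh (fun u => sh (fun v => f (a :: v)) x (b :: u)) y (c :: z)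
  + sg (deg b * degs (a :: x))
      (sh (fun u => sh (fun v => f (b :: v)) (a :: x) u) y (c :: z)).
  by rewrite -sh_sg -shD.
have F2 : sh (fun u => sh f (a :: x) (c :: u)) (b :: y) z =
    sh (fun u => sh (fun v => f (a :: v)) x (c :: u)) (b :: y) z
  + sg (deg c * degs (a :: x))
      (sh (fun u => sh (fun v => f (c :: v)) (a :: x) u) (b :: y) z).
  by rewrite -sh_sg -shD.
rewrite sh_cons E1 E2 [RHS]sh_cons F1 F2 !sgD !sg_sg -IHy -IHz.
rewrite [sh (fun u => sh _ u z) _ _]sh_cons sgD sg_sg IHx [sh _ (b :: y) (c :: z)]sh_cons.
rewrite [LHS](AC (3*2) ((1*4)*(2*(3*5)))) /=.
by congr (_ + (_ + (_ + _))); apply: sg_parity; parity.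
Qed.

End Target.

Lemma raddf_sh (A B : zmodType) (h : {additive A -> B}) f x y :
  h (sh f x y) = sh (fun u => h (f u)) x y.
Proof.
elim: x f y => [|a x IHx] f y //; elim: y f => [|b y IHy] f //.
by rewrite !sh_cons raddfD raddf_sg IHx IHy.
Qed.

End Shuffle.

(** Relabelling letters, or forgetting the addresses of the vertices of a
    tree, does not change the shuffles. *)
Lemma sh_map (S T : eqType) (degS : S -> nat) (degT : T -> nat) (h : S -> T)
    (A : zmodType) (f : seq T -> A) x y :
  (forall a, degT (h a) = degS a) ->
  sh degT f (map h x) (map h y) = sh degS (fun u => f (map h u)) x y.
Proof.
move=> e; have ed w : degs degT (map h w) = degs degS w.
  by rewrite /degs -map_comp; congr sumn; apply: eq_map.
elim: x f y => [|a x IHx] f y //; elim: y f => [|b y IHy] f //.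
rewrite !map_cons !sh_cons -!map_cons ed e; congr (_ + sg _ _).
  exact: IHx.
exact: IHy.
Qed.

Arguments eq_sh {T deg A f g x y} _.
Arguments sh_ext {T deg A f g x y} _.
Arguments sh_sg {T deg A} n f x y.
Arguments shD {T deg A} f g x y.
Arguments sh_assoc {T deg A} f x y z.
Arguments sh_comm {T deg A} f x y.
Arguments shuffled_degs {T deg x y u} _.
Arguments sh : simpl never.

(** * Composition and differential of words *)

Notation block := (seq nat).
Notation word := (seq block).
Notation shw := (sh dim).

Definition blocky (w : word) := all (fun b => b != [::]) w.

Lemma dimsE w : degs dim w = dims w. Proof. by []. Qed.

Lemma shuffled_dims (x y u : word) :
  shuffled x y u -> dims u = (dims x + dims y)%N.
Proof. exact: shuffled_degs. Qed.

Lemma dims_cons b w : dims (b :: w) = (dim b + dims w)%N. Proof. by []. Qed.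

Lemma dims_cat v w : dims (v ++ w) = (dims v + dims w)%N.
Proof. exact: degs_cat. Qed.

Lemma dims_perm v w : perm_eq v w -> dims v = dims w.
Proof. exact: degs_perm. Qed.

(** The sign exponent of moving [i] to the end of the block [b]. *)
Definition after (i : nat) (b : block) : nat := (size b - (index i b).+1)%N.

Lemma after_catl i a b : i \in a -> after i (a ++ b) = (after i a + size b)%N.
Proof.
move=> ia; by rewrite /after index_cat ia size_cat addnBAC // index_mem.
Qed.

Lemma after_catr i a b : i \notin a -> after i (a ++ b) = after i b.
Proof. by move=> /negbTE ia; rewrite /after index_cat ia size_cat -addnS subnDl. Qed.

Lemma rem_catl (T : eqType) (i : T) (a b : seq T) : i \in a -> rem i (a ++ b) = rem i a ++ b.
Proof.
elim: a => //= x a IH; rewrite inE eq_sym; case: eqP => //= _ /IH ->.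
by [].
Qed.

Lemma rem_catr (T : eqType) (i : T) (a b : seq T) : i \notin a -> rem i (a ++ b) = a ++ rem i b.
Proof.
elim: a => //= x a IH; rewrite inE eq_sym negb_or.
by case: eqP => //= _ /IH ->.
Qed.

(** Moving [i] and [k] to the end of a block in either order differs by one
    transposition. *)
Lemma after_rem i k b : uniq b -> i \in b -> k \in b -> i != k ->
  odd (after i b + after k (rem i b)) = ~~ odd (after k b + after i (rem k b)).
Proof.
rewrite /after; elim: b => //= x b IH /andP[xb ub]; rewrite !inE.
have [xi|xi] := eqVneq x i; have [xk|xk] := eqVneq x k.
- by subst; rewrite /= => _ _ /eqP.
- rewrite -xi /= => _ kb _; rewrite size_rem //.
  have := kb; rewrite -index_mem; case: (size b) => // n _.
  by rewrite /= !subSS ?eqxx ?subn0; parity.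
- rewrite -xk /= => ib _ _; rewrite size_rem //.
  have := ib; rewrite -index_mem; case: (size b) => // n _.
  by rewrite /= !subSS ?eqxx ?subn0; parity.
- rewrite /= => ib kb nik.
  by rewrite ?(negbTE xi) ?(negbTE xk) !subSS /= IH.
Qed.

Section Words.
Variable A : zmodType.
Implicit Types (f g : word -> A) (b : block) (w v u t : word) (i j k : nat).

(** The composition at [i] of words whose letters are already renumbered. The
    exponent [dim (head [::] v) * dims w'] is the Koszul sign of moving the
    first block of [v] in front of the blocks [w'] that follow the one of [i];
    that block absorbs it, and the remaining blocks are shuffled. *)
Fixpoint wcomp f i w v : A :=
  if w is b :: w' then
    if i \in b then
      sg (after i b + dim (head [::] v) * dims w')
        (shw (fun t => f ((rem i b ++ head [::] v) :: t)) w' (behead v))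
    else wcomp (fun t => f (b :: t)) i w' v
  else 0.

Lemma wcomp_in f i b w c v : i \in b ->
  wcomp f i (b :: w) (c :: v) =
    sg (after i b + dim c * dims w) (shw (fun t => f ((rem i b ++ c) :: t)) w v).
Proof. by move=> /= ->. Qed.

Lemma wcomp_notin f i b w v : i \notin b ->
  wcomp f i (b :: w) v = wcomp (fun t => f (b :: t)) i w v.
Proof. by move=> /= /negbTE->. Qed.

Lemma wcomp_out f i w v : i \notin flatten w -> wcomp f i w v = 0.
Proof.
elim: w f => //= b w IH f; rewrite mem_cat negb_or => /andP[/negbTE-> ?].
exact: IH.
Qed.

Definition composite i w v t :=
  [&& perm_eq (flatten t) (rem i (flatten w) ++ flatten v),
      dims t == (dims w + dims v)%N & blocky t].

Lemma blocky_perm w v : perm_eq w v -> blocky w = blocky v.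
Proof. by move=> h; rewrite /blocky (perm_all _ h). Qed.

Lemma uniq_cons_block b w : uniq (flatten (b :: w)) ->
  [/\ uniq b, uniq (flatten w) & forall x, x \in b -> x \notin flatten w].
Proof.
rewrite /= cat_uniq => /and3P[? /hasPn h ?]; split=> // x xb.
by apply/negP => /h; rewrite xb.
Qed.

Lemma dim_wcomp i b c : i \in b -> c != [::] ->
  dim (rem i b ++ c) = (dim b + dim c)%N.
Proof.
rewrite /dim size_cat => ib; rewrite size_rem //; case: c => // x c _ /=.
by lia.
Qed.

Lemma wcomp_ext f g i w v : blocky w -> blocky v -> v != [::] ->
  (forall t, composite i w v t -> f t = g t) -> wcomp f i w v = wcomp g i w v.
Proof.
move=> bw; case: v => // c v bv _; elim: w f g bw => //= b w IH f g /andP[b0 bw] h.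
case: ifP => ib.
  congr sg; apply: sh_ext => t ht; apply: h; case/and3P: (ht) => p _ _.
  apply/and3P; split.
  - rewrite /= rem_catl // -!catA perm_cat2l perm_sym perm_catCA perm_cat2l perm_sym.
    by have:= perm_flatten p; rewrite flatten_cat.
  - rewrite !dims_cons dim_wcomp //; first by rewrite (dims_perm p) dims_cat; apply/eqP; lia.
    by case/andP: bv.
  - case/andP: bv => c0 bv; apply/andP; split; first by case: (rem i b).
    change (is_true (blocky t)).
    by rewrite (blocky_perm p) /blocky all_cat; apply/andP.
apply: IH => // t /and3P[p d n]; apply: h; apply/and3P; split.
- by rewrite rem_catr ?ib //= -catA perm_cat2l.
- by rewrite !dims_cons (eqP d) addnA.
- by rewrite /blocky /= b0.
Qed.

Lemma eq_wcomp f g i w v : f =1 g -> wcomp f i w v = wcomp g i w v.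
Proof.
elim: w f g => //= b w IH f g h; case: ifP => _; last by apply: IH => ?.
by congr sg; apply: eq_sh => ?.
Qed.

Lemma wcompD f g i w v :
  wcomp (fun t => f t + g t) i w v = wcomp f i w v + wcomp g i w v.
Proof.
elim: w f g => [|b w IH] f g; first by rewrite /= addr0.
by rewrite /=; case: ifP => _; rewrite ?IH // shD sgD.
Qed.

Lemma wcomp_sg n f i w v : wcomp (fun t => sg n (f t)) i w v = sg n (wcomp f i w v).
Proof.
elim: w f => [|b w IH] f; first by rewrite /= sg_0.
by rewrite /=; case: ifP => _; rewrite ?IH // sh_sg !sg_sg addnC.
Qed.

Lemma wcomp_0 i w v : wcomp (fun=> 0) i w v = 0.
Proof. by elim: w => //= b w ->; case: ifP => _; rewrite // sh_0 sg_0. Qed.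

(** The blocks that a shuffle puts behind the one of [i] are shuffled with the
    rest of [u] in either order of the two operations, by [sh_assoc]. *)
Lemma sh_wcomp f i x y u : blocky y -> blocky u -> u != [::] ->
  i \notin flatten x ->
  shw (fun t => wcomp f i t u) x y = wcomp (fun t => shw f x t) i y u.
Proof.
move=> + bu; case: u bu => // c u bu + _.
elim: x f y => [|a x IHx] f y // yb ix.
elim: y f yb => [|b y IHy] f yb; first by rewrite shs0 wcomp_out.
have [ia ix'] : i \notin a /\ i \notin flatten x.
  by apply/andP; rewrite -negb_or -mem_cat.
rewrite sh_cons; rewrite (eq_sh (g := fun t => wcomp (fun t => f (a :: t)) i t (c :: u)));
  last by move=> t; rewrite wcomp_notin.
rewrite IHx //; case/andP: (yb) => b0 yb'.
case: (boolP (i \in b)) => ib.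
  rewrite [X in sg _ X](sh_ext (g := fun t =>
     sg (after i b + dim c * (dims (a :: x) + dims y))
      (shw (fun t => f ((rem i b ++ c) :: t)) t u))); last first.
    by move=> t /shuffled_dims dt; rewrite wcomp_in // dt.
  rewrite sh_sg sh_assoc !wcomp_in // sg_sg.
  rewrite [in RHS](eq_sh (g := fun t =>
     shw (fun t => f (a :: t)) x ((rem i b ++ c) :: t) +
     sg ((dim b + dim c) * dims (a :: x))
       (shw (fun t => f ((rem i b ++ c) :: t)) (a :: x) t))); last first.
    move=> t; rewrite sh_cons dim_wcomp //; first by case/andP: bu.
  rewrite shD sgD sh_sg sg_sg; congr (_ + _).
  by rewrite dims_cons; apply: sg_parity; parity.
rewrite !wcomp_notin //.
rewrite [X in sg _ X](eq_sh (g := fun t => wcomp (fun t => f (b :: t)) i t (c :: u)));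
  last by move=> t; rewrite wcomp_notin.
by rewrite IHy // -wcomp_sg -wcompD.
Qed.

(** Reduced to the previous lemma by exchanging [x] and [y]; the sign that is
    left is the one of moving [u] across [y]. *)
Lemma sh_wcompl f i x y u : blocky x -> blocky u -> u != [::] ->
  i \notin flatten y ->
  shw (fun t => wcomp f i t u) x y =
    sg (dims u * dims y) (wcomp (fun t => shw f t y) i x u).
Proof.
move=> bx bu u0 iy; rewrite sh_comm sh_wcomp // -!wcomp_sg.
apply: wcomp_ext => // t /and3P[_ /eqP dt _].
rewrite (sh_comm _ t) !dimsE dt !sg_sg; apply: sg_parity; parity.
Qed.

(** The hypothesis on [j] allows the letter of [v] at which [u] is inserted to
    be the letter [i] that [v] replaces: renumbering produces this case. *)
Lemma wcomp_seq f i j w v u :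
  uniq (flatten w) -> uniq (flatten v) -> j \in flatten v ->
  (j \in flatten w -> j = i) -> blocky w -> blocky v -> blocky u -> u != [::] ->
  wcomp (fun t => wcomp f j t u) i w v = wcomp (fun t => wcomp f i w t) j v u.
Proof.
move=> uw uv jv jw bw bv bu; case: u bu => // d u bu _.
case: v jv bv uv => // c v jv bv uv.
elim: w f uw jw bw => [|b w IH] f uw jw bw; first by rewrite [RHS](@eq_wcomp _ (fun=> 0)) ?wcomp_0.
have [ub uw' dbw] := uniq_cons_block uw.
case/andP: (bw) => b0 bw'; case/andP: (bv) => c0 bv'.
case: (boolP (i \in b)) => ib; last first.
  have jb : j \notin b.
    by apply: contra ib => jb; rewrite -jw ?mem_cat ?jb.
  rewrite wcomp_notin // (@eq_wcomp _ (fun t => wcomp (fun t => f (b :: t)) j t (d :: u)));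
    last by move=> t; rewrite wcomp_notin.
  rewrite IH //; first by apply: eq_wcomp => t; rewrite wcomp_notin.
  by move=> jw'; apply: jw; rewrite mem_cat jw' orbT.
have iw : i \notin flatten w by apply: dbw.
have jw' : j \notin flatten w.
  by apply/negP => jw'; have := jw; rewrite mem_cat jw' orbT => /(_ isT) ij;
  rewrite -ij jw' in iw.
have jr : j \notin rem i b.
  rewrite mem_rem_uniq // inE; apply/andP => -[ji jb].
  by move: ji; rewrite jw ?eqxx // mem_cat jb.
have [uc uv' dcv] := uniq_cons_block uv.
rewrite wcomp_in //; case: (boolP (j \in c)) => jc.
  rewrite (sh_ext (g := fun t => sg (after j c + dim d * (dims w + dims v))
       (shw (fun t => f ((rem i b ++ (rem j c ++ d)) :: t)) t u))); last first.
    move=> t /shuffled_dims dt.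
    by rewrite wcomp_in ?mem_cat ?jc ?orbT // after_catr // rem_catr // -catA dt.
  rewrite sh_sg sh_assoc wcomp_in // sg_sg.
  rewrite [X in sg _ X = _](eq_sh (g := fun t => sg (after i b + dim (rem j c ++ d) * dims w)
     (wcomp f i (b :: w) ((rem j c ++ d) :: t)))); last first.
    by move=> t; rewrite wcomp_in // sg_sg sg_even // oddD addbb.
  rewrite sh_sg sg_sg dim_wcomp //; last by case/andP: bu.
  by apply: sg_parity; parity.
have jv' : j \in flatten v by move: jv; rewrite mem_cat (negbTE jc).
rewrite (eq_sh (g := fun t => wcomp (fun t => f ((rem i b ++ c) :: t)) j t (d :: u)));
  last by move=> t; rewrite wcomp_notin // mem_cat negb_or jr.
rewrite sh_wcomp // -wcomp_sg wcomp_notin //; apply: eq_wcomp => t.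
by rewrite wcomp_in.
Qed.
(** Antisymmetry within a block, for the exchange of two consecutive factors. *)
Definition swapping f := forall p a b t q,
  f (p ++ (q ++ a ++ b) :: t) =
    sg (size a * size b) (f (p ++ (q ++ b ++ a) :: t)).

Lemma swapping_cons f b : swapping f -> swapping (fun t => f (b :: t)).
Proof. by move=> h p a c t q; have := h (b :: p) a c t q. Qed.

Lemma swapping_head f a b t q : swapping f ->
  f ((q ++ a ++ b) :: t) = sg (size a * size b) (f ((q ++ b ++ a) :: t)).
Proof. by move=> h; exact: (h [::]). Qed.

(** If [i] and [k] lie in different blocks the two insertions do not interact.
    If they lie in the same block, the first blocks of [v] and [u] end up in
    it in different orders, which is where antisymmetry is used. *)
Lemma wcomp_par f i k w v u : swapping f ->
  uniq (flatten w) -> i != k -> k \notin flatten v -> i \notin flatten u ->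
  blocky w -> blocky v -> v != [::] -> blocky u -> u != [::] ->
  wcomp (fun t => wcomp f k t u) i w v =
    sg (dims v * dims u) (wcomp (fun t => wcomp f i t v) k w u).
Proof.
move=> + + + + + + + v0 + u0.
case: u u0 => // d u _; case: v v0 => // c v _.
elim: w f i k c v d u => [|b w IH] f i k c v d u sf uw ik kv iu bw bv bu.
  by rewrite /= sg_0.
have [ub uw' dbw] := uniq_cons_block uw.
case/andP: (bw) => b0 bw'; case/andP: (bv) => c0 bv'; case/andP: (bu) => d0 bu'.
(* The letter [i] lies in the first block and [k] does not; the opposite case *)
(* is obtained from this one by exchanging the roles of [i] and [k]. *)
have H : forall i k c v d u, i != k -> k \notin flatten (c :: v) ->
   i \notin flatten (d :: u) -> blocky (c :: v) -> blocky (d :: u) ->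
   i \in b -> k \notin b ->
   wcomp (fun t => wcomp f k t (d :: u)) i (b :: w) (c :: v) =
    sg (dims (c :: v) * dims (d :: u)) (wcomp (fun t => wcomp f i t (c :: v)) k (b :: w) (d :: u)).
  move=> {ik kv iu bv bu c0 bv' d0 bu'} {}i {}k {}c {}v {}d {}u ik kv iu bv bu ib kb.
  case/andP: (bv) => c0 bv'; case/andP: (bu) => d0 bu'.
  rewrite wcomp_in // (eq_sh (g := fun t => wcomp (fun t => f ((rem i b ++ c) :: t)) k t (d :: u)));
    last first.
    move=> t; rewrite wcomp_notin // mem_cat negb_or; move: kv; rewrite mem_cat negb_or.
    case/andP=> -> _; rewrite andbT; apply: contra kb; exact: mem_rem.
  rewrite sh_wcompl //; last by move: kv; rewrite mem_cat negb_or => /andP[].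
  rewrite [in RHS]wcomp_notin // -!wcomp_sg; apply: wcomp_ext => // t /and3P[_ /eqP dt _].
  rewrite wcomp_in // !sg_sg dt; apply: sg_parity; rewrite !dims_cons; parity.
case: (boolP (i \in b)) => ib; case: (boolP (k \in b)) => kb.
- have [iu1 iu2] : i \notin d /\ i \notin flatten u.
    by apply/andP; rewrite -negb_or -mem_cat.
  have [kv1 kv2] : k \notin c /\ k \notin flatten v.
    by apply/andP; rewrite -negb_or -mem_cat.
  have E : forall i k c v d u, i \in b -> k \in b -> i != k ->
     wcomp (fun t => wcomp f k t (d :: u)) i (b :: w) (c :: v) =
     sg (after i b + dim c * dims w +
          (after k (rem i b) + size c + dim d * (dims w + dims v)))
       (shw (fun t => shw (fun t => f ((rem k (rem i b) ++ c ++ d) :: t)) w t) v u).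
    move=> {ik kv iu bv bu c0 bv' d0 bu' iu1 iu2 kv1 kv2 ib kb}.
    move=> {}i {}k {}c {}v {}d {}u ib kb ik.
    have kr : k \in rem i b by rewrite mem_rem_uniq // inE eq_sym ik.
    rewrite wcomp_in // (sh_ext (g := fun t =>
      sg (after k (rem i b) + size c + dim d * (dims w + dims v))
       (shw (fun t => f ((rem k (rem i b) ++ c ++ d) :: t)) t u))); last first.
      move=> t /shuffled_dims dt.
      by rewrite wcomp_in ?mem_cat ?kr // after_catl // rem_catl // -catA dt.
    by rewrite sh_sg sh_assoc sg_sg.
  rewrite !E // 1?eq_sym // sh_comm !dimsE !sg_sg.
  have -> : rem i (rem k b) = rem k (rem i b).
    rewrite !rem_filter ?filter_uniq //; rewrite -!filter_predI; apply: eq_filter => x.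
    exact: andbC.
  rewrite (eq_sh (g := fun t => sg (size c * size d) (shw (fun t => f ((rem k (rem i b) ++ d ++ c) :: t)) w t)));
    last by move=> t; rewrite -sh_sg; apply: eq_sh => ?; apply: swapping_head.
  rewrite sh_sg sg_sg; have := after_rem ub ib kb ik.
  have -> : size c = (dim c).+1 by case: (c) c0.
  have -> : size d = (dim d).+1 by case: (d) d0.
  rewrite !dims_cons => Ea; apply: sg_parity; move: Ea; rewrite !oddD.
  set P := odd (after i b); set Q := odd (after k (rem i b)).
  set R := odd (after k b); set S := odd (after i (rem k b)).
  rewrite ?(oddD, oddM, oddS) -/P -/Q -/R -/S.
  by move: P Q R S => [] [] [] [] //= _; parity.
- exact: H.
- rewrite [in RHS]H // 1?eq_sym // sg_sg sg_even // mulnC oddD addbb //.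
- rewrite !wcomp_notin //.
  rewrite (@eq_wcomp _ (fun t => wcomp (fun t => f (b :: t)) k t (d :: u)));
    last by move=> t; rewrite wcomp_notin.
  rewrite IH //; last exact: swapping_cons.
  by congr sg; apply: eq_wcomp => t; rewrite wcomp_notin.
Qed.

(** Either the first two blocks are merged or two later ones are; the sign of
    the first block occurs in both cases. *)
Fixpoint wdiff f w : A :=
  if w is b :: w' then
    sg (dim b) ((if w' is c :: w'' then f ((b ++ c) :: w'') else 0)
       + wdiff (fun t => f (b :: t)) w')
  else 0.

Definition merge_head f b w : A := if w is c :: w' then f ((b ++ c) :: w') else 0.

Lemma wdiff_cons f b w :
  wdiff f (b :: w) = sg (dim b) (merge_head f b w + wdiff (fun t => f (b :: t)) w).
Proof. by []. Qed.

Definition merged w t :=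
  [&& flatten t == flatten w, dims t == (dims w).+1 & blocky t].

Lemma dim_cat b c : b != [::] -> c != [::] -> dim (b ++ c) = (dim b + dim c).+1.
Proof. by case: b => // x b _; case: c => // y c _; rewrite /dim size_cat /= addnS. Qed.

Lemma wdiff_ext f g w : blocky w ->
  (forall t, merged w t -> f t = g t) -> wdiff f w = wdiff g w.
Proof.
elim: w f g => // b w IH f g /andP[b0 bw] h; rewrite !wdiff_cons.
congr (sg _ (_ + _)); last first.
  apply: IH => // t /and3P[/eqP p /eqP d bt]; apply: h; apply/and3P; split.
  - by rewrite /= p.
  - by rewrite !dims_cons d addnS.
  - by apply/andP.
case: w bw h {IH} => // c w /andP[c0 bw] h; apply: h; apply/and3P; split.
- by rewrite /= catA.
- by rewrite !dims_cons dim_cat // !addSn addnA.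
- by apply/andP; split=> //; case: (b) b0.
Qed.

Lemma eq_wdiff f g w : f =1 g -> wdiff f w = wdiff g w.
Proof.
elim: w f g => // b w IH f g h; rewrite !wdiff_cons; congr (sg _ (_ + _)).
  by case: w {IH} => /=.
exact: IH.
Qed.

Lemma wdiffD f g w : wdiff (fun t => f t + g t) w = wdiff f w + wdiff g w.
Proof.
elim: w f g => [|b w IH] f g; first by rewrite addr0.
rewrite !wdiff_cons IH -sgD addrACA; congr (sg _ (_ + _)).
by case: w {IH} => //=; rewrite addr0.
Qed.

Lemma wdiff_sg n f w : wdiff (fun t => sg n (f t)) w = sg n (wdiff f w).
Proof.
elim: w f => [|b w IH] f; first by rewrite sg_0.
rewrite !wdiff_cons IH.
have -> : merge_head (fun t => sg n (f t)) b w = sg n (merge_head f b w).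
  by case: w {IH} => //=; rewrite sg_0.
by rewrite -sgD !sg_sg addnC.
Qed.

(** Merging two disjoint pairs of blocks in either order gives opposite signs,
    and so do the two ways of merging three consecutive blocks. *)
Lemma wdiff_wdiff f w : blocky w -> wdiff (fun t => wdiff f t) w = 0.
Proof.
elim: w f => // b w IH f /andP[b0 bw]; rewrite wdiff_cons.
rewrite (@eq_wdiff _ (fun t => sg (dim b) (merge_head f b t + wdiff (fun t => f (b :: t)) t)))
  // wdiff_sg wdiffD IH // addr0.
case: w bw {IH} => [|c w]; first by rewrite /= sg_0 addr0 sg_0.
case/andP=> c0 bw.
have E1 : merge_head (fun t => wdiff f t) b (c :: w) =
    sg (dim b + dim c).+1 (merge_head f (b ++ c) w + wdiff (fun t => f ((b ++ c) :: t)) w).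
  by rewrite -dim_cat.
have E2 : wdiff (fun t => merge_head f b t) (c :: w) =
    sg (dim c) (merge_head f (b ++ c) w + wdiff (fun t => f ((b ++ c) :: t)) w).
  by rewrite wdiff_cons; congr (sg _ (_ + _)); case: w {bw E1} => //= d w; rewrite catA.
rewrite E1 E2 sg_sg sg_odd_opp ?sg_0 //.
by rewrite ?(oddD, oddS); case: odd; case: odd.
Qed.

Lemma size_dim b : b != [::] -> size b = (dim b).+1.
Proof. by case: b. Qed.
(** Merging commutes with shuffling except where blocks of the two factors
    become neighbours: the merged blocks [a ++ b] and [b ++ a] that appear
    then cancel by antisymmetry. *)
Lemma sh_wdiff f x y : swapping f -> blocky x -> blocky y ->
  shw (wdiff f) x y =
    wdiff (fun t => shw f t y) x + sg (dims x) (wdiff (fun t => shw f x t) y).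
Proof.
elim: x f y => [|a x IHx] f y; first by move=> _ _ _; rewrite sh0s /= add0r; apply: eq_wdiff.
elim: y f => [|b y IHy] f sf bx yb.
  rewrite shs0 [wdiff _ [::]]/= sg_0 addr0; apply: eq_wdiff => t; by rewrite shs0.
case/andP: (bx) => a0 bx'; case/andP: (yb) => b0 by'.
rewrite sh_cons.
rewrite (@eq_sh _ _ _ _ (fun t => sg (dim a) (merge_head f a t + wdiff (fun t => f (a :: t)) t))) //.
rewrite [X in sg (dim b * _) X](@eq_sh _ _ _ _ (fun t => sg (dim b) (merge_head f b t + wdiff (fun t => f (b :: t)) t))) //.
rewrite !sh_sg !shD IHx ?IHy //; try exact: swapping_cons.
rewrite !wdiff_cons.
have E1 : wdiff (fun t => shw f (a :: t) (b :: y)) x =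
    wdiff (fun t => shw (fun t => f (a :: t)) t (b :: y)) x
    + sg (dim b * (dim a + (dims x).+1)) (wdiff (fun t => shw (fun t => f (b :: t)) (a :: t) y) x).
  rewrite -wdiff_sg -wdiffD; apply: wdiff_ext => // t /and3P[_ /eqP dt _].
  by rewrite sh_cons !dimsE dims_cons dt.
have E2 : wdiff (fun t => shw f (a :: x) (b :: t)) y =
    wdiff (fun t => shw (fun t => f (a :: t)) x (b :: t)) y
    + sg (dim b * dims (a :: x)) (wdiff (fun t => shw (fun t => f (b :: t)) (a :: x) t) y).
  by rewrite -wdiff_sg -wdiffD.
rewrite E1 E2 {E1 E2 IHx IHy}.
set D1 := wdiff _ x; set D2 := wdiff _ y; set D3 := wdiff _ x; set D4 := wdiff _ y.
set S := merge_head _ a x; set Q := merge_head _ b y.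
set N1 := merge_head _ a x; set N2 := merge_head _ b y.
set P := shw (fun t => f ((a ++ b) :: t)) x y.
(* [P] is the sum in which [a] and [b] are merged. It arises once from each of *)
(* the two shuffles below, with opposite signs; [R] and [R'] are the rest. *)
have [R [-> ->]] : exists R, shw (merge_head f a) x (b :: y) = R + sg (dim b * dims x) P
    /\ N1 = R + sg (dim b * (dim a + (dims x).+1)) S.
  rewrite {}/N1 {}/S {}/P {D1 D2 D3 D4 Q N2 bx}.
  case: x bx' => [|c x] bx' /=.
    by exists 0; rewrite add0r muln0 sg_0 addr0.
  case/andP: bx' => c0 _; exists (shw (fun t => f ((a ++ c) :: t)) x (b :: y)).
  split; rewrite sh_cons // !dimsE !dims_cons dim_cat //.
  by congr (_ + sg _ _); lia.
have [R' [-> ->]] : exists R',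
    shw (merge_head f b) (a :: x) y = sg (size a * size b) P + R'
    /\ N2 = Q + sg ((dim b).+1 * dims (a :: x)) R'.
  rewrite {}/N2 {}/Q {}/P {D1 D2 D3 D4 N1 S yb R}.
  have EP : shw (fun t => f ((b ++ a) :: t)) x y =
       sg (size a * size b) (shw (fun t => f ((a ++ b) :: t)) x y).
    rewrite -sh_sg; apply: eq_sh => t; rewrite mulnC.
    exact: (@swapping_head f b a t [::] sf).
  case: y by' EP => [|d y] by' EP.
    by exists 0; rewrite -EP !shs0 sg_0 !addr0.
  case/andP: by' => d0 _; exists (sg (dim d * dims (a :: x)) (shw (fun t => f ((b ++ d) :: t)) (a :: x) y)).
  rewrite sh_cons EP; split=> //.
  rewrite /merge_head sh_cons sg_sg dim_cat //; congr (_ + _); apply: sg_parity; rewrite !dimsE; parity.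
rewrite (size_dim a0) (size_dim b0) !sgD !sg_sg !dimsE !dims_cons.
rewrite [LHS](AC ((2*(1*2))*(2*3)) ((((1*8)*(3*9))*((4*7)*(5*10)))*(2*6))) /=.
rewrite [X in _ + X]sg_odd_opp ?addr0; last by parity.
by congr (((_ + _) + (_ + _)) + ((_ + _) + (_ + _))); apply: sg_parity; parity.
Qed.

Lemma wdiff_0 w : wdiff (fun=> 0) w = 0.
Proof. by elim: w => // b w IH; rewrite wdiff_cons IH addr0; case: w {IH} => *; exact: sg_0. Qed.
(** The terms in which the block of [i] absorbs a further block, of [w] or of
    [v], are matched separately; the others are covered by [sh_wdiff]. *)
Lemma wcomp_wdiff f i w v : swapping f -> uniq (flatten w) ->
  blocky w -> blocky v -> v != [::] ->
  wcomp (wdiff f) i w v =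
    wdiff (fun t => wcomp f i t v) w + sg (dims w) (wdiff (fun t => wcomp f i w t) v).
Proof.
move=> + + + + v0; case: v v0 => // c v _; elim: w f => [|b w IH] f sf uw bw bv.
  by rewrite [wcomp _ _ _ _]/= [wdiff _ [::]]/= add0r wdiff_0.
have [ub uw' dbw] := uniq_cons_block uw.
case/andP: (bw) => b0 bw'; case/andP: (bv) => c0 bv'.
case: (boolP (i \in b)) => ib; last first.
  rewrite wcomp_notin // (@eq_wcomp _ (fun t => sg (dim b) (merge_head f b t + wdiff (fun t => f (b :: t)) t))) //.
  rewrite wcomp_sg wcompD IH //; last exact: swapping_cons.
  rewrite [wdiff _ (b :: w)]wdiff_cons (@eq_wdiff (fun t => wcomp f i (b :: t) (c :: v)) (fun t => wcomp (fun t => f (b :: t)) i t (c :: v)));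
    last by move=> t; rewrite wcomp_notin.
  rewrite (@eq_wdiff (fun t => wcomp f i (b :: w) t) (fun t => wcomp (fun t => f (b :: t)) i w t));
    last by move=> t; rewrite wcomp_notin.
  have -> : merge_head (fun t => wcomp f i t (c :: v)) b w = wcomp (merge_head f b) i w (c :: v).
    case: w {IH uw bw uw' dbw bw'} => //= d w.
    rewrite mem_cat (negbTE ib) /=; case: ifP => id; last first.
      by apply: eq_wcomp => t.
    rewrite after_catr // rem_catr //; congr sg; apply: eq_sh => t /=.
    by rewrite catA.
  by rewrite dims_cons !sgD !sg_sg addrA.
have iw : i \notin flatten w by apply: dbw.
set B := rem i b ++ c.
have B0 : B != [::] by rewrite /B; case: (rem i b) => //.
rewrite wcomp_in // (@eq_sh _ _ _ _ (fun t => sg (dim B) (merge_head f B t + wdiff (fun t => f (B :: t)) t))) //.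
rewrite sh_sg shD sh_wdiff //; last exact: swapping_cons.
rewrite !wdiff_cons.
rewrite (@wdiff_ext (fun t => wcomp f i (b :: t) (c :: v)) (fun t => sg (after i b + dim c * (dims w).+1) (shw (fun t => f (B :: t)) t v))) //;
  last by move=> t /and3P[_ /eqP dt _]; rewrite wcomp_in // dt.
rewrite (@eq_wdiff (fun t => wcomp f i (b :: w) (c :: t)) (fun t => sg (after i b + dim c * dims w) (shw (fun t => f (B :: t)) w t))) //;
  last by move=> t; rewrite wcomp_in.
rewrite !wdiff_sg dim_wcomp //.
set D1 := wdiff _ w; set D2 := wdiff _ v; set N1 := merge_head _ b w; set N2 := merge_head _ c v.
(* [R] and [R'] collect the terms in which the merged block absorbs the next *)
(* block of [w] and of [v], respectively. *)
have [R [R' [-> -> ->]]] : exists R R', [/\ shw (merge_head f B) w v = R + R',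
    N1 = sg (after i b + dim c * (dims w).+1) R &
    N2 = sg (after i b + dim c * dims w + dims w) R'].
  exists (if w is d :: w' then shw (fun t => f ((B ++ d) :: t)) w' v else 0).
  exists (if v is e :: v' then
    sg (dim e * dims w) (shw (fun t => f ((B ++ e) :: t)) w v') else 0).
  split.
  - case: w {uw bw IH uw' dbw bw' D1 D2 N1 N2 iw} => [|d w].
      case: (v) => [|e v']; first by rewrite addr0.
      by rewrite add0r [dims [::]]/= muln0.
    by case: (v) => [|e v']; rewrite ?addr0 ?shs0.
  - rewrite {}/N1 {D1 D2 N2}; case: w {IH uw iw} bw uw' dbw bw' => [|d w] bw uw' dbw bw'.
      by rewrite sg_0.
    case/andP: bw' => d0 bw'; rewrite /merge_head wcomp_in ?mem_cat ?ib // after_catl // rem_catl //.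
    rewrite (@eq_sh _ _ _ _ (fun t => sg (size d * size c) (f ((B ++ d) :: t)))).
      rewrite sh_sg sg_sg (size_dim d0) (size_dim c0) dims_cons.
      by apply: sg_parity; parity.
    by move=> t; rewrite -catA (swapping_head d c) // /B catA.
  - rewrite {}/N2 {D1 D2 N1}; case: v {bv IH} bv' => [|e v] bv'.
      by rewrite sg_0.
    case/andP: bv' => e0 bv'; rewrite /merge_head wcomp_in // dim_cat // sg_sg /B.
    rewrite (@eq_sh _ _ _ _ (fun t => f (((rem i b ++ c) ++ e) :: t))); last by move=> t; rewrite catA.
    by apply: sg_parity; parity.
rewrite !sgD !sg_sg dims_cons.
rewrite [LHS](AC (2*2) ((1*3)*(2*4))) /=.
by congr ((_ + _) + (_ + _)); apply: sg_parity; parity.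
Qed.

Lemma wcomp_1l f i v : v != [::] -> wcomp f i [:: [:: i]] v = f v.
Proof.
by case: v => // c v _; rewrite wcomp_in ?inE // /= eqxx muln0 /after /= eqxx.
Qed.

(** The letter [i], which the composition moves to the end of its block, is
    moved back to its place by antisymmetry. *)
Lemma wcomp_1r f i w : swapping f -> i \in flatten w -> wcomp f i w [:: [:: i]] = f w.
Proof.
elim: w f => // b w IH f sf; rewrite /= mem_cat; case: (boolP (i \in b)) => ib.
  move=> _; rewrite shs0 mul0n addn0 remE -catA.
  rewrite (@swapping_head f (drop (index i b).+1 b) [:: i]) //.
  rewrite sg_sg muln1 size_drop sg_even ?oddD ?addbb //.
  by rewrite cat1s -drop_index // cat_take_drop.
by move=> /IH -> //; exact: swapping_cons.
Qed.
End Words.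

Arguments wcomp_ext {A} f g i w v.
Arguments eq_wcomp {A} f g i w v.
Arguments wdiff_ext {A} f g w.
Arguments eq_wdiff {A} f g w.

Section Naturality.
Variables A B : zmodType.
Implicit Types (w v : word).

Lemma raddf_wcomp (h : {additive A -> B}) f i w v :
  h (wcomp f i w v) = wcomp (fun t => h (f t)) i w v.
Proof.
elim: w f => [|b w IH] f /=; first exact: raddf0.
by case: ifP => _; rewrite ?IH // raddf_sg raddf_sh.
Qed.

Lemma raddf_wdiff (h : {additive A -> B}) f w :
  h (wdiff f w) = wdiff (fun t => h (f t)) w.
Proof.
elim: w f => [|b w IH] f; first exact: raddf0.
rewrite !wdiff_cons raddf_sg raddfD IH; congr (sg _ (_ + _)).
by case: w {IH} => //=; exact: raddf0.
Qed.

Definition relabel (r : nat -> nat) (w : word) : word := map (map r) w.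

Lemma relabel_comp r s w : relabel r (relabel s w) = relabel (r \o s) w.
Proof.
rewrite /relabel -map_comp; apply: eq_map => b /=; by rewrite -map_comp.
Qed.

Lemma eq_relabel (r s : nat -> nat) w :
  (forall x : nat, x \in flatten w -> r x = s x) -> relabel r w = relabel s w.
Proof.
move=> h; apply/eq_in_map => b bw; apply/eq_in_map => x xb; apply: h.
by apply/flattenP; exists b.
Qed.

Lemma flatten_relabel r w : flatten (relabel r w) = map r (flatten w).
Proof. by rewrite map_flatten. Qed.

Lemma dims_relabel r w : dims (relabel r w) = dims w.
Proof.
rewrite /dims -map_comp; congr sumn; apply: eq_map => b.
by rewrite /= /dim size_map.
Qed.

Lemma blocky_relabel r w : blocky (relabel r w) = blocky w.
Proof. by rewrite /blocky all_map; apply: eq_all => -[]. Qed.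

Lemma relabel_id r w : {in flatten w, r =1 id} -> relabel r w = w.
Proof.
move=> h; rewrite -[RHS]map_id; apply/eq_in_map => b bw.
rewrite -[RHS]map_id; apply/eq_in_map => x xb; apply: h.
by apply/flattenP; exists b.
Qed.

Lemma wcomp_relabel (f : word -> A) r i j w v : j = r i ->
  {in flatten w, forall x, r x = r i -> x = i} ->
  wcomp f j (relabel r w) (relabel r v) = wcomp (fun t => f (relabel r t)) i w v.
Proof.
move=> -> {j}; elim: w f => //= b w IH f h.
have hb : {in b, forall x, r x = r i -> x = i}.
  by move=> x xb; apply: h; rewrite mem_cat xb.
have -> : (r i \in map r b) = (i \in b).
  apply/mapP/idP => [[x xb rx]|ib]; first by rewrite -(hb x xb (esym rx)).
  by exists i.
case: ifP => ib; last first.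
  by rewrite IH // => x xw; apply: h; rewrite mem_cat xw orbT.
have E : {in b, forall x, (r x == r i) = (x == i)}.
  by move=> x xb; apply/eqP/eqP => [/(hb x xb)|->].
have -> : rem (r i) (map r b) = map r (rem i b).
  elim: b {hb h ib} E => //= x b IHb E; rewrite (E x) ?inE ?eqxx //.
  case: ifP => //= _; rewrite IHb // => y yb; apply: E; by rewrite inE yb orbT.
have -> : after (r i) (map r b) = after i b.
  rewrite /after size_map; congr (_ - _.+1)%N.
  elim: b {hb h ib} E => //= x b IHb E; rewrite (E x) ?inE ?eqxx //.
  by case: ifP => //= _; rewrite IHb // => y yb; apply: E; rewrite inE yb orbT.
have -> : head [::] (relabel r v) = map r (head [::] v) by case: (v).
have -> : behead (relabel r v) = relabel r (behead v) by case: (v).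
rewrite [dim (map _ _)]/dim size_map -/(dim _) dims_relabel; congr sg.
rewrite /relabel (@sh_map _ _ dim); first by apply: eq_sh => t; rewrite map_cat.
by move=> a; rewrite /dim size_map.
Qed.

Lemma wdiff_relabel (f : word -> A) r w :
  wdiff f (relabel r w) = wdiff (fun t => f (relabel r t)) w.
Proof.
elim: w f => // b w IH f; rewrite [relabel _ _]/= !wdiff_cons IH.
rewrite [dim (map _ _)]/dim size_map; congr (sg _ (_ + _)).
by case: w {IH} => //= c w; rewrite map_cat.
Qed.
End Naturality.

(** * Expressions of [Pi] and their signs *)

Ltac odd_cases :=
  repeat match goal with |- context [odd ?x] => case: (odd x) end; by [].

(** The sign of the permutation that sorts a block is the parity of its number
    of inversions, which is additive up to [cross] and therefore easier to
    follow through compositions than [wedge_sign]. *)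
Fixpoint ninv (b : block) : nat :=
  if b is x :: b' then (count (fun y => y < x) b' + ninv b')%N else 0%N.

Definition ninvs (w : word) : nat := sumn (map ninv w).
Definition sortw (w : word) : word := map (sort leq) w.

Definition cross (a b : block) : nat :=
  sumn [seq count (fun y => y < x)%N b | x <- a].

Lemma ninv_cat a b : ninv (a ++ b) = (ninv a + ninv b + cross a b)%N.
Proof.
elim: a => [|x a IH] /=; first by rewrite addn0.
by rewrite IH count_cat /cross /=; lia.
Qed.

Lemma cross_perm a a' b b' : perm_eq a a' -> perm_eq b b' ->
  cross a b = cross a' b'.
Proof.
move=> pa pb; rewrite /cross (perm_sumn (perm_map _ pa)); congr sumn.
by apply: eq_map => x; apply/permP.
Qed.

Lemma crossC a b : (forall x, x \in a -> x \notin b) ->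
  (cross a b + cross b a = size a * size b)%N.
Proof.
elim: a => [|x a IH] h; rewrite /cross /=.
  by elim: b {h} => //= y b ->.
rewrite -/(cross a b) mulSn -IH; last by move=> y ya; apply: h; rewrite inE ya orbT.
have -> : sumn [seq ((x < y) + count (fun z => z < y) a)%N | y <- b] =
  (count (fun y => x < y) b + cross b a)%N.
  by elim: b {h IH} => //= y b ->; rewrite /cross /=; lia.
have : (count (fun y => y < x) b + count (fun y => x < y) b = size b)%N.
  have: x \notin b by apply: h; rewrite inE eqxx.
  by elim: b {h IH} => //= y b IH; rewrite inE negb_or => /andP[xy /IH]; case: ltngtP xy => //; lia.
by move=> <-; rewrite addnACA.
Qed.

Lemma count_remE a i (b : block) : i \in b ->
  count a b = (a i + count a (rem i b))%N.
Proof. by move=> ib; have /permP -> := perm_to_rem ib. Qed.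

(** Moving [i] to the end of the block [b] takes [after i b] transpositions, and
    the letters larger than [i] then form inversions with it. *)
Lemma ninv_rem i b : uniq b -> i \in b ->
  odd (ninv b + after i b) = odd (ninv (rem i b) + count (fun y => i < y) b)%N.
Proof.
elim: b => //= x b IH /andP[xb ub]; rewrite inE eq_sym.
have [xi _|xi /= ib] := eqVneq x i.
  subst x; have -> : after i (i :: b) = size b by rewrite /after /= eqxx subn1.
  have <- : (count (fun y => y < i) b + count (fun y => i < y) b = size b)%N.
    elim: b xb {IH ub} => //= y b IH; rewrite inE negb_or => /andP[xy /IH].
    by case: ltngtP xy => //; lia.
  by rewrite ?eqxx ltnn add0n; parity.
rewrite (count_remE _ ib) /=; have := IH ub ib.
have -> : after i (x :: b) = after i b by rewrite /after /= (negbTE xi).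
by rewrite !oddD; odd_cases.
Qed.

Lemma ninv_sorted b : sorted leq b -> ninv b = 0%N.
Proof.
elim: b => //= x b IH xb; rewrite IH ?(path_sorted xb) // addn0.
apply/eqP; rewrite -leqn0 leqNgt -has_count; apply/hasPn => y yb.
by rewrite -leqNgt; apply: (allP (order_path_min leq_trans xb)).
Qed.

Lemma sort_leq_sorted b : sorted leq (sort leq b).
Proof. by apply: sort_sorted => x y; exact: leq_total. Qed.

Lemma ninv_sort b : ninv (sort leq b) = 0%N.
Proof. exact/ninv_sorted/sort_leq_sorted. Qed.

Lemma ninv_map r b : {in b &, {mono r : x y / (x < y)%N}} -> ninv (map r b) = ninv b.
Proof.
elim: b => //= x b IH h; rewrite IH; last first.
  by move=> y z yb zb; apply: h; rewrite inE ?yb ?zb orbT.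
rewrite count_map; congr addn; apply: eq_in_count => y yb /=.
by rewrite h // inE ?eqxx // yb orbT.
Qed.

Lemma sort_perm a b : perm_eq a b -> sort leq a = sort leq b.
Proof. by move=> h; apply/(perm_sortP leq_total leq_trans anti_leq). Qed.

Lemma sort_sort b : sort leq (sort leq b) = sort leq b.
Proof. by apply: sort_perm; rewrite perm_sort. Qed.

Lemma sortw_sortw w : sortw (sortw w) = sortw w.
Proof. by rewrite /sortw -map_comp; apply: eq_map => b /=; exact: sort_sort. Qed.

Lemma ninvs_sortw w : ninvs (sortw w) = 0%N.
Proof. by rewrite /ninvs /sortw -map_comp; elim: w => //= b w ->; rewrite ninv_sort. Qed.

Lemma ninvs_cons b w : ninvs (b :: w) = (ninv b + ninvs w)%N. Proof. by []. Qed.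

Lemma ninvs_cat v w : ninvs (v ++ w) = (ninvs v + ninvs w)%N.
Proof. by rewrite /ninvs map_cat sumn_cat. Qed.

Lemma ninv_min y b : y \in b -> uniq b -> all (leq y) b ->
  ninv b = (index y b + ninv (rem y b))%N.
Proof.
elim: b => //= x b IH; rewrite inE eq_sym; have [->|xy] := eqVneq x y.
  move=> _ /andP[yb _] /andP[_ ya]; rewrite (_ : count _ _ = 0)%N //.
  apply/eqP; rewrite -leqn0 leqNgt -has_count; apply/hasPn => z zb.
  by rewrite -leqNgt; exact: (allP ya).
move=> /= yb /andP[_ ub] /andP[yx ya]; rewrite IH // (count_remE _ yb).
by rewrite ltn_neqAle eq_sym xy yx /=; lia.
Qed.

(** The recursion defining [wedge_sign] removes the smallest letter first,
    whereas the one of [ninv] removes the first letter; [ninv_min] relates the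
    two. *)
Lemma wedge_sign_sort b : uniq b -> wedge_sign b (sort leq b) = (-1) ^+ ninv b.
Proof.
move=> ub; have := sort_leq_sorted b.
have : perm_eq (sort leq b) b by rewrite perm_sort.
move: (sort leq b) ub => ys; rewrite /wedge_sign.
elim: ys b => [|y ys IH] b ub pb; first by move: pb; rewrite perm_sym => /perm_nilP->.
have yb : y \in b by rewrite -(perm_mem pb) inE eqxx.
rewrite [sorted _ _]/= => yys /=; rewrite IH ?rem_uniq ?(path_sorted yys) //; last first.
  by rewrite -(perm_cons y) (permPl pb) perm_to_rem.
have ya : all (leq y) b.
  by rewrite -(perm_all _ pb) /= leqnn (order_path_min leq_trans yys).
rewrite (ninv_min yb) // exprD mul1n; congr (_ ^+ _ * _).
have -> : map (fun=> 1%N) (take (index y b) b) = nseq (index y b) 1%N.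
  rewrite -[in RHS](size_takel (index_size y b)); elim: (take _ _) => //= _ s <- //.
by rewrite sumn_nseq mul1n.
Qed.

Lemma flatten_sortw w : perm_eq (flatten (sortw w)) (flatten w).
Proof. by elim: w => //= b w IH; rewrite perm_cat // perm_sort. Qed.

Lemma dims_sortw w : dims (sortw w) = dims w.
Proof. by rewrite /dims -map_comp; congr sumn; apply: eq_map => b; rewrite /= /dim size_sort. Qed.

Lemma blocky_sortw w : blocky (sortw w) = blocky w.
Proof. by rewrite /blocky all_map; apply: eq_all => b /=; rewrite -!size_eq0 size_sort. Qed.

Lemma is_expr_sortw n k w : is_expr n k (sortw w) = is_expr n k w.
Proof.
rewrite /is_expr dims_sortw -/(blocky (sortw w)) blocky_sortw.
by rewrite (permPl (flatten_sortw w)).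
Qed.

Lemma expr_out n k w : ~~ is_expr n k w -> expr n k w = 0.
Proof.
move=> h; rewrite /expr insubN // -/(sortw w) is_expr_sortw (negbTE h).
by [].
Qed.

Lemma is_expr_blocky n k w : is_expr n k w -> blocky w.
Proof. by case/and4P. Qed.

Lemma is_expr_uniq n k w : is_expr n k w -> uniq (flatten w).
Proof. by case/and4P=> _ _ p _; rewrite (perm_uniq p) iota_uniq. Qed.

Lemma is_expr_mem n k w : is_expr n k w -> forall x, (x \in flatten w) = (0 < x <= n)%N.
Proof. by case/and4P=> _ _ p _ x; rewrite (perm_mem p) mem_iota add1n ltnS. Qed.

Lemma is_expr_dims n k w : is_expr n k w -> dims w = k.
Proof. by case/and4P=> _ _ _ /eqP. Qed.

Lemma is_expr_gt0 n k w : is_expr n k w -> (0 < n)%N.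
Proof. by case/and4P. Qed.

Lemma is_expr_size n k w : is_expr n k w -> size (flatten w) = n.
Proof. by case/and4P=> _ _ p _; rewrite (perm_size p) size_iota. Qed.

Lemma is_expr_nil n k w : is_expr n k w -> w != [::].
Proof. by case: w => // h; have := is_expr_gt0 h; rewrite -(is_expr_size h). Qed.

Lemma uniq_block (w : word) (b : block) : uniq (flatten w) -> b \in w -> uniq b.
Proof.
elim: w => //= c w IH /uniq_cons_block[uc uw _]; rewrite inE => /orP[/eqP->//|].
exact: IH.
Qed.

Lemma wedge_signs (w : word) : uniq (flatten w) ->
  \prod_(s <- w) wedge_sign s (sort leq s) = (-1) ^+ ninvs w.
Proof.
elim: w => [|b w IH] uw; first by rewrite big_nil.
have [ub uw' _] := uniq_cons_block uw.
by rewrite big_cons IH // wedge_sign_sort // -exprD.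
Qed.

Lemma signU n (T : choiceType) (b : T) :
  << (-1) ^+ n *g b >> = sg n (<< b >> : {freeg T / int}).
Proof.
rewrite -sgE freeg_mulz; congr (<< _ *g _ >>).
by rewrite -mulrzl mulr1 intz.
Qed.

Lemma sort_ltn b : uniq b -> sorted ltn (sort leq b).
Proof. by move=> ub; rewrite ltn_sorted_uniq_leq sort_uniq ub sort_leq_sorted. Qed.

Lemma insub_expr n k w : is_expr n k w ->
  exists2 b : pi_basis n k, insub (sortw w) = Some b & val b = sortw w.
Proof.
move=> h; case: insubP => [b _ vb|]; first by exists b.
rewrite is_expr_sortw h /=; case/negP; apply/allP => _ /mapP[b bw ->].
exact/sort_ltn/(uniq_block (is_expr_uniq h) bw).
Qed.

Lemma exprE n k w b : is_expr n k w -> insub (sortw w) = Some b ->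
  expr n k w = sg (ninvs w) << b >>.
Proof.
move=> h; rewrite /expr -/(sortw w) => ->.
by rewrite wedge_signs ?(is_expr_uniq h) // signU.
Qed.

(** Everything about [expr] is reduced to increasing blocks in this way. *)
Lemma expr_alt n k w : expr n k w = sg (ninvs w) (expr n k (sortw w)).
Proof.
case h : (is_expr n k w); last by rewrite !expr_out ?is_expr_sortw ?h // sg_0.
have [b eb _] := insub_expr h.
rewrite (exprE h eb) (@exprE _ _ (sortw w) b) ?is_expr_sortw ?sortw_sortw // ninvs_sortw.
by [].
Qed.

Lemma sortw_id n k (b : pi_basis n k) : sortw (val b) = val b.
Proof.
case: b => w /= /andP[_ /allP h]; rewrite /sortw -[RHS]map_id.
apply/eq_in_map => b bw; apply: sorted_sort; first exact: leq_trans.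
exact/(sub_sorted ltnW)/h.
Qed.

Lemma is_expr_val n k (b : pi_basis n k) : is_expr n k (val b).
Proof. by case: b => w /= /andP[]. Qed.

Lemma expr_val n k (b : pi_basis n k) : expr n k (val b) = << b >>.
Proof.
rewrite (@exprE _ _ _ b) ?is_expr_val // ?sortw_id ?valK //.
by rewrite -sortw_id ninvs_sortw.
Qed.

Lemma expr_swapping n k : swapping (expr n k).
Proof.
move=> p a b t q; set w := _ ++ _; set w' := _ ++ _.
have e : sortw w = sortw w'.
  rewrite /sortw !map_cat /=; congr (_ ++ _ :: _); apply: sort_perm.
  by rewrite perm_cat2l perm_catC.
case h : (is_expr n k w); last first.
  by rewrite !expr_out ?sg_0 // -is_expr_sortw -?e ?is_expr_sortw h.
rewrite (expr_alt _ _ w) (expr_alt _ _ w') e sg_sg.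
apply: sg_parity; rewrite /w /w' !ninvs_cat !ninvs_cons !ninv_cat.
have dab : forall x, x \in a -> x \notin b.
  have := is_expr_uniq h; rewrite /w flatten_cat cat_uniq => /and3P[_ _].
  rewrite /= !cat_uniq => /andP[/and3P[_ _ /and3P[_ /hasPn hh _]] _] x xa.
  by apply/negP => /hh; rewrite /= xa.
have := congr1 odd (crossC dab); rewrite oddD => E.
have pab : perm_eq (a ++ b) (b ++ a) by rewrite perm_catC.
rewrite (cross_perm (perm_refl q) pab) !oddD -E.
by odd_cases.
Qed.

(** The increasing expressions form a basis, so all expressions generate. *)
Lemma Pi_ind n k (A : zmodType) (f g : {additive Pi_mod n k -> A}) :
  (forall w, is_expr n k w -> f (expr n k w) = g (expr n k w)) -> f =1 g.
Proof.
move=> h x; rewrite -[x]freeg_sumE !raddf_sum; apply: eq_bigr => b _.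
have -> : << coeff b x *g b >> = expr n k (val b) *~ coeff b x.
  by rewrite expr_val freeg_mulz -mulrzl mulr1 intz.
by rewrite !raddfMz h // is_expr_val.
Qed.

(** * The operations of [Pi] on expressions *)

(** The sum over the permutations that are shuffles, weighted by the Koszul
    sign, is the recursively defined [sh]. This needs distinct entries: with
    repetitions a word could be a shuffle in several ways. *)
Section Shuffles.
Variables (T : eqType) (deg : T -> nat) (A : zmodType).
Implicit Types (s t u : seq T) (f : seq T -> A).

Lemma mem_shuffles s t u : (u \in shuffles s t) = shuffled s t u.
Proof. by rewrite mem_filter mem_permutations andbC. Qed.

Lemma shuffles0 t : perm_eq (shuffles [::] t) [:: t].
Proof.
apply: uniq_perm; rewrite ?filter_uniq ?permutations_uniq // => u.
rewrite mem_shuffles inE; apply/and3P/eqP => [[p _ s]|->].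
  by apply/esym/eqP; rewrite -(size_subseq_leqif s).2 (perm_size p).
by rewrite perm_refl sub0seq subseq_refl.
Qed.

Lemma shuffless0 t : perm_eq (shuffles t [::]) [:: t].
Proof.
apply: uniq_perm; rewrite ?filter_uniq ?permutations_uniq // => u.
rewrite mem_shuffles inE; apply/and3P/eqP => [[p s _]|->].
  by apply/esym/eqP; rewrite -(size_subseq_leqif s).2 (perm_size p) cats0.
by rewrite cats0 perm_refl sub0seq subseq_refl.
Qed.

Lemma shuffles_cons a s b t : uniq (a :: s ++ b :: t) ->
  perm_eq (shuffles (a :: s) (b :: t))
    (map (cons a) (shuffles s (b :: t)) ++ map (cons b) (shuffles (a :: s) t)).
Proof.
move=> U; have ab : a != b.
  by apply: contraTneq U => ->; rewrite /= mem_cat inE eqxx orbT.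
have inj c : injective (cons c : seq T -> seq T) by move=> x y [].
apply: uniq_perm.
- by rewrite filter_uniq ?permutations_uniq.
- rewrite cat_uniq !map_inj_uniq ?filter_uniq ?permutations_uniq // andbT /=.
  apply/hasPn => _ /mapP[u _ ->]; apply/mapP => -[v _ [ba]].
  by rewrite ba eqxx in ab.
move=> u; rewrite mem_cat mem_shuffles; apply/and3P/orP.
  case: u => [[/perm_size//]|c u [p sa sb]].
  have uu : uniq (c :: u) by rewrite (perm_uniq p).
  have [ca|ca] := eqVneq c a.
    left; apply/mapP; exists u; last by rewrite ca.
    rewrite mem_shuffles; apply/and3P; split.
    - by move: p; rewrite ca /= perm_cons.
    - by move: sa; rewrite ca /= eqxx.
    - by move: sb; rewrite ca /= eq_sym (negbTE ab).
  have [cb|cb] := eqVneq c b.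
    right; apply/mapP; exists u; last by rewrite cb.
    rewrite mem_shuffles; apply/and3P; split.
    - rewrite -(perm_cons b) -cb; apply: perm_trans p _; rewrite cb.
      by rewrite perm_catC -cat_cons perm_cons perm_catC.
    - by move: sa; rewrite cb /= (negbTE ab).
    - by move: sb; rewrite cb /= eqxx.
  move: sa sb; rewrite /= !(eq_sym _ c) (negbTE ca) (negbTE cb) => sa sb.
  have [/negP cu _] := andP uu.
  have : c \in (a :: s) ++ (b :: t) by rewrite -(perm_mem p) inE eqxx.
  rewrite mem_cat => /orP[] cx; case: cu.
    exact: (mem_subseq sa).
  exact: (mem_subseq sb).
case=> /mapP[v]; rewrite mem_shuffles => /and3P[p sa sb] ->.
  split; first by rewrite /= perm_cons.
    by rewrite /= eqxx.
  by apply: (subseq_trans sb (subseq_cons _ _)).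
split; last by rewrite /= eqxx.
  by rewrite perm_sym perm_catC /= perm_cons perm_catC perm_sym.
by apply: (subseq_trans sa (subseq_cons _ _)).
Qed.

Lemma koszul_head y ys s t : y \notin s ->
  koszul deg (s ++ y :: t) (y :: ys) =
    (-1) ^+ (deg y * degs deg s) * koszul deg (s ++ t) ys.
Proof.
move=> ys'; rewrite /= index_cat (negbTE ys') /= eqxx addn0 take_size_cat //.
congr (_ * koszul _ _ _); elim: s ys' => //= [|x s IH]; first by rewrite eqxx.
by rewrite inE eq_sym negb_or; case: eqP => //= _ /IH ->.
Qed.

Lemma shufflesE f s t : uniq (s ++ t) ->
  \sum_(u <- shuffles s t) f u *~ koszul deg (s ++ t) u = sh deg f s t.
Proof.
elim: s f t => [|a s IHs] f t ut.
  rewrite (perm_big _ (shuffles0 t)) big_seq1 sh0s /=.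
  suff -> : koszul deg t t = 1 by rewrite mulr1z.
  by elim: t {ut} => //= x t; rewrite eqxx muln0 mul1r => ->.
elim: t f ut => [|b t IHt] f ut.
  rewrite (perm_big _ (shuffless0 (a :: s))) big_seq1 shs0 cats0.
  suff -> : forall t, koszul deg t t = 1 by rewrite mulr1z.
  by elim=> //= x t; rewrite eqxx muln0 mul1r => ->.
rewrite (perm_big _ (shuffles_cons ut)) big_cat !big_map /= sh_cons.
congr (_ + _).
  rewrite -IHs; last by case/andP: ut.
  by apply: eq_bigr => u _; rewrite eqxx muln0 mul1r.
rewrite -IHt; last first.
  by move: ut; rewrite (perm_uniq (permEl (perm_catCA (a :: s) [:: b] t))) => /andP[].
rewrite sg_sum; apply: eq_bigr => u _; rewrite -sgE -mulrzA.
rewrite [in RHS]mulrC -koszul_head //.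
by move: ut; rewrite cat_uniq => /and3P[_ /norP[]].
Qed.
End Shuffles.

Definition upl (i n x : nat) : nat := if (i < x)%N then (x + n).-1 else x.
Definition lowl (i x : nat) : nat := (x + i).-1.
Definition up i n := relabel (upl i n).
Definition low i := relabel (lowl i).

Lemma wedge_sign_rcons b i : i \notin b ->
  wedge_sign (i :: b) (rcons b i) = (-1) ^+ size b.
Proof.
rewrite /wedge_sign; elim: b => [|y b IH].
  by move=> _ /=; rewrite eqxx muln0 mulr1.
rewrite inE negb_or => /andP[iy ib].
rewrite rcons_cons [LHS]/= (negbTE iy) eqxx IH //=.
by rewrite ?take0 exprS.
Qed.

Lemma wedge_sign_last b i : uniq b -> i \in b ->
  wedge_sign b (rcons (rem i b) i) = (-1) ^+ after i b.
Proof.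
elim: b => // x b IH /andP[xb ub]; rewrite inE eq_sym.
have [xi _|xi /= ib] := eqVneq x i.
  by rewrite -xi /= eqxx wedge_sign_rcons // /after /= eqxx subn1.
rewrite (negbTE xi) /wedge_sign /= eqxx /= muln0 mul1r.
have := IH ub ib; rewrite /wedge_sign => ->.
by rewrite /after /= (negbTE xi).
Qed.

Arguments koszul : simpl never.

Lemma head_wcompE (A : zmodType) (f : word -> A) i (p q : word) :
  let l := find (fun b => i \in b) p in
  let b := nth [::] p l in
  i \in flatten p -> uniq (flatten p) -> uniq (drop l.+1 p ++ q) -> q != [::] ->
  \sum_(u <- shuffles (drop l.+1 p) (behead q))
    f (take l p ++ (rem i b ++ head [::] q) :: u)
    *~ (wedge_sign b (rcons (rem i b) i) *
        koszul dim (drop l.+1 p ++ q) (head [::] q :: u))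
  = wcomp f i p q.
Proof.
case: q => // c q l b + + + _; rewrite {}/b {}/l.
elim: p f => // b p IH f ip up upq; have [ub up' dbp] := uniq_cons_block up.
move: upq; rewrite [wcomp _ _ _ _]/= [find _ _]/=; case: ifP => ib upq; last first.
  by rewrite -IH //; move: ip; rewrite /= mem_cat ib.
move: upq; rewrite /= drop0 => upq.
rewrite -(@shufflesE _ dim) ?sg_sum; last first.
  move: upq; rewrite -[c :: q]cat1s.
  by rewrite (perm_uniq (permEl (perm_catCA _ [:: c] q))) => /andP[].
apply: eq_bigr => u _; rewrite wedge_sign_last // koszul_head; last first.
  by move: upq; rewrite cat_uniq => /and3P[_ /norP[]].
by rewrite -sgE -mulrzA mulrA -exprD [in RHS]mulrC.
Qed.

Lemma notin_drop i (p : word) : uniq (flatten p) ->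
  i \notin flatten (drop (find (fun b => i \in b) p).+1 p).
Proof.
elim: p => //= b p IH /uniq_cons_block[_ /IH ip dbp].
by case: ifP => // ib; rewrite drop0; exact: dbp.
Qed.

Lemma upl_inj i n : (0 < n)%N -> injective (upl i n).
Proof. by move=> n0 x y; rewrite /upl; case: ltnP => ?; case: ltnP => ? ?; lia. Qed.

Lemma lowl_inj i : (0 < i)%N -> injective (lowl i).
Proof. by move=> i0 x y; rewrite /lowl => ?; lia. Qed.

Lemma upl_range (i n x : nat) : (0 < n)%N ->
  (i + n <= upl i n x)%N = (i < x)%N /\ (upl i n x <= i)%N = (x <= i)%N.
Proof. by move=> n0; rewrite /upl; split; case: ltnP => ?; lia. Qed.

Lemma lowl_range (i n x : nat) : (0 < i)%N -> (0 < x <= n)%N ->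
  (i <= lowl i x < i + n)%N.
Proof. by rewrite /lowl => ? ?; lia. Qed.

Lemma composable_facts m a n b r c i w v : composable m a n b r c i ->
  is_expr m a w -> is_expr n b v ->
  [/\ i \in flatten (up i n w), uniq (flatten (up i n w)),
      uniq (flatten (low i v)) &
      forall x, x \in flatten (up i n w) -> x \in flatten (low i v) -> x = i].
Proof.
case/and3P=> /andP[i0 im] /eqP er _ ew ev.
have n0 := is_expr_gt0 ev; have mw := is_expr_mem ew; have mv := is_expr_mem ev.
rewrite !flatten_relabel; split.
- apply/mapP; exists i; first by rewrite mw i0.
  by rewrite /upl ltnn.
- by rewrite map_inj_uniq ?(is_expr_uniq ew) //; exact: upl_inj.
- by rewrite map_inj_uniq ?(is_expr_uniq ev) //; exact: lowl_inj.
move=> _ /mapP[z _ ->] /mapP[y]; rewrite mv => yn E.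
have := lowl_range i0 yn; rewrite -E => /andP[iz zi].
have [] := @upl_range i n z n0; rewrite leqNgt zi /= => /esym/negbT.
by rewrite -leqNgt => -> ?; apply/eqP; rewrite eqn_leq iz andbT.
Qed.

(** Renumbering is arranged so that the letters of the two factors, without
    [i], fill up [1, ..., m + n - 1]. *)
Lemma composite_expr m a n b r c i w v t : composable m a n b r c i ->
  is_expr m a w -> is_expr n b v ->
  composite i (up i n w) (low i v) t -> is_expr r c t.
Proof.
move=> h ew ev /and3P[p /eqP dt bt].
have [iw uw uv dwv] := composable_facts h ew ev.
case/and3P: h => /andP[i0 im] /eqP er /eqP ec.
have n0 := is_expr_gt0 ev; have mw := is_expr_mem ew; have mv := is_expr_mem ev.
apply/and4P; split; [lia|by []| |]; last first.
  by rewrite dt !dims_relabel (is_expr_dims ew) (is_expr_dims ev) ec.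
apply: uniq_perm; rewrite ?iota_uniq //.
  rewrite (perm_uniq p) cat_uniq rem_uniq //= uv andbT.
  apply/hasPn => x xv; apply/negP => /=; rewrite mem_rem_uniq // inE.
  by case/andP=> /eqP xi xw; case: xi; exact: dwv.
suff H (x : nat) : (x \in map (upl i n) (flatten w)) && (x != i) || (x \in map (lowl i) (flatten v))
    = (0 < x < 1 + r)%N.
  move=> x; rewrite (perm_mem p) mem_cat mem_rem_uniq // inE !flatten_relabel.
  by rewrite mem_iota andbC H.
apply/idP/idP.
  case/orP=> [/andP[/mapP[z]]|/mapP[z]]; rewrite ?mw ?mv /upl /lowl.
    by move=> zm ->; case: ltnP => ?; lia.
  by move=> zn ->; lia.
move=> xr; case: (ltngtP x i) => xi.
- apply/orP; left; rewrite andbT; apply/mapP; exists x; rewrite ?mw /upl; first lia.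
  by rewrite ltnNge ltnW.
- case: (leqP (i + n) x) => xin.
    apply/orP; left; rewrite andbT; apply/mapP; exists (x.+1 - n)%N; rewrite ?mw /upl; first lia.
    by case: ltnP => ?; lia.
  apply/orP; right; apply/mapP; exists (x.+1 - i)%N; rewrite ?mv /lowl; lia.
- apply/orP; right; apply/mapP; exists 1%N; rewrite ?mv /lowl; lia.
Qed.

Lemma blocky_uniq (w : word) : blocky w -> uniq (flatten w) -> uniq w.
Proof.
elim: w => //= b w IH /andP[b0 bw] /uniq_cons_block[_ /(IH bw) -> h].
rewrite andbT; apply/negP; case: b b0 h => // x b _ h xw.
have := h x; rewrite inE eqxx => /(_ isT)/negP; case.
by apply/flattenP; exists (x :: b); rewrite ?inE ?eqxx.
Qed.

Lemma pi_comp_exprE m a n b r c i w v : composable m a n b r c i ->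
  is_expr m a w -> is_expr n b v ->
  pi_comp_expr r c i w v = wcomp (expr r c) i (up i n w) (low i v).
Proof.
move=> h ew ev; have [iw uw uv dwv] := composable_facts h ew ev.
rewrite -head_wcompE //.
- by rewrite /up -(is_expr_size ev).
- rewrite cat_uniq drop_uniq !blocky_uniq ?blocky_relabel ?(is_expr_blocky ew) //;
    last exact: is_expr_blocky ev.
  rewrite andbT /=; apply/hasPn => b0 bv; apply/negP => /= bw.
  have : b0 != [::].
    have := is_expr_blocky ev; rewrite -(blocky_relabel (lowl i)) => /allP; exact.
  case: b0 bv bw => // x b0 bv bw _; case/negP: (notin_drop i uw).
  have xw : x \in flatten (drop (find (fun b => i \in b) (up i n w)).+1 (up i n w)).
    by apply/flattenP; exists (x :: b0); rewrite ?inE ?eqxx.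
  rewrite -[X in X \in _](dwv x) //.
    rewrite -(cat_take_drop (find (fun b => i \in b) (up i n w)).+1 (up i n w)).
    by rewrite flatten_cat mem_cat xw orbT.
  by apply/flattenP; exists (x :: b0); rewrite ?inE ?eqxx.
by rewrite -size_eq0 size_map size_eq0 (is_expr_nil ev).
Qed.
(** The next lemmas compare the value of an operation on arbitrary words and
    on the words with sorted blocks: [k] is the sign of the blocks that have
    already been processed. *)
Lemma sh_sortw (A : zmodType) (f g : word -> A) k x y :
  (forall t, f t = sg (k + ninvs t) (g (sortw t))) ->
  shw f x y = sg (k + ninvs x + ninvs y) (shw g (sortw x) (sortw y)).
Proof.
move=> h; rewrite (@sh_map _ _ dim) -?sh_sg; last by move=> b; rewrite /dim size_sort.
apply: sh_ext => t /and3P[p _ _]; rewrite h; apply: sg_parity.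
by rewrite /ninvs (perm_sumn (perm_map ninv p)) map_cat sumn_cat addnA.
Qed.

Definition alt (A : zmodType) (f : word -> A) := forall t, f t = sg (ninvs t) (f (sortw t)).

(** The merged block [rem i b ++ c] is sorted in two steps, first [b] and [c]
    and then their union; [ninv_rem] accounts for the removal of [i], and the
    inversions between the two parts agree by [cross_perm]. *)
Lemma wcomp_sortw (A : zmodType) (f g : word -> A) k i w v : alt g ->
  (forall t, f t = sg (k + ninvs t) (g (sortw t))) ->
  uniq (flatten w) ->
  wcomp f i w v = sg (k + ninvs w + ninvs v) (wcomp g i (sortw w) (sortw v)).
Proof.
elim: w f g k => [|b w IH] f g k ag h uw; first by rewrite /= sg_0.
have [ub uw' dbw] := uniq_cons_block uw.
rewrite [wcomp g _ _ _]/= mem_sort; case: (boolP (i \in b)) => ib; last first.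
  rewrite wcomp_notin // (IH _ (fun t => g (sort leq b :: t)) (k + ninv b)%N) //.
  - by apply: sg_parity; rewrite ninvs_cons; parity.
  - by move=> t; rewrite ag ninvs_cons ninv_sort /= sort_sort.
  - by move=> t; rewrite h ninvs_cons /= addnA.
rewrite /= ib; set c := head [::] v; set v' := behead v.
have -> : head [::] (sortw v) = sort leq c by rewrite /c; case: (v).
have -> : behead (sortw v) = sortw v' by rewrite /v'; case: (v).
have -> : ninvs v = (ninv c + ninvs v')%N by rewrite /c /v'; case: (v).
set B := rem i b ++ c; set Bs := rem i _ ++ _.
have ib' : i \in sort leq b by rewrite mem_sort.
have pr : perm_eq (rem i (sort leq b)) (rem i b).
  rewrite -(perm_cons i) -(permPl (perm_to_rem ib')) -(permPr (perm_to_rem ib)).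
  by rewrite perm_sort.
have pB : perm_eq Bs B by rewrite perm_cat // perm_sort.
have ds : dim (sort leq c) = dim c by rewrite /dim size_sort.
rewrite (@sh_sortw _ _ (fun t => g (sort leq B :: t)) (k + ninv B)%N); last first.
  by move=> t; rewrite h ninvs_cons /= addnA.
rewrite (@sh_sortw _ (fun t => g (Bs :: t)) (fun t => g (sort leq B :: t)) (ninv Bs)); last first.
  by move=> t; rewrite ag ninvs_cons /= (sort_perm pB).
rewrite !ninvs_sortw !sortw_sortw dims_sortw ds !sg_sg; apply: sg_parity.
have E1 := ninv_rem ub ib.
have us : uniq (sort leq b) by rewrite sort_uniq.
have E2 := ninv_rem us ib'.
have E3 : count (fun y => i < y)%N (sort leq b) = count (fun y => i < y)%N b.
  by apply/permP; rewrite perm_sort.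
have E4 : ninv (rem i (sort leq b)) = 0%N.
  apply: ninv_sorted; apply: (subseq_sorted leq_trans (rem_subseq _ _)).
  exact: sort_leq_sorted.
have pc : perm_eq (sort leq c) c by rewrite perm_sort.
have E5 := cross_perm pr pc.
rewrite /B /Bs !ninv_cat E5 E4 !ninv_sort ninvs_cons.
move: E1 E2; rewrite E3 E4 ninv_sort !add0n !oddD.
set P := odd (count _ _); move=> + E2; rewrite E2 !oddM.
case: P E2 => _; odd_cases.
Qed.

Lemma wdiff_sortw (A : zmodType) (f g : word -> A) k w : alt g ->
  (forall t, f t = sg (k + ninvs t) (g (sortw t))) ->
  wdiff f w = sg (k + ninvs w) (wdiff g (sortw w)).
Proof.
elim: w f g k => [|b w IH] f g k ag h; first by rewrite /= sg_0.
rewrite [sortw _]/= !wdiff_cons.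
rewrite (IH _ (fun t => g (sort leq b :: t)) (k + ninv b)%N); first last.
- by move=> t; rewrite h ninvs_cons /= addnA.
- by move=> t; rewrite ag ninvs_cons ninv_sort /= sort_sort.
have -> : merge_head f b w = sg (k + ninvs (b :: w)) (merge_head g (sort leq b) (sortw w)).
  case: w {IH} => [|c w]; rewrite /merge_head ?sg_0 // h.
  have pbc : perm_eq (sort leq b ++ sort leq c) (b ++ c).
    by rewrite perm_cat // perm_sort.
  rewrite [in RHS]/= (ag ((sort leq b ++ sort leq c) :: sortw w)) sg_sg.
  rewrite !ninvs_cons ninvs_sortw [sortw (_ :: w)]/= [sortw (_ :: sortw w)]/= sortw_sortw (sort_perm pbc).
  apply: sg_parity; rewrite !ninv_cat !ninv_sort.
  have -> : cross (sort leq b) (sort leq c) = cross b c by apply: cross_perm; rewrite perm_sort.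
  parity.
have -> : dim (sort leq b) = dim b by rewrite /dim size_sort.
by rewrite ninvs_cons addnA -sgD !sg_sg addnC.
Qed.

Lemma fgliftB (T : choiceType) (M : lmodType int) (f : T -> M) : additive (fglift f).
Proof. exact: lift_is_additive. Qed.

HB.instance Definition _ (T : choiceType) (M : lmodType int) (f : T -> M) :=
  GRing.isAdditive.Build {freeg T / int} M (fglift f) (fgliftB f).

Lemma fgliftE (T : choiceType) (M : lmodType int) (f : T -> M) x :
  fglift f x = \sum_(z <- dom x) coeff z x *: f z.
Proof.
rewrite -{1}[x]freeg_sumE raddf_sum; apply: eq_bigr => z _; exact: liftU.
Qed.

Section Bilinear.
Variables (m a n b r c i : nat).

Definition pi_compl (y : Pi_mod n b) (x : Pi_mod m a) : Pi_mod r c := pi_comp r c i x y.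
Definition pi_compr (x : Pi_mod m a) (y : Pi_mod n b) : Pi_mod r c := pi_comp r c i x y.

Lemma pi_compl_additive y : additive (pi_compl y).
Proof. exact: fgliftB. Qed.

HB.instance Definition _ y := GRing.isAdditive.Build _ _ (pi_compl y) (pi_compl_additive y).

Lemma pi_compr_additive x : additive (pi_compr x).
Proof.
move=> y y'; rewrite /pi_compr /pi_comp !(fgliftE _ x) -sumrB.
by apply: eq_bigr => z _; rewrite raddfB scalerBr.
Qed.

HB.instance Definition _ x := GRing.isAdditive.Build _ _ (pi_compr x) (pi_compr_additive x).

(** The definition of [pi_comp] only speaks of basis elements, that is, of
    increasing blocks; by [wcomp_sortw] the formula holds for all expressions. *)
Lemma pi_comp_expr2 w v : composable m a n b r c i ->
  is_expr m a w -> is_expr n b v ->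
  pi_comp r c i (expr m a w) (expr n b v) =
    wcomp (expr r c) i (up i n w) (low i v).
Proof.
move=> h ew ev; have [bw ebw vbw] := insub_expr ew.
have [bv ebv vbv] := insub_expr ev.
rewrite (exprE ew ebw) (exprE ev ebv).
have -> k l (x : Pi_mod m a) (y : Pi_mod n b) : pi_comp r c i (sg k x) (sg l y) = sg (k + l) (pi_comp r c i x y).
  transitivity (sg k (pi_comp r c i x (sg l y))).
    exact: (raddf_sg (pi_compl (sg l y))).
  by rewrite -sg_sg; congr sg; exact: (raddf_sg (pi_compr x)).
rewrite /pi_comp !liftU !scale1r vbw vbv.
rewrite (pi_comp_exprE h) ?is_expr_sortw //.
have mono_sortw s (g : nat -> nat) : {mono g : x y / (x <= y)%N} ->
   relabel g (sortw s) = sortw (relabel g s) /\ ninvs (relabel g s) = ninvs s.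
  move=> hg; have hg' : {mono g : x y / (x < y)%N} by move=> x y; rewrite !ltnNge hg.
  split.
    rewrite /sortw /relabel -!map_comp; apply: eq_map => u /=.
    apply: (sorted_eq leq_trans anti_leq); last first.
    - by rewrite perm_sym perm_sort perm_map // perm_sym perm_sort.
    - exact: sort_leq_sorted.
    by rewrite (mono_sorted hg) sort_leq_sorted.
  rewrite /ninvs /relabel -map_comp; congr sumn; apply: eq_map => u /=.
  by apply: ninv_map => x y _ _; exact: hg'.
have n0 := is_expr_gt0 ev; have [/andP[i0 _] _ _] := and3P h; rewrite /up /low.
have [| -> ew'] := mono_sortw w (upl i n).
  by move=> x y; rewrite /upl; case: ltnP => ?; case: ltnP => ?; lia.
have [| -> ev'] := mono_sortw v (lowl i); first by move=> x y; rewrite /lowl; lia.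
have [_ uw _ _] := composable_facts h ew ev.
rewrite (@wcomp_sortw _ (expr r c) (expr r c) 0 i (up i n w)) //.
- by rewrite add0n /up /low ew' ev'.
- exact: expr_alt.
- by move=> t; exact: expr_alt.
Qed.
End Bilinear.

Lemma pi_d_additive n k : additive (@pi_d n k).
Proof. exact: fgliftB. Qed.

HB.instance Definition _ n k := GRing.isAdditive.Build _ _ (@pi_d n k) (@pi_d_additive n k).

Lemma pi_d_sum (A : zmodType) (f : word -> A) (w : word) :
  \sum_(0 <= j < (size w).-1)
    f (take j w ++ (nth [::] w j ++ nth [::] w j.+1) :: drop j.+2 w)
      *~ (-1) ^+ dims (take j.+1 w) = wdiff f w.
Proof.
elim: w f => [|b w IH] f; first by rewrite big_geq.
case: w IH => [|c w] IH; first by rewrite big_geq //= addr0 sg_0.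
rewrite wdiff_cons -IH [size _]/= big_nat_recl //= ?drop0 ?take0 sgD; congr (_ + _).
  by rewrite sgE dims_cons addn0.
rewrite sg_sum; apply: eq_bigr => j _.
by rewrite -!sgE -mulrzA dims_cons exprD [in RHS]mulrC.
Qed.

Lemma pi_d_expr n k w : is_expr n k w ->
  pi_d (expr n k w) = wdiff (expr n k.+1) w.
Proof.
move=> ew; have [bw ebw vbw] := insub_expr ew.
rewrite (exprE ew ebw); transitivity (sg (ninvs w) (pi_d (<< bw >> : Pi_mod n k))).
  exact: (raddf_sg (@pi_d n k)).
rewrite /pi_d liftU scale1r vbw /=.
rewrite pi_d_sum (@wdiff_sortw _ (expr n k.+1) (expr n k.+1) 0 w) //.
- exact: expr_alt.
- by move=> t; exact: expr_alt.
Qed.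

Lemma merged_expr n k w t : is_expr n k w -> merged w t -> is_expr n k.+1 t.
Proof.
move=> ew /and3P[/eqP p /eqP d bt]; apply/and4P; split=> //.
- exact: is_expr_gt0 ew.
- by rewrite p; case/and4P: ew.
- by rewrite d (is_expr_dims ew).
Qed.

(** * [Pi] is a differential graded operad *)

Lemma pi_compBl m a n b r c i (x x' : Pi_mod m a) (y : Pi_mod n b) :
  pi_comp r c i (x - x') y = pi_comp r c i x y - pi_comp r c i x' y.
Proof. exact: (raddfB (pi_compl r c i y)). Qed.

Lemma pi_compBr m a n b r c i (x : Pi_mod m a) (y y' : Pi_mod n b) :
  pi_comp r c i x (y - y') = pi_comp r c i x y - pi_comp r c i x y'.
Proof. exact: (raddfB (pi_compr r c i x)). Qed.

Lemma pi_dB n k (x y : Pi_mod n k) : pi_d (x - y) = pi_d x - pi_d y.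
Proof. exact: (raddfB (@pi_d n k)). Qed.

Lemma Pi_eq n k (A : zmodType) (f g : Pi_mod n k -> A) :
  (forall x y, f (x - y) = f x - f y) -> (forall x y, g (x - y) = g x - g y) ->
  (forall w, is_expr n k w -> f (expr n k w) = g (expr n k w)) -> f =1 g.
Proof.
move=> fB gB h.
pose f' := GRing.isAdditive.Build _ _ f fB.
pose g' := GRing.isAdditive.Build _ _ g gB.
pose F : {additive Pi_mod n k -> A} := HB.pack f f'.
pose G : {additive Pi_mod n k -> A} := HB.pack g g'.
exact: (@Pi_ind _ _ _ F G h).
Qed.
(** A composite is a signed sum of expressions to which [pi_comp_expr2] applies
    again, so an iterated composition becomes an iterated [wcomp]. *)
Lemma pi_comp_wcompl m a n b r c p e t g i j w v u : composable m a n b r c i ->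
  composable r c p e t g j -> is_expr m a w -> is_expr n b v -> is_expr p e u ->
  pi_comp t g j (wcomp (expr r c) i (up i n w) (low i v)) (expr p e u) =
  wcomp (fun s => wcomp (expr t g) j (up j p s) (low j u)) i (up i n w) (low i v).
Proof.
move=> h h' ew ev eu.
transitivity (wcomp (fun s => pi_comp t g j (expr r c s) (expr p e u)) i (up i n w) (low i v)).
  exact: (raddf_wcomp (pi_compl t g j (expr p e u))).
apply: wcomp_ext; rewrite ?blocky_relabel ?(is_expr_blocky ew) ?(is_expr_blocky ev) //.
  by rewrite -size_eq0 size_map size_eq0 (is_expr_nil ev).
move=> s hs; rewrite (pi_comp_expr2 h') //; exact: (composite_expr h ew ev hs).
Qed.

Lemma pi_comp_wcompr m a n b p e s f t g i j w v u : composable n b p e s f j ->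
  composable m a s f t g i -> is_expr m a w -> is_expr n b v -> is_expr p e u ->
  pi_comp t g i (expr m a w) (wcomp (expr s f) j (up j p v) (low j u)) =
  wcomp (fun x => wcomp (expr t g) i (up i s w) (low i x)) j (up j p v) (low j u).
Proof.
move=> h h' ew ev eu.
transitivity (wcomp (fun x => pi_comp t g i (expr m a w) (expr s f x)) j (up j p v) (low j u)).
  exact: (raddf_wcomp (pi_compr t g i (expr m a w))).
apply: wcomp_ext; rewrite ?blocky_relabel ?(is_expr_blocky ev) ?(is_expr_blocky eu) //.
  by rewrite -size_eq0 size_map size_eq0 (is_expr_nil eu).
move=> x hx; rewrite (pi_comp_expr2 h') //; exact: (composite_expr h ev eu hx).
Qed.

Lemma relabel_nil r w : (relabel r w == [::]) = (w == [::]).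
Proof. by case: w. Qed.

Lemma uniq_up i n w : (0 < n)%N -> uniq (flatten w) -> uniq (flatten (up i n w)).
Proof. by move=> n0 uw; rewrite flatten_relabel map_inj_uniq //; exact: upl_inj. Qed.

Lemma uniq_low i w : (0 < i)%N -> uniq (flatten w) -> uniq (flatten (low i w)).
Proof. by move=> i0 uw; rewrite flatten_relabel map_inj_uniq //; exact: lowl_inj. Qed.

(** After renumbering, both sides are instances of [wcomp_seq] on the words
    relabelled into the final alphabet [1, ..., m + n + p - 2]. *)
Lemma Pi_seq m a n b p e r c s f t g i j
    (h1 : composable m a n b r c i)
    (h2 : composable r c p e t g (i.-1 + j))
    (h3 : composable n b p e s f j)
    (h4 : composable m a s f t g i)
    (x : Pi m a) (y : Pi n b) (z : Pi p e) :
    op_comp Pi h2 (op_comp Pi h1 x y) z = op_comp Pi h4 x (op_comp Pi h3 y z).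
Proof.
rewrite /op_comp /=; move: x; apply: Pi_eq => [x x'|x x'|w ew]; rewrite ?pi_compBl //.
move: y; apply: Pi_eq => [y y'|y y'|v ev]; rewrite ?(pi_compBl, pi_compBr) //.
move: z; apply: Pi_eq => [z z'|z z'|u eu]; rewrite ?(pi_compBl, pi_compBr) //.
rewrite (pi_comp_expr2 h1) // (pi_comp_expr2 h3) //.
rewrite (pi_comp_wcompl h1 h2) // (pi_comp_wcompr h3 h4) //.
have n0 := is_expr_gt0 ev; have p0 := is_expr_gt0 eu; have m0 := is_expr_gt0 ew.
have [/andP[i0 im] /eqP er _] := and3P h1.
have [/andP[j0 jn] /eqP es _] := and3P h3.
set J := (i.-1 + j)%N.
rewrite -(@wcomp_relabel _ (fun s => wcomp (expr t g) J s (low J u)) (upl J p) i i); last first.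
- by move=> q _ /upl_inj; apply.
- by rewrite /upl /J; case: ltnP => ?; lia.
rewrite -(@wcomp_relabel _ (fun x => wcomp (expr t g) i (up i s w) x) (lowl i) j J); last first.
- by move=> q _ /lowl_inj; apply.
- by rewrite /lowl /J; lia.
have mw := is_expr_mem ew; have mv := is_expr_mem ev; have mu := is_expr_mem eu.
have -> : relabel (upl J p) (up i n w) = up i s w.
  rewrite relabel_comp; apply: eq_relabel => q; rewrite mw /upl /J /= => qm.
  by case: (ltnP i q) => ?; case: ltnP => ?; lia.
have -> : relabel (upl J p) (low i v) = relabel (lowl i) (up j p v).
  rewrite !relabel_comp; apply: eq_relabel => q; rewrite mv /upl /lowl /J /= => qm.
  by case: (ltnP j q) => ?; case: ltnP => ?; lia.
have -> : relabel (lowl i) (low j u) = low J u.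
  rewrite !relabel_comp; apply: eq_relabel => q; rewrite mu /lowl /J /= => qm; lia.
have s0 : (0 < s)%N by lia.
apply: wcomp_seq.
- exact: uniq_up (is_expr_uniq ew).
- exact: (uniq_low i0 (uniq_up _ p0 (is_expr_uniq ev))).
- rewrite !flatten_relabel; apply/mapP; exists j; last by rewrite /lowl /J; lia.
  apply/mapP; exists j; first by rewrite mv j0 jn.
  by rewrite /upl ltnn.
- rewrite flatten_relabel => /mapP[q]; rewrite mw /upl /J.
  by case: (ltnP i q) => ? ? ?; lia.
- by rewrite blocky_relabel (is_expr_blocky ew).
- by rewrite !blocky_relabel (is_expr_blocky ev).
- by rewrite blocky_relabel (is_expr_blocky eu).
- by rewrite relabel_nil (is_expr_nil eu).
Qed.

Lemma Pi_par m a n b p e r c s f t g i k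
    (h1 : composable m a n b r c i)
    (h2 : composable r c p e t g (k + n).-1)
    (h3 : composable m a p e s f k)
    (h4 : composable s f n b t g i)
    (x : Pi m a) (y : Pi n b) (z : Pi p e) : (i < k)%N ->
    op_comp Pi h2 (op_comp Pi h1 x y) z =
      op_comp Pi h4 (op_comp Pi h3 x z) y *~ (-1) ^+ (b * e).
Proof.
move=> ik; rewrite sgE /op_comp /=.
move: x; apply: Pi_eq => [x x'|x x'|w ew]; rewrite ?pi_compBl ?sgB //.
move: y; apply: Pi_eq => [y y'|y y'|v ev]; rewrite ?(pi_compBl, pi_compBr, sgB) //.
move: z; apply: Pi_eq => [z z'|z z'|u eu]; rewrite ?(pi_compBl, pi_compBr, sgB) //.
rewrite (pi_comp_expr2 h1) // (pi_comp_expr2 h3) //.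
rewrite (pi_comp_wcompl h1 h2) // (pi_comp_wcompl h3 h4) //.
have n0 := is_expr_gt0 ev; have p0 := is_expr_gt0 eu; have m0 := is_expr_gt0 ew.
have [/andP[i0 im] /eqP er _] := and3P h1.
have [/andP[k0 km] /eqP es _] := and3P h3.
set K := (k + n).-1.
have mw := is_expr_mem ew; have mv := is_expr_mem ev; have mu := is_expr_mem eu.
rewrite -(@wcomp_relabel _ (fun s => wcomp (expr t g) K s (low K u)) (upl K p) i i); last first.
- by move=> q _ /upl_inj; apply.
- by rewrite /upl /K; case: ltnP => ?; lia.
rewrite -(@wcomp_relabel _ (fun s => wcomp (expr t g) i s (low i v)) (upl i n) k K); last first.
- by move=> q _ /upl_inj; apply.
- by rewrite /upl ik.
have -> : relabel (upl i n) (up k p w) = relabel (upl K p) (up i n w).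
  rewrite !relabel_comp; apply: eq_relabel => q; rewrite mw /upl /K /= => qm.
  by case: (ltnP k q) => ?; case: (ltnP i q) => ?; repeat case: ltnP => ?; lia.
have -> : relabel (upl K p) (low i v) = low i v.
  rewrite relabel_comp; apply: eq_relabel => q; rewrite mv /upl /lowl /K /= => qm.
  by case: ltnP => ?; lia.
have -> : relabel (upl i n) (low k u) = low K u.
  rewrite relabel_comp; apply: eq_relabel => q; rewrite mu /upl /lowl /K /= => qm.
  by case: ltnP => ?; lia.
rewrite (@wcomp_par _ _ i K).
- by rewrite !dims_relabel (is_expr_dims ev) (is_expr_dims eu).
- exact: expr_swapping.
- exact: (uniq_up _ p0 (uniq_up _ n0 (is_expr_uniq ew))).
- by apply/eqP; rewrite /K; lia.
- rewrite flatten_relabel; apply/mapP => -[q]; rewrite mv /lowl /K; lia.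
- rewrite flatten_relabel; apply/mapP => -[q]; rewrite mu /lowl /K; lia.
- by rewrite !blocky_relabel (is_expr_blocky ew).
- by rewrite blocky_relabel (is_expr_blocky ev).
- by rewrite relabel_nil (is_expr_nil ev).
- by rewrite blocky_relabel (is_expr_blocky eu).
- by rewrite relabel_nil (is_expr_nil eu).
Qed.

Lemma Pi_1l n a (h : composable 1 0 n a n a 1) (x : Pi n a) :
  op_comp Pi h (op_one Pi) x = x.
Proof.
rewrite /op_comp /op_one /=; move: x; apply: Pi_eq => [x x'|//|v ev]; first by rewrite pi_compBr.
rewrite (pi_comp_expr2 h) //.
have -> : up 1 n [:: [:: 1%N]] = [:: [:: 1%N]] by [].
rewrite wcomp_1l ?relabel_nil ?(is_expr_nil ev) //; congr expr.
by apply: relabel_id => q _; rewrite /lowl addn1.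
Qed.

Lemma Pi_1r m a i (h : composable m a 1 0 m a i) (x : Pi m a) :
  op_comp Pi h x (op_one Pi) = x.
Proof.
rewrite /op_comp /op_one /=; move: x; apply: Pi_eq => [x x'|//|w ew]; first by rewrite pi_compBl.
rewrite (pi_comp_expr2 h) //.
have -> : low i [:: [:: 1%N]] = [:: [:: i]] by [].
have -> : up i 1 w = w.
  by apply: relabel_id => q _; rewrite /upl addn1 /= if_same.
rewrite wcomp_1r //; first exact: expr_swapping.
by have [/andP[i0 im] _ _] := and3P h; rewrite (is_expr_mem ew) i0.
Qed.

Lemma pi_d_wdiff n k f w : is_expr n k w ->
  (forall t, merged w t -> is_expr n k.+1 (f t)) ->
  pi_d (wdiff (fun t => expr n k.+1 (f t)) w) =
  wdiff (fun t => wdiff (expr n k.+2) (f t)) w.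
Proof.
move=> ew h; rewrite (raddf_wdiff (@pi_d n k.+1)); apply: wdiff_ext.
  exact: is_expr_blocky ew.
by move=> t /h; exact: pi_d_expr.
Qed.

Lemma Pi_d_d n k (x : Pi n k) : op_d Pi (op_d Pi x) = 0.
Proof.
rewrite /op_d /=; move: x; apply: Pi_eq => [x x'|x x'|w ew]; rewrite ?pi_dB ?subrr //.
rewrite pi_d_expr // (@pi_d_wdiff _ _ id) //.
  by apply: wdiff_wdiff; exact: is_expr_blocky ew.
by move=> t; exact: merged_expr.
Qed.

Lemma Pi_d_comp m a n b r c i
    (h : composable m a n b r c i)
    (h1 : composable m a.+1 n b r c.+1 i)
    (h2 : composable m a n b.+1 r c.+1 i)
    (x : Pi m a) (y : Pi n b) :
    op_d Pi (op_comp Pi h x y) =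
      op_comp Pi h1 (op_d Pi x) y + op_comp Pi h2 x (op_d Pi y) *~ (-1) ^+ a.
Proof.
rewrite sgE /op_comp /op_d /=; move: x; apply: Pi_eq => [x x'|x x'|w ew];
  rewrite ?(pi_compBl, pi_dB, sgB) // ?opprD 1?addrACA //.
move: y; apply: Pi_eq => [y y'|y y'|v ev];
  rewrite ?(pi_compBr, pi_dB, sgB) // ?opprD 1?addrACA //.
rewrite (pi_comp_expr2 h) // !pi_d_expr //.
transitivity (wcomp (wdiff (expr r c.+1)) i (up i n w) (low i v)).
  rewrite (raddf_wcomp (@pi_d r c)); apply: wcomp_ext.
  - by rewrite blocky_relabel (is_expr_blocky ew).
  - by rewrite blocky_relabel (is_expr_blocky ev).
  - by rewrite relabel_nil (is_expr_nil ev).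
  by move=> t ht; apply: pi_d_expr; exact: (composite_expr h ew ev ht).
have [_ uw _ _] := composable_facts h ew ev.
rewrite wcomp_wdiff //.
- rewrite dims_relabel (is_expr_dims ew); congr (_ + sg _ _).
  + rewrite wdiff_relabel -[RHS]/(pi_compl r c.+1 i (expr n b v) _) raddf_wdiff.
    apply: wdiff_ext; first exact: is_expr_blocky ew.
    move=> t ht; rewrite /= /pi_compl (pi_comp_expr2 h1) //; exact: merged_expr ht.
  + rewrite wdiff_relabel -[RHS]/(pi_compr r c.+1 i (expr m a w) _) raddf_wdiff.
    apply: wdiff_ext; first exact: is_expr_blocky ev.
    move=> t ht; rewrite /= /pi_compr (pi_comp_expr2 h2) //; exact: merged_expr ht.
- exact: expr_swapping.
- by rewrite blocky_relabel (is_expr_blocky ew).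
- by rewrite blocky_relabel (is_expr_blocky ev).
- by rewrite relabel_nil (is_expr_nil ev).
Qed.

(** The properties of words proved above, transported to [Pi] by linearity. *)
Theorem Pi_axioms : dgop_axioms Pi.
Proof.
split.
- by move=> *; apply: (subr_add (f := fun x => pi_comp _ _ _ x _)) => *; exact: pi_compBl.
- by move=> *; apply: (subr_add (f := fun x => pi_comp _ _ _ _ x)) => *; exact: pi_compBr.
- exact: Pi_1l.
- exact: Pi_1r.
- exact: Pi_seq.
- exact: Pi_par.
- by move=> *; apply: (subr_add (@pi_dB _ _)).
- exact: Pi_d_d.
- exact: Pi_d_comp.
Qed.

(** * Elements of plane trees as iterated shuffles *)

(** The recursion of [ptree] passes through lists, so the induction principle
    for trees carries along a property of forests. *)
Section TreeInd.
Variables (P : ptree -> Prop) (Q : seq ptree -> Prop).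
Hypotheses (PL : P Leaf) (PN : forall ts, Q ts -> P (Node ts)).
Hypotheses (Q0 : Q [::]) (QS : forall t ts, P t -> Q ts -> Q (t :: ts)).

Fixpoint ptree_ind2 (t : ptree) : P t :=
  match t with
  | Leaf => PL
  | Node ts =>
    PN ((fix go (us : seq ptree) : Q us :=
          match us with
          | [::] => Q0
          | u :: us' => QS (ptree_ind2 u) (go us')
          end) ts)
  end.

Lemma forest_ind2 ts : Q ts.
Proof. by elim: ts => // t ts IH; apply: QS => //; exact: ptree_ind2. Qed.
Lemma tree_forest_ind : (forall t, P t) /\ (forall us, Q us).
Proof. by split; [exact: ptree_ind2 | exact: forest_ind2]. Qed.
End TreeInd.

Fixpoint starts (p : nat) (ts : seq ptree) : block :=
  if ts is t :: ts' then p :: starts (p + leaves t) ts' else [::].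

Definition sectors (o : nat) (ts : seq ptree) : block :=
  if ts is t :: ts' then starts (o + leaves t) ts' else [::].

Lemma sectorsE o ts : take (size ts).-1 (scanl addn o (map leaves ts)) = sectors o ts.
Proof.
case: ts => //= t ts; elim: ts o t => //= u ts IH o t.
by rewrite IH.
Qed.

(** The inner loop is [dfs_forest]. *)
Fixpoint dfs_word (o : nat) (t : ptree) {struct t} : word :=
  if t is Node ts then
    sectors o ts ::
      (fix go (o : nat) (us : seq ptree) : word :=
        if us is u :: us' then dfs_word o u ++ go (o + leaves u)%N us' else [::]) o ts
  else [::].

Fixpoint dfs_forest (o : nat) (us : seq ptree) : word :=
  if us is u :: us' then dfs_word o u ++ dfs_forest (o + leaves u)%N us' else [::].

Lemma dfs_Node o ts : dfs_word o (Node ts) = sectors o ts :: dfs_forest o ts.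
Proof. by rewrite /=; congr cons; elim: ts o => //= u us IH o; rewrite IH. Qed.

Notation vertex := (seq nat * seq nat)%type.

Fixpoint kids (a : seq nat) (j o : nat) (us : seq ptree) : seq vertex :=
  if us is u :: us' then
    vertices (rcons a j) o u ++ kids a j.+1 (o + leaves u)%N us'
  else [::].

Lemma vertices_Node a o ts :
  vertices a o (Node ts) = (a, sectors o ts) :: kids a 0 o ts.
Proof.
rewrite /= sectorsE; congr cons.
by elim: ts 0%N o => //= u us IH j o; rewrite IH.
Qed.

Lemma dfs_vertices a o t : unzip2 (vertices a o t) = dfs_word o t.
Proof.
move: a o; pose Q us := forall a j o, unzip2 (kids a j o us) = dfs_forest o us.
apply: (@ptree_ind2 (fun t => forall a o, unzip2 (vertices a o t) = dfs_word o t) Q) => //.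
- by move=> ts IH a o; rewrite vertices_Node dfs_Node /= IH.
- by move=> u us IHu IHus a j o; rewrite /= /unzip2 map_cat -!/(unzip2 _) IHu IHus.
Qed.

Section TreeSum.
Variable A : zmodType.
Implicit Types (f g : word -> A).

(** The sum defining the element of a tree, computed recursively: the block of
    the root comes first, followed by a shuffle of words of the subtrees. The
    inner loop is [fsum], the corresponding sum for a forest. *)
Fixpoint tsum (t : ptree) : nat -> (word -> A) -> A :=
  if t is Node ts then fun o f =>
    (fix FS us o f :=
      if us is u :: us' then
        tsum u o (fun x => FS us' (o + leaves u)%N (fun y => shw f x y))
      else f [::]) ts o (fun w => f (sectors o ts :: w))
  else fun o f => f [::].

Fixpoint fsum (us : seq ptree) (o : nat) f : A :=
  if us is u :: us' then
    tsum u o (fun x => fsum us' (o + leaves u)%N (fun y => shw f x y))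
  else f [::].

Lemma tsum_Node ts o f : tsum (Node ts) o f = fsum ts o (fun w => f (sectors o ts :: w)).
Proof.
rewrite [LHS]/=.
suff H : forall us o f, (fix FS us o f :=
      if us is u :: us' then
        tsum u o (fun x => FS us' (o + leaves u)%N (fun y => shw f x y))
      else f [::]) us o f = fsum us o f by rewrite H.
by move=> {ts o f}; elim=> //.
Qed.

Lemma fsum_cons u us o f :
  fsum (u :: us) o f = tsum u o (fun x => fsum us (o + leaves u) (fun y => shw f x y)).
Proof. by []. Qed.

Lemma tsum_fsum_ext :
  (forall t o f g, (forall w, perm_eq w (dfs_word o t) -> f w = g w) -> tsum t o f = tsum t o g) /\
  (forall us o f g, (forall w, perm_eq w (dfs_forest o us) -> f w = g w) -> fsum us o f = fsum us o g).
Proof.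
apply: tree_forest_ind.
- by move=> o f g h; apply: h.
- move=> ts Qts o f g h; rewrite !tsum_Node; apply: Qts => w hw; apply: h.
  by rewrite dfs_Node perm_cons.
- by move=> o f g h; apply: h.
- move=> t ts Pt Qts o f g h; rewrite !fsum_cons; apply: Pt => x hx; apply: Qts => y hy.
  apply: sh_ext => u /and3P[p _ _]; apply: h; apply: perm_trans p _.
  exact: perm_cat.
Qed.

Definition tsum_ext := tsum_fsum_ext.1.
Definition fsum_ext := tsum_fsum_ext.2.

End TreeSum.

Arguments tsum_ext {A} t o f g.
Arguments fsum_ext {A} us o f g.

Section TreeSumTheory.
Variables (A B : zmodType).

Lemma raddf_tsum_fsum (h : {additive A -> B}) :
  (forall t o f, h (tsum t o f) = tsum t o (fun w => h (f w))) /\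
  (forall us o f, h (fsum us o f) = fsum us o (fun w => h (f w))).
Proof.
apply: tree_forest_ind.
- by [].
- by move=> ts Qts o f; rewrite !tsum_Node Qts.
- by [].
- move=> t ts Pt Qts o f; rewrite !fsum_cons Pt; apply: tsum_ext => x _.
  rewrite Qts; apply: fsum_ext => y _; exact: raddf_sh.
Qed.

Definition raddf_tsum h := (raddf_tsum_fsum h).1.
Definition raddf_fsum h := (raddf_tsum_fsum h).2.

Lemma tsum_fsum_D :
  (forall t o (f g : word -> A), tsum t o (fun w => f w + g w) = tsum t o f + tsum t o g) /\
  (forall us o (f g : word -> A), fsum us o (fun w => f w + g w) = fsum us o f + fsum us o g).
Proof.
apply: tree_forest_ind.
- by [].
- by move=> ts Qts o f g; rewrite !tsum_Node Qts.
- by [].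
- move=> t ts Pt Qts o f g; rewrite !fsum_cons -Pt; apply: tsum_ext => x _.
  rewrite -Qts; apply: fsum_ext => y _; exact: shD.
Qed.

Lemma sg_additive n : additive (@sg A n).
Proof. by move=> x y; exact: sgB. Qed.
HB.instance Definition _ n := GRing.isAdditive.Build A A (@sg A n) (@sg_additive n).

End TreeSumTheory.

Section TreeSigns.
Variables (A : zmodType).

Lemma tsum_sg t o n (f : word -> A) : tsum t o (fun w => sg n (f w)) = sg n (tsum t o f).
Proof. by rewrite (raddf_tsum (@sg A n)). Qed.

Lemma fsum_sg t o n (f : word -> A) : fsum t o (fun w => sg n (f w)) = sg n (fsum t o f).
Proof. by rewrite (raddf_fsum (@sg A n)). Qed.

Lemma addr_0_morph (g : A -> A) : g 0 = g 0 + g 0 -> g 0 = 0.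
Proof. by move/eqP; rewrite -subr_eq0 opprD addrA subrr sub0r oppr_eq0 => /eqP. Qed.

Lemma tsum_0 t o : tsum t o (fun=> 0 : A) = 0.
Proof.
apply: (@addr_0_morph (fun x => tsum t o (fun=> x))).
by rewrite -(tsum_fsum_D A).1; apply: tsum_ext => w _; rewrite addr0.
Qed.

Lemma fsum_0 t o : fsum t o (fun=> 0 : A) = 0.
Proof.
apply: (@addr_0_morph (fun x => fsum t o (fun=> x))).
by rewrite -(tsum_fsum_D A).2; apply: fsum_ext => w _; rewrite addr0.
Qed.

Lemma starts_shift o s ts : starts (o + s) ts = map (addn s) (starts o ts).
Proof. by elim: ts o => //= t ts IH o; rewrite addnAC IH addnC. Qed.

Lemma sectors_shift o s ts : sectors (o + s) ts = map (addn s) (sectors o ts).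
Proof. by case: ts => //= t ts; rewrite addnAC starts_shift. Qed.

Lemma dim_map (r : nat -> nat) b : dim (map r b) = dim b.
Proof. by rewrite /dim size_map. Qed.

Lemma tsum_fsum_shift s :
  (forall t o (f : word -> A), tsum t (o + s) f = tsum t o (fun w => f (relabel (addn s) w))) /\
  (forall us o (f : word -> A), fsum us (o + s) f = fsum us o (fun w => f (relabel (addn s) w))).
Proof.
apply: tree_forest_ind.
- by [].
- by move=> ts Qts o f; rewrite !tsum_Node Qts sectors_shift.
- by [].
- move=> t ts Pt Qts o f; rewrite !fsum_cons Pt; apply: tsum_ext => x _.
  rewrite addnAC Qts; apply: fsum_ext => y _.
  by rewrite /relabel (@sh_map _ _ dim) // => b; rewrite dim_map.
Qed.
End TreeSigns.

Definition forest_leaves (ts : seq ptree) : nat := sumn (map leaves ts).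

Lemma leaves_gt0 t : branching t -> (0 < leaves t)%N.
Proof.
move: t; apply: (@ptree_ind2 _ (fun ts => all branching ts -> (size ts <= forest_leaves ts)%N)) => //.
- by move=> ts IH /andP[s bs]; apply: leq_trans (IH bs); exact: ltnW.
- move=> t ts IHt IHts /= /andP[bt bts]; rewrite /forest_leaves /=.
  by rewrite -add1n leq_add ?IHt ?IHts.
Qed.

(** Each leaf other than the leftmost one is the leftmost leaf of exactly one
    subtree that is not a first child, and so occurs in exactly one block. *)
Lemma dfs_letters :
  (forall t o, branching t -> perm_eq (flatten (dfs_word o t)) (iota o.+1 (leaves t).-1)) /\
  (forall us o, all branching us ->
    perm_eq (starts o us ++ flatten (dfs_forest o us)) (iota o (forest_leaves us))).
Proof.
apply: tree_forest_ind.
- by [].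
- move=> ts Qts o /andP[s bs]; rewrite dfs_Node /=.
  case: ts s bs Qts => // t ts _ bs Qts.
  have := Qts o bs; have l0 : (0 < leaves t)%N by apply: leaves_gt0; case/andP: bs.
  rewrite /sectors /= /forest_leaves /= -[iota o _]/(iota o (leaves t + sumn (map leaves ts))).
  have -> : (leaves t + sumn (map leaves ts))%N = ((leaves t + sumn (map leaves ts)).-1).+1 by lia.
  by rewrite /= perm_cons.
- by [].
- move=> t ts Pt Qts o /= /andP[bt bts]; have l0 := leaves_gt0 bt.
  rewrite flatten_cat /forest_leaves /= iotaD.
  rewrite [in X in perm_eq _ (X ++ _)](_ : leaves t = (leaves t).-1.+1) /=; last by lia.
  rewrite perm_cons perm_catCA perm_cat //; first exact: Pt.
  exact: Qts.
Qed.

Lemma dfs_blocky :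
  (forall t o, branching t -> blocky (dfs_word o t)) /\
  (forall us o, all branching us -> blocky (dfs_forest o us)).
Proof.
apply: tree_forest_ind.
- by [].
- move=> ts Qts o /andP[s bs]; rewrite dfs_Node; apply/andP; split; last exact: Qts.
  by case: ts s {bs Qts} => // t [].
- by [].
- move=> t ts Pt Qts o /= /andP[bt bts]; rewrite /blocky all_cat.
  by apply/andP; split; [exact: Pt | exact: Qts].
Qed.

Lemma dfs_shift s :
  (forall t o, dfs_word (o + s) t = relabel (addn s) (dfs_word o t)) /\
  (forall us o, dfs_forest (o + s) us = relabel (addn s) (dfs_forest o us)).
Proof.
apply: tree_forest_ind.
- by [].
- by move=> ts Qts o; rewrite !dfs_Node Qts sectors_shift.
- by [].
- move=> t ts Pt Qts o; rewrite /= Pt addnAC Qts /relabel map_cat //.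
Qed.

Lemma dfs_sorted :
  (forall t o, branching t -> all (sorted ltn) (dfs_word o t)) /\
  (forall us o, all branching us -> all (sorted ltn) (dfs_forest o us)).
Proof.
apply: tree_forest_ind.
- by [].
- move=> ts Qts o /andP[s bs]; rewrite dfs_Node; apply/andP; split; last exact: Qts.
  case: ts s bs {Qts} => //= t [//|u us] _ /andP[_] /=.
  elim: us u (o + leaves t)%N => //= v us IH u p /andP[bu bus].
  by rewrite IH // andbT -[X in (X < _)%N]addn0 ltn_add2l leaves_gt0.
- by [].
- move=> t ts Pt Qts o /= /andP[bt bts]; rewrite all_cat.
  by apply/andP; split; [exact: Pt | exact: Qts].
Qed.

(** * Sums over linear extensions *)

Section LinearExtensions.
Variables (T : eqType) (deg : T -> nat) (par : rel T) (A : zmodType).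
Implicit Types (s t u : seq T) (F : seq T -> A).

Definition parents_before (o : seq T) := pairwise (fun v w => ~~ par w v) o.

(** [tree_elt] is the case of the vertices of a tree with [is_parent]. *)
Definition le_sum s F : A :=
  \sum_(o <- permutations s | parents_before o) F o *~ koszul deg s o.

Lemma koszulS s z u : koszul deg s (z :: u) =
  (-1) ^+ (deg z * degs deg (take (index z s) s)) * koszul deg (rem z s) u.
Proof. by []. Qed.

Lemma filter_rem x s u : x \notin u -> filter (mem (rem x s)) u = filter (mem s) u.
Proof.
move=> xu; apply: eq_in_filter => y yu /=.
have yx : y != x by apply: contraNneq xu => <-.
have [xs|xs] := boolP (x \in s); last by rewrite rem_id.
by have /perm_mem/(_ y) := perm_to_rem xs; rewrite inE (negbTE yx).
Qed.

(** A rearrangement of [s ++ t] is a rearrangement of [s], one of [t], and a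
    shuffle of the two. *)
Lemma koszul_split s t u : uniq (s ++ t) -> perm_eq u (s ++ t) ->
  koszul deg (s ++ t) u =
    koszul deg s (filter (mem s) u) * koszul deg t (filter (mem t) u)
    * koszul deg (filter (mem s) u ++ filter (mem t) u) u.
Proof.
elim: u s t => [|z u IH] s t ust p.
  move: p; rewrite perm_sym => /perm_nilP/(congr1 size)/eqP.
  by rewrite size_cat addn_eq0 !size_eq0 => /andP[/eqP-> /eqP->].
have uzu : uniq (z :: u) by rewrite (perm_uniq p).
have [us ust' ut] : [/\ uniq s, ~~ has (mem s) t & uniq t] by apply/and3P; rewrite -cat_uniq.
have zu : z \notin u by case/andP: uzu.
have zst : z \in s ++ t by rewrite -(perm_mem p) inE eqxx.
have p' : perm_eq u (rem z (s ++ t)).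
  by rewrite -(perm_cons z); apply: perm_trans p _; apply: perm_to_rem.
have u' : uniq (rem z (s ++ t)) by rewrite rem_uniq.
move: (zst); rewrite mem_cat; case: (boolP (z \in s)) => zs /= zt.
  have zt' : z \notin t by apply: contra ust' => zt'; apply/hasP; exists z.
  move: p' u'; rewrite rem_catl // => p' u'.
  rewrite zs (negbTE zt') cat_cons !koszulS rem_catl // IH // filter_rem //.
  rewrite index_cat zs takel_cat ?index_size // /= eqxx muln0 expr0 mul1r.
  by rewrite !mulrA.
move: p' u'; rewrite rem_catr // => p' u'.
rewrite (negbTE zs) zt koszul_head; last by rewrite mem_filter /= negb_and zs.
rewrite !koszulS rem_catr // IH // filter_rem //.
rewrite index_cat (negbTE zs) take_cat ltnNge leq_addr /= addKn.
rewrite degs_cat mulnDr exprD.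
have -> : degs deg [seq x <- u | mem s x] = degs deg s.
  apply: degs_perm; apply: uniq_perm => //.
    by rewrite filter_uniq //; case/andP: uzu.
  move=> x; rewrite mem_filter; apply/andP/idP => [[]//|xs]; split=> //.
  by rewrite (perm_mem p') mem_cat xs.
set a := (-1) ^+ _; set b := (-1) ^+ _; set x := koszul _ _ _; set y := koszul _ _ _.
by rewrite !mulrA; congr (_ * _); rewrite -!mulrA; rewrite mulrC -!mulrA [y * a]mulrC mulrCA !mulrA.
Qed.

Lemma shuffled_filter s t o1 o2 u : uniq (s ++ t) ->
  perm_eq o1 s -> perm_eq o2 t ->
  shuffled o1 o2 u =
    [&& perm_eq u (s ++ t), filter (mem s) u == o1 & filter (mem t) u == o2].
Proof.
move=> ust p1 p2; have p12 : perm_eq (o1 ++ o2) (s ++ t) by exact: perm_cat.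
rewrite /shuffled (permPr p12); case: (boolP (perm_eq u _)) => //= p.
have uu : uniq u by rewrite (perm_uniq p).
have e1 : filter (mem s) u = filter (mem o1) u.
  by apply: eq_filter => x /=; rewrite (perm_mem p1).
have e2 : filter (mem t) u = filter (mem o2) u.
  by apply: eq_filter => x /=; rewrite (perm_mem p2).
rewrite e1 e2; congr andb; apply/subseq_uniqP/eqP => //.
Qed.

Lemma parents_before_split s t u : uniq (s ++ t) -> perm_eq u (s ++ t) ->
  (forall v w, v \in s -> w \in t -> ~~ par v w && ~~ par w v) ->
  parents_before u =
    parents_before (filter (mem s) u) && parents_before (filter (mem t) u).
Proof.
move=> ust p h; have : {subset u <= s ++ t} by move=> x; rewrite (perm_mem p).
have dst : forall x, x \in s -> x \notin t.
  move: ust; rewrite cat_uniq => /and3P[_ /hasPn ht _] x xs.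
  by apply/negP => /ht; rewrite /= xs.
rewrite /parents_before; elim: u {p} => //= z u IH wcomp.
rewrite IH; last by move=> x xu; apply: wcomp; rewrite inE xu orbT.
have wcomp' x : x \in u -> (x \in s) || (x \in t).
  by move=> xu; rewrite -mem_cat; apply: wcomp; rewrite inE xu orbT.
have : z \in s ++ t by apply: wcomp; rewrite inE eqxx.
rewrite mem_cat; case: (boolP (z \in s)) => zs /= zt.
  rewrite (negbTE (dst _ zs)) /= -andbA; congr (_ && _).
  rewrite all_filter; apply: eq_in_all => x xu /=.
  case: (boolP (x \in s)) (wcomp' x xu) => //= xs xt.
  by have /andP[_ ->] := h _ _ zs xt.
rewrite zt /= andbCA; congr (_ && (_ && _)).
rewrite all_filter; apply: eq_in_all => x xu /=.
case: (boolP (x \in t)) (wcomp' x xu) => //=; rewrite orbF => xt xs.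
by have /andP[-> _] := h _ _ xs zt.
Qed.

Lemma big_pick (S : eqType) (r : seq S) (P : pred S) (G : S -> A) a :
  uniq r -> a \in r ->
  \sum_(x <- r | P x) (if a == x then G x else 0) = if P a then G a else 0.
Proof.
move=> ur ar; rewrite big_mkcond (bigD1_seq a) //= eqxx big1 ?addr0 // => x xa.
by rewrite eq_sym (negbTE xa) if_same.
Qed.

(** If no entry of [s] is related to an entry of [t], a linear extension of
    [s ++ t] is a shuffle of linear extensions of [s] and [t]. *)
Lemma le_sum_cat s t F : uniq (s ++ t) ->
  (forall v w, v \in s -> w \in t -> ~~ par v w && ~~ par w v) ->
  le_sum (s ++ t) F = le_sum s (fun x => le_sum t (fun y => sh deg F x y)).
Proof.
move=> ust h; rewrite /le_sum.
have [us _ ut] := and3P (etrans (esym (cat_uniq s t)) ust).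
pose c u := F u *~ koszul deg (s ++ t) u.
(* An ordering is counted at the pair of orderings it induces on the parts. *)
transitivity (\sum_(o1 <- permutations s | parents_before o1)
  \sum_(o2 <- permutations t | parents_before o2)
   \sum_(u <- permutations (s ++ t))
     (if filter (mem s) u == o1 then if filter (mem t) u == o2 then c u else 0 else 0)).
  rewrite [RHS](eq_bigr (fun o1 => \sum_(u <- permutations (s ++ t))
      \sum_(o2 <- permutations t | parents_before o2)
     (if filter (mem s) u == o1 then if filter (mem t) u == o2 then c u else 0 else 0)));
    last by move=> o1 _; exact: exchange_big.
  rewrite [RHS]exchange_big /= big_mkcond big_seq [RHS]big_seq; apply: eq_bigr => u.
  rewrite mem_permutations => p.
  have uu : uniq u by rewrite (perm_uniq p).
  have wcomp x : (x \in u) = (x \in s) || (x \in t) by rewrite (perm_mem p) mem_cat.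
  have p1 : filter (mem s) u \in permutations s.
    rewrite mem_permutations; apply: uniq_perm; rewrite ?filter_uniq // => x.
    by rewrite mem_filter wcomp /=; case: (x \in s).
  have p2 : filter (mem t) u \in permutations t.
    rewrite mem_permutations; apply: uniq_perm; rewrite ?filter_uniq // => x.
    by rewrite mem_filter wcomp /=; case: (x \in t); rewrite ?orbT.
  rewrite (eq_bigr (fun o1 => if filter (mem s) u == o1 then
     (if parents_before (filter (mem t) u) then c u else 0) else 0)); last first.
    move=> o1 _; case: eqP => _; last by rewrite big1.
    by rewrite (@big_pick _ _ _ (fun=> c u)) ?permutations_uniq.
  rewrite (@big_pick _ _ _ (fun=> if parents_before (filter (mem t) u) then c u else 0))
    ?permutations_uniq // (parents_before_split ust p h).
  by case: (parents_before (filter (mem s) u)).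
rewrite big_seq_cond [RHS]big_seq_cond; apply: eq_bigr => o1 /andP[p1 _].
rewrite mulrz_suml big_seq_cond [RHS]big_seq_cond; apply: eq_bigr => o2 /andP[p2 _].
move: p1 p2; rewrite !mem_permutations => p1 p2.
have u12 : uniq (o1 ++ o2) by rewrite (perm_uniq (perm_cat p1 p2)).
rewrite -shufflesE // !mulrz_suml.
rewrite (eq_bigr (fun u => if (filter (mem s) u == o1) && (filter (mem t) u == o2) then c u else 0));
  last by move=> u _; case: (filter (mem s) u == o1).
rewrite -[LHS]big_mkcond -[LHS]big_filter.
have pe : perm_eq [seq u <- permutations (s ++ t) | (filter (mem s) u == o1) && (filter (mem t) u == o2)]
   (shuffles o1 o2).
  apply: uniq_perm; rewrite ?filter_uniq ?permutations_uniq // => u.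
  by rewrite mem_shuffles mem_filter mem_permutations (shuffled_filter _ ust p1 p2) andbC.
rewrite (perm_big _ pe) big_seq [RHS]big_seq; apply: eq_bigr => u.
rewrite mem_shuffles (shuffled_filter _ ust p1 p2) => /and3P[p /eqP e1 /eqP e2].
rewrite /c koszul_split // e1 e2 -!mulrzA; congr (_ *~ _).
by rewrite mulrC [_ * koszul deg t o2]mulrC mulrA.
Qed.

(** An entry above all others has to come first. It is enough to know that
    each entry of [s] has a parent: the first entry of an admissible ordering
    has none, hence is [r]. *)
Lemma le_sum_root r s F : uniq (r :: s) ->
  (forall v, v \in s -> exists2 u, u \in r :: s & par u v) ->
  (forall v, ~~ par v v) -> (forall v, v \in s -> ~~ par v r) ->
  le_sum (r :: s) F = le_sum s (fun x => F (r :: x)).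
Proof.
move=> urs hp irr hr; rewrite /le_sum -big_filter -[RHS]big_filter.
have pe : perm_eq [seq o <- permutations (r :: s) | parents_before o]
   (map (cons r) [seq o <- permutations s | parents_before o]).
  apply: uniq_perm; first by rewrite filter_uniq ?permutations_uniq.
    rewrite map_inj_uniq ?filter_uniq ?permutations_uniq //.
    by move=> x y [].
  move=> u; rewrite mem_filter mem_permutations; apply/andP/mapP.
    case: u => [[_ /perm_size//]|z u [/= /andP[az pu] p]].
    have zr : z = r.
      have : z \in r :: s by rewrite -(perm_mem p) inE eqxx.
      rewrite inE => /orP[/eqP//|/hp[v vrs vz]].
      move: vrs; rewrite -(perm_mem p) inE => /orP[/eqP e|vu].
        by have := irr z; rewrite -{1}e vz.
      by have := allP az v vu; rewrite vz.
    exists u; last by rewrite zr.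
    rewrite mem_filter [parents_before _]pu mem_permutations.
    by rewrite -(perm_cons r) -{1}zr.
  case=> v; rewrite mem_filter mem_permutations => /andP[pv p] ->.
  split; last by rewrite perm_cons.
  rewrite /parents_before /= [pairwise _ _]pv andbT; apply/allP => x xv.
  by apply: hr; rewrite -(perm_mem p).
rewrite (perm_big _ pe) big_map; apply: eq_bigr => o _.
rewrite (@koszul_head _ _ r o [::] s) // mulrC; congr (_ *~ _).
by rewrite muln0 mulr1.
Qed.

Lemma eq_le_sum s F G : F =1 G -> le_sum s F = le_sum s G.
Proof. by move=> h; apply: eq_bigr => o _; rewrite h. Qed.

Lemma le_sum0 F : le_sum [::] F = F [::].
Proof. by rewrite /le_sum big_cons big_nil /= addr0. Qed.
End LinearExtensions.

(** * The element of a tree is a sum over linear extensions *)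

(** Addresses tell which vertices are related: the vertices of a subtree share
    its address as a prefix, and distinct siblings have incomparable ones. *)
Lemma vertices_prefix :
  (forall t a o v, v \in vertices a o t -> exists p, v.1 = a ++ p) /\
  (forall us a j o v, v \in kids a j o us ->
    exists j' p, (j <= j')%N /\ v.1 = rcons a j' ++ p).
Proof.
apply: tree_forest_ind.
- by [].
- move=> ts Qts a o v; rewrite vertices_Node inE => /orP[/eqP->|/Qts[j [p [_ ->]]]].
    by exists [::]; rewrite cats0.
  by exists (j :: p); rewrite cat_rcons.
- by [].
- move=> t ts Pt Qts a j o v; rewrite /= mem_cat => /orP[/Pt[p ->]|/Qts[j' [p [jj ->]]]].
    by exists j, p.
  by exists j', p; split=> //; exact: ltnW.
Qed.

Lemma not_parent_size (v w : vertex) : (size w.1 <= size v.1)%N -> ~~ is_parent v w.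
Proof.
move=> h; apply/negP => /andP[w0 /eqP/(congr1 size)].
rewrite size_takel ?leq_pred // => e; move: h; rewrite e.
by case: (w.1) w0 => //= x s _; rewrite ltnn.
Qed.

Lemma not_parent_branch a j j' p q (v w : vertex) : j != j' ->
  v.1 = rcons a j ++ p -> w.1 = rcons a j' ++ q -> ~~ is_parent v w.
Proof.
move=> jj ev ew; case: (ltnP (size v.1) (size w.1)); last exact: not_parent_size.
rewrite ev ew !size_cat !size_rcons => h; apply/negP => /andP[_].
rewrite ev ew => /eqP/(congr1 (nth 0%N ^~ (size a))).
have q0 : (0 < size q)%N by move: h; rewrite ltn_add2l; apply: leq_ltn_trans.
rewrite nth_take; last first.
  by rewrite size_cat size_rcons /= -[X in (X < _)%N]addn0 ltn_add2l.
by rewrite !nth_cat !size_rcons ltnSn !nth_rcons ltnn eqxx => e; rewrite e eqxx in jj.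
Qed.

Lemma vertices_parent :
  (forall t a o v, v \in vertices a o t ->
     v.1 = a \/ exists2 u, u \in vertices a o t & is_parent u v) /\
  (forall us a j o v, v \in kids a j o us ->
     take (size v.1).-1 v.1 = a \/ exists2 u, u \in kids a j o us & is_parent u v).
Proof.
apply: tree_forest_ind.
- by [].
- move=> ts Qts a o v; rewrite vertices_Node inE => /orP[/eqP->|vk]; first by left.
  right; case: (Qts _ _ _ _ vk) => [e|[u uk uv]]; last first.
    by exists u => //; rewrite inE uk orbT.
  exists (a, sectors o ts); first by rewrite inE eqxx.
  rewrite /is_parent e eqxx andbT.
  have [j [p [_ ->]]] := vertices_prefix.2 _ _ _ _ _ vk.
  by rewrite cat_rcons; case: (a).
- by [].
- move=> t ts Pt Qts a j o v; rewrite /= mem_cat => /orP[/Pt[->|[u uv1 uv]]|/Qts[->|[u uv1 uv]]].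
  - by left; rewrite size_rcons /= -cats1 take_size_cat.
  - by right; exists u => //; rewrite mem_cat uv1.
  - by left.
  - by right; exists u => //; rewrite mem_cat uv1 orbT.
Qed.

Lemma kids_branch a j o o' t us (v w : vertex) :
  v \in vertices (rcons a j) o t -> w \in kids a j.+1 o' us ->
  [/\ v != w, ~~ is_parent v w & ~~ is_parent w v].
Proof.
move=> /(vertices_prefix.1 _ _ _ _)[p ev] /(vertices_prefix.2 _ _ _ _ _)[j' [q [jj ew]]].
have nj : j != j' by apply: contraTneq jj => ->; rewrite ltnn.
split.
- apply: contraNneq nj => e; move: ew; rewrite -e ev => /(congr1 (nth 0%N ^~ (size a))).
  by rewrite !nth_cat !size_rcons ltnSn !nth_rcons ltnn eqxx => ->.
- exact: not_parent_branch nj ev ew.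
- by apply: not_parent_branch ew ev; rewrite eq_sym.
Qed.

Lemma vertices_uniq :
  (forall t a o, uniq (vertices a o t)) /\ (forall us a j o, uniq (kids a j o us)).
Proof.
apply: tree_forest_ind.
- by [].
- move=> ts Qts a o; rewrite vertices_Node /= Qts andbT; apply/negP => h.
  have [j [p [_]]] := vertices_prefix.2 _ _ _ _ _ h.
  by move/(congr1 size); rewrite /= size_cat size_rcons; lia.
- by [].
- move=> t ts Pt Qts a j o; rewrite /= cat_uniq Pt Qts andbT /=.
  apply/hasPn => w wk; apply/negP => /= vk.
  by have [] := kids_branch vk wk; rewrite eqxx.
Qed.

Definition vdim (v : vertex) : nat := dim v.2.

Lemma le_sum_tsum (A : zmodType) :
  (forall t a o (f : word -> A),
    le_sum vdim is_parent (vertices a o t) (fun x => f (unzip2 x)) = tsum t o f) /\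
  (forall us a j o (f : word -> A),
    le_sum vdim is_parent (kids a j o us) (fun x => f (unzip2 x)) = fsum us o f).
Proof.
apply: tree_forest_ind.
- by move=> a o f; rewrite le_sum0.
- move=> ts Qts a o f; rewrite vertices_Node le_sum_root.
  - by rewrite tsum_Node -(Qts a 0%N o).
  - by have := vertices_uniq.1 (Node ts) a o; rewrite vertices_Node.
  - move=> v vk; have vk' : v \in vertices a o (Node ts) by rewrite vertices_Node inE vk orbT.
    case: (vertices_parent.1 _ _ _ _ vk') => [e|]; last by rewrite vertices_Node.
    have [j [p [_]]] := vertices_prefix.2 _ _ _ _ _ vk.
    by rewrite e; move/(congr1 size); rewrite /= size_cat size_rcons; lia.
  - by move=> v; apply: not_parent_size.
  - move=> v vk; apply: not_parent_size; have [j [p [_ ->]]] := vertices_prefix.2 _ _ _ _ _ vk.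
    by rewrite size_cat size_rcons /=; lia.
- by move=> a j o f; rewrite le_sum0.
- move=> t ts Pt Qts a j o f; rewrite /= le_sum_cat.
  - rewrite -(Pt (rcons a j)); apply: eq_le_sum => x; rewrite -(Qts a j.+1).
    by apply: eq_le_sum => y; rewrite /unzip2 (@sh_map _ _ vdim dim).
  - by have := vertices_uniq.2 (t :: ts) a j o.
  - by move=> v w vk wk; have [_ -> ->] := kids_branch vk wk.
Qed.

Lemma tree_elt_tsum n k t : tree_elt n k t = tsum t 0 (expr n k).
Proof. exact: (le_sum_tsum _).1. Qed.

Lemma filter_sep (S : eqType) (a : pred S) (s t : seq S) :
  all a s -> all (predC a) t -> filter a (s ++ t) = s.
Proof.
move=> /all_filterP sa ta; rewrite filter_cat sa; apply/eqP.
rewrite -[X in _ == X]cats0 eqseq_cat // eqxx -size_eq0 size_filter -leqn0 leqNgt -has_count.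
by rewrite -all_predC.
Qed.

(** If the blocks of the two factors can be told apart by [a], a given word is
    a shuffle of [x] and [y] for one choice of [x] and [y] only. Moreover
    [w0 ++ w1] occurs exactly once among the shuffles of [w0] and [w1]. *)
Lemma sh_delta (w0 w1 x y : word) (a : pred block) :
  all a w0 -> all a x -> all (predC a) w1 -> all (predC a) y ->
  shw (fun u => (u == w0 ++ w1)%:R : int) x y = ((x == w0) && (y == w1))%:R.
Proof.
move=> a0 ax a1 ay.
have E : ~~ ((x == w0) && (y == w1)) ->
  shw (fun u => (u == w0 ++ w1)%:R : int) x y = 0.
  move=> n; rewrite -(sh_0 dim int x y); apply: sh_ext => u /and3P[p sx sy].
  case: eqP => // e; case/negP: n; subst u.
  have px : perm_eq x w0.
    have := perm_filter a p; rewrite !filter_sep // perm_sym //.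
  have py : perm_eq y w1.
    have := perm_filter (predC a) p; rewrite !filter_cat.
    have F s0 : all a s0 -> filter (predC a) s0 = [::].
      by elim: s0 => //= b s0 IH /andP[-> /IH].
    by rewrite (F w0) // (F x) // !cat0s (all_filterP a1) (all_filterP ay) perm_sym.
  have wcomp (b : pred block) s0 u0 : all b s0 -> subseq s0 u0 -> subseq s0 (filter b u0).
    by move=> bs; rewrite subseq_filter bs.
  have := wcomp a x _ ax sx; rewrite filter_sep // => /size_subseq_leqif h.
  have := wcomp (predC a) y _ ay sy; rewrite filter_cat.
  have -> : filter (predC a) w0 = [::] by elim: (w0) a0 => //= b s0 IH /andP[-> /IH].
  rewrite cat0s (all_filterP a1) => /size_subseq_leqif h'.
  by rewrite -h.2 -h'.2 (perm_size px) (perm_size py) !eqxx.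
case: (boolP ((x == w0) && (y == w1))) => [/andP[/eqP-> /eqP->]|]; last exact: E.
elim: w0 w1 a0 a1 {E ax ay x y} => [|b w0 IH] w1 a0 a1; first by rewrite sh0s eqxx.
case: w1 a1 => [|c w1] a1; first by rewrite shs0 cats0 eqxx.
rewrite sh_cons (eq_sh (g := fun u => (u == w0 ++ c :: w1)%:R : int)); last first.
  by move=> u; rewrite /= eqseq_cons eqxx.
rewrite IH ?(eq_sh (g := fun=> 0 : int)) ?sh_0 ?sg_0 ?addr0 //.
- move=> u; rewrite /= eqseq_cons; case: eqP => // cb.
  by move: a0 a1; rewrite cb /= => /andP[->].
- by case/andP: a0.
Qed.

(** * Linear independence of the elements of trees *)

HB.instance Definition _ := gen_eqMixin ptree.

Definition delta (w0 w : word) : int := (w == w0)%:R.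

(** The sectors at the root determine the sizes of all subtrees but the
    last, whose size follows from the total number of leaves. *)
Lemma sectors_inj o t t' ts ts' :
  sectors o (t :: ts) = sectors o (t' :: ts') ->
  forest_leaves (t :: ts) = forest_leaves (t' :: ts') ->
  map leaves (t :: ts) = map leaves (t' :: ts').
Proof.
elim: ts o t t' ts' => [|u ts IH] o t t' [|u' ts'] //=.
  by move=> _; rewrite /forest_leaves /= !addn0 => ->.
case=> /eqP; rewrite eqn_add2l => /eqP e; rewrite e => es.
rewrite /forest_leaves /= e => /eqP; rewrite eqn_add2l => /eqP el.
by congr cons; apply: (IH (o + leaves t')%N).
Qed.

Lemma dfs_range o t w x : branching t -> perm_eq w (dfs_word o t) ->
  x \in flatten w -> (o < x < o + leaves t)%N.
Proof.
move=> bt /perm_flatten p; rewrite (perm_mem p) (perm_mem (dfs_letters.1 t o bt)).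
rewrite mem_iota; have := leaves_gt0 bt; lia.
Qed.

Lemma dfs_forest_range o us w x : all branching us -> perm_eq w (dfs_forest o us) ->
  x \in flatten w -> (o <= x)%N.
Proof.
move=> bt /perm_flatten p; rewrite (perm_mem p) => xw.
have : x \in starts o us ++ flatten (dfs_forest o us) by rewrite mem_cat xw orbT.
by rewrite (perm_mem (dfs_letters.2 us o bt)) mem_iota => /andP[].
Qed.

(** The depth-first word of [t'] occurs in the sum of [t] only if the first
    blocks agree, which fixes the sizes of the subtrees. The letters of the
    first subtree are then smaller than all others, so [sh_delta] separates it
    from the remaining subtrees. *)
Lemma tsum_fsum_delta :
  (forall t o t', branching t -> branching t' -> leaves t = leaves t' ->
     tsum t o (delta (dfs_word o t')) = (t == t')%:R) /\
  (forall us o us', all branching us -> all branching us' ->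
     map leaves us = map leaves us' ->
     fsum us o (delta (dfs_forest o us')) = (us == us')%:R).
Proof.
apply: tree_forest_ind.
- move=> o [|ts'] _ bt' _; first by rewrite /= /delta !eqxx.
  by rewrite dfs_Node /= /delta /=; case: eqP.
- move=> ts Qts o [|ts'] bt bt' el.
    rewrite tsum_Node (fsum_ext _ _ _ (fun=> 0)) ?fsum_0; first by case: eqP.
    by move=> w _; rewrite /delta.
  have -> : (Node ts == Node ts') = (ts == ts') by apply/eqP/eqP => [[]|->].
  case/andP: bt => s bs; case/andP: bt' => s' bs'.
  rewrite tsum_Node dfs_Node /delta.
  have [es|es] := eqVneq (sectors o ts) (sectors o ts').
    have em : map leaves ts = map leaves ts'.
      case: ts ts' s s' es el {Qts bs bs'} => [//|t ts] [//|t' ts'] _ _.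
      exact: sectors_inj.
    rewrite -(Qts o) //; apply: fsum_ext => w _; rewrite es.
    by rewrite /delta eqseq_cons eqxx.
  rewrite (fsum_ext _ _ _ (fun=> 0)) ?fsum_0.
    by case: eqP => // e; rewrite e eqxx in es.
  by move=> w _; rewrite eqseq_cons (negbTE es).
- by move=> o [].
- move=> t ts Pt Qts o [//|t' ts'] /andP[bt bts] /andP[bt' bts'] /= [et ets].
  (* The predicate that tells the blocks of the first subtree from the others. *)
  pose a (b : block) := all (fun x => x < o + leaves t)%N b.
  have in_a t0 w : branching t0 -> leaves t0 = leaves t -> perm_eq w (dfs_word o t0) -> all a w.
    move=> b0 l0 p; apply/allP => b bw; apply/allP => x xb.
    have xw : x \in flatten w by apply/flattenP; exists b.
    by have := dfs_range b0 p xw; rewrite l0 => /andP[].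
  have out_a us w : all branching us ->
     perm_eq w (dfs_forest (o + leaves t) us) -> all (predC a) w.
    move=> bus p; apply/allP => b bw /=; apply/negP => /allP ab.
    have : b != [::].
      have := dfs_blocky.2 us (o + leaves t)%N bus; rewrite -(blocky_perm p).
      by move/allP; apply.
    case: b bw ab => // x b bw ab _; have := ab x; rewrite inE eqxx => /(_ isT).
    rewrite ltnNge (dfs_forest_range bus p) //.
    by apply/flattenP; exists (x :: b); rewrite ?inE ?eqxx.
  transitivity (tsum t o (fun x => fsum ts (o + leaves t) (fun y =>
      (if x == dfs_word o t' then delta (dfs_forest (o + leaves t) ts') y else 0)))).
    apply: tsum_ext => x px; apply: fsum_ext => y py.
    rewrite /delta /= -et (@sh_delta _ _ _ _ a) //.
    - by case: (x == dfs_word o t').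
    - exact: (in_a t' _ bt' (esym et) (perm_refl _)).
    - exact: (in_a t x bt erefl px).
    - exact: (out_a ts' _ bts' (perm_refl _)).
    - exact: (out_a ts y bts py).
  transitivity (tsum t o (fun x => if ts == ts' then delta (dfs_word o t') x else 0)).
    apply: tsum_ext => x _; rewrite /delta; case: (x == dfs_word o t').
      rewrite -/(delta _) Qts //; by case: (ts == ts').
    by rewrite fsum_0; case: ifP.
  rewrite eqseq_cons andbC; case: (ts == ts'); last by rewrite tsum_0.
  by rewrite Pt //; case: (t == t').
Qed.

Definition pcoef n k (w0 : word) (x : Pi_mod n k) : int :=
  fglift (fun b : pi_basis n k => (val b == w0)%:R : int^o) x.

Lemma pcoef_additive n k w0 : additive (@pcoef n k w0).
Proof. exact: (@fgliftB _ (int^o) _). Qed.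
HB.instance Definition _ n k w0 :=
  GRing.isAdditive.Build (Pi_mod n k) int (@pcoef n k w0) (@pcoef_additive n k w0).

Lemma pcoef_expr n k w0 w : is_expr n k w -> all (sorted ltn) w ->
  pcoef w0 (expr n k w) = delta w0 w.
Proof.
move=> ew aw; have h : is_expr n k w && all (sorted ltn) w by rewrite ew.
have -> : w = val (Sub w h : pi_basis n k) by rewrite SubK.
rewrite expr_val /pcoef liftU scale1r //.
Qed.

Lemma cell_expr n k t w : (0 < n)%N -> is_cell n k t -> perm_eq w (dfs_word 0 t) ->
  is_expr n k w.
Proof.
move=> n0 /and3P[bt /eqP lt /eqP dt] p; apply/and4P; split=> //.
- by rewrite -/(blocky w) (blocky_perm p); exact: dfs_blocky.1.
- rewrite (permPl (perm_flatten p)).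
  by have := dfs_letters.1 t 0%N bt; rewrite lt.
- by rewrite (dims_perm p) -dt /tree_vertices dfs_vertices.
Qed.

Lemma pcoef_tree n k t t' : (0 < n)%N -> is_cell n k t -> is_cell n k t' ->
  pcoef (dfs_word 0 t') (tree_elt n k t) = (t == t')%:R.
Proof.
move=> n0 ct ct'; rewrite tree_elt_tsum (raddf_tsum (@pcoef n k (dfs_word 0 t'))).
have [/and3P[bt /eqP lt _] /and3P[bt' /eqP lt' _]] := (ct, ct').
rewrite -(tsum_fsum_delta.1 t 0%N t') ?lt //; apply: tsum_ext => w p.
rewrite -[LHS]/(pcoef _ _) pcoef_expr //; first exact: cell_expr p.
by rewrite (perm_all _ p); exact: dfs_sorted.1.
Qed.

(** * The free operad on three generators *)

Inductive gen := Glt | Ggt | Gbar.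
(** A vertex of a binary tree stands for one of the three generators; since
    there are no unary or higher generators, this is a basis of the free
    operad. *)
Inductive btree := bleaf | bnode of gen & btree & btree.

HB.instance Definition _ := gen_eqMixin btree.
HB.instance Definition _ := gen_choiceMixin btree.

Definition gdeg (g : gen) : nat := if g is Gbar then 1 else 0.

Fixpoint bleaves (t : btree) : nat := if t is bnode _ l r then (bleaves l + bleaves r)%N else 1%N.
Fixpoint bdeg (t : btree) : nat :=
  if t is bnode g l r then (gdeg g + bdeg r + bdeg l)%N else 0%N.

Definition btyped (n k : nat) (t : btree) := (bleaves t == n) && (bdeg t == k).

Lemma bleaves_gt0 t : (0 < bleaves t)%N.
Proof. by elim: t => //= g l IHl r IHr; rewrite addn_gt0 IHl. Qed.

Fixpoint graft (i : nat) (t s : btree) : btree :=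
  if t is bnode g l r then
    if (i <= bleaves l)%N then bnode g (graft i l s) r
    else bnode g l (graft (i - bleaves l) r s)
  else s.
(** The degree of what hangs to the left of the path to the leaf [i]. As a
    tree stands for the composite [(g o_2 r) o_1 l], the degrees of its vertices
    are read from the root to the right subtree and then to the left one; a
    tree grafted at [i] has to be moved across what lies to the left. *)
Fixpoint left_deg (i : nat) (t : btree) : nat :=
  if t is bnode g l r then
    if (i <= bleaves l)%N then left_deg i l else (bdeg l + left_deg (i - bleaves l) r)%N
  else 0%N.

Lemma bleaves_graft i t s : (bleaves (graft i t s)).+1 = (bleaves t + bleaves s)%N.
Proof.
elim: t i => //= g l IHl r IHr i; case: ifP => _ /=.
  by have := IHl i; lia.
by have := IHr (i - bleaves l)%N; lia.
Qed.

Lemma bdeg_graft i t s : bdeg (graft i t s) = (bdeg t + bdeg s)%N.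
Proof.
elim: t i => //= g l IHl r IHr i; case: ifP => _ /=; rewrite ?IHl ?IHr; lia.
Qed.

Lemma graft_seq i j t s u : (0 < i <= bleaves t)%N -> (0 < j <= bleaves s)%N ->
  graft (i.-1 + j) (graft i t s) u = graft i t (graft j s u) /\
  left_deg (i.-1 + j) (graft i t s) = (left_deg i t + left_deg j s)%N.
Proof.
move=> + hj; elim: t i => [|g l IHl r IHr] i hi.
  by have -> : i = 1%N by move: hi => /=; lia.
have hl := bleaves_graft i l s; have hr := bleaves_graft (i - bleaves l) r s.
rewrite /=; case: (leqP i (bleaves l)) => il /=.
  have -> : (i.-1 + j <= bleaves (graft i l s))%N by lia.
  have [|-> ->] := IHl i; [lia|by []].
have -> : (i.-1 + j <= bleaves l)%N = false by apply/negbTE; rewrite -ltnNge; lia.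
have -> : (i.-1 + j - bleaves l = (i - bleaves l).-1 + j)%N by lia.
have [|-> ->] := IHr (i - bleaves l)%N; [by move: hi => /=; lia|by rewrite addnA].
Qed.

Lemma graft_par i k t s u : (0 < i)%N -> (i < k)%N -> (k <= bleaves t)%N ->
  [/\ graft (k + bleaves s).-1 (graft i t s) u = graft i (graft k t u) s,
      left_deg (k + bleaves s).-1 (graft i t s) = (left_deg k t + bdeg s)%N &
      left_deg i (graft k t u) = left_deg i t].
Proof.
move=> i0 ik; elim: t i k i0 ik => [|g l IHl r IHr] i k i0 ik kt.
  by move: kt => /=; lia.
have hl := bleaves_graft i l s; have hr := bleaves_graft (k - bleaves l) r u.
have hl' := bleaves_graft k l u; have s0 := bleaves_gt0 s; have u0 := bleaves_gt0 u.
rewrite /=; case: (leqP i (bleaves l)) => il; case: (leqP k (bleaves l)) => kl /=.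
- have -> : ((k + bleaves s).-1 <= bleaves (graft i l s))%N by lia.
  have -> : (i <= bleaves (graft k l u))%N by lia.
  by have [] := IHl i k i0 ik kl => -> -> ->.
- have -> : ((k + bleaves s).-1 <= bleaves (graft i l s))%N = false.
    by apply/negbTE; rewrite -ltnNge; lia.
  rewrite il; have -> : ((k + bleaves s).-1 - bleaves (graft i l s) = k - bleaves l)%N by lia.
  by rewrite bdeg_graft; split=> //; lia.
- by lia.
have -> : ((k + bleaves s).-1 <= bleaves l)%N = false by apply/negbTE; rewrite -ltnNge; lia.
rewrite leqNgt il /=.
have -> : ((k + bleaves s).-1 - bleaves l = (k - bleaves l + bleaves s).-1)%N by lia.
have [|||-> -> ->] := IHr (i - bleaves l)%N (k - bleaves l)%N; try lia.
- by move: kt => /=; lia.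
- by rewrite addnA.
Qed.

Section bdiff.
Variable A : zmodType.
Implicit Types (f h : btree -> A).

(** The differential of the generators, as a multiple of [Gbar]. *)
Definition gdiff (g : gen) (x : A) : A :=
  match g with Glt => x | Ggt => - x | Gbar => 0 end.

(** The derivation of the free operad that extends the differential of the
    generators: one vertex is changed at a time, the signs being those of the
    order root, right subtree, left subtree. *)
Fixpoint bdiff f (t : btree) : A :=
  if t is bnode g l r then
    gdiff g (f (bnode Gbar l r))
    + (sg (gdeg g) (bdiff (fun r' => f (bnode g l r')) r)
    + sg (gdeg g + bdeg r) (bdiff (fun l' => f (bnode g l' r)) l))
  else 0.

Lemma bdiff_ext f h t :
  (forall t', bleaves t' = bleaves t -> bdeg t' = (bdeg t).+1 -> f t' = h t') ->
  bdiff f t = bdiff h t.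
Proof.
elim: t f h => //= g l IHl r IHr f h e; congr (_ + (sg _ _ + sg _ _)).
- case: g e => //= e; [|congr -%R]; apply: e => //=; lia.
- by apply: IHr => r' b d; apply: e => /=; rewrite ?b // d; lia.
- by apply: IHl => l' b d; apply: e => /=; rewrite ?b // d; lia.
Qed.

Lemma gdiffD g x y : gdiff g (x + y) = gdiff g x + gdiff g y.
Proof. by case: g => //=; rewrite ?opprD ?addr0. Qed.

Lemma gdiff_sg g n x : gdiff g (sg n x) = sg n (gdiff g x).
Proof. by case: g => //=; rewrite ?sg_0 // /sg; case: odd. Qed.

Lemma bdiffD f h t : bdiff (fun t' => f t' + h t') t = bdiff f t + bdiff h t.
Proof.
elim: t f h => [|g l IHl r IHr] f h /=; first by rewrite addr0.
rewrite gdiffD IHl IHr !sgD.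
by rewrite [LHS](AC (2*(2*2)) ((1*(3*5))*(2*(4*6)))).
Qed.

Lemma bdiff_sg n f t : bdiff (fun t' => sg n (f t')) t = sg n (bdiff f t).
Proof.
elim: t f => [|g l IHl r IHr] f /=; first by rewrite sg_0.
by rewrite gdiff_sg IHl IHr !sgD !sg_sg addnC [(_ + n)%N in X in _ + (_ + X)]addnC.
Qed.

Lemma bdiff_0 t : bdiff (fun=> 0) t = 0.
Proof.
elim: t => //= g l -> r ->; rewrite !sg_0 !addr0.
by case: g => //=; rewrite oppr0.
Qed.

Lemma bdiff_gdiff g f t : bdiff (fun t' => gdiff g (f t')) t = gdiff g (bdiff f t).
Proof.
case: g => //=; last exact: bdiff_0.
by rewrite -[RHS]/(sg 1 _) -bdiff_sg.
Qed.

Lemma bdiff_exchange (f : btree -> btree -> A) l r :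
  bdiff (fun r' => bdiff (fun l' => f l' r') l) r =
  bdiff (fun l' => bdiff (fun r' => f l' r') r) l.
Proof.
elim: l f => [|g l IHl m IHm] f /=; first exact: bdiff_0.
by rewrite !bdiffD bdiff_gdiff !bdiff_sg IHl IHm.
Qed.

(** Changing two different vertices in either order gives opposite signs, and
    no vertex can be changed twice. *)
Lemma bdiff_bdiff f t : bdiff (fun t' => bdiff f t') t = 0.
Proof.
elim: t f => [|g l IHl r IHr] f //=.
have E1 : bdiff (fun r' => gdiff g (f (bnode Gbar l r'))
    + (sg (gdeg g) (bdiff (fun r'' => f (bnode g l r'')) r')
    + sg (gdeg g + bdeg r') (bdiff (fun l' => f (bnode g l' r')) l))) r =
    gdiff g (bdiff (fun r' => f (bnode Gbar l r')) r)
    + sg (gdeg g + (bdeg r).+1) (bdiff (fun l' => bdiff (fun r' => f (bnode g l' r')) r) l).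
  rewrite bdiffD bdiff_gdiff; congr (_ + _); rewrite bdiffD bdiff_sg IHr sg_0 add0r.
  rewrite -bdiff_exchange -bdiff_sg; apply: bdiff_ext => r' _ d; by rewrite d.
have E2 : bdiff (fun l' => gdiff g (f (bnode Gbar l' r))
    + (sg (gdeg g) (bdiff (fun r'' => f (bnode g l' r'')) r)
    + sg (gdeg g + bdeg r) (bdiff (fun l'' => f (bnode g l'' r)) l'))) l =
    gdiff g (bdiff (fun l' => f (bnode Gbar l' r)) l)
    + sg (gdeg g) (bdiff (fun l' => bdiff (fun r' => f (bnode g l' r')) r) l).
  by rewrite bdiffD bdiff_gdiff; congr (_ + _); rewrite bdiffD !bdiff_sg IHl sg_0 addr0.
rewrite E1 E2 add0r; set X := bdiff _ l; set Y := bdiff _ r; set Z := bdiff _ l.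
rewrite !gdiffD !gdiff_sg !sgD !sg_sg.
rewrite [LHS](AC (2*(2*2)) ((1*3)*((2*5)*(4*6)))) /=.
rewrite [X in _ + (_ + X)]sg_odd_opp; last by parity.
by move: X Y Z {E1 E2} => X Y Z; case: g => /=; rewrite ?sg_0 ?addr0 ?add0r //;
  rewrite !sg_odd_opp ?addr0 //; parity.
Qed.

Lemma bdiff_graft f i t s : (0 < i <= bleaves t)%N ->
  sg (bdeg s * left_deg i t) (bdiff f (graft i t s)) =
    bdiff (fun t' => sg (bdeg s * left_deg i t') (f (graft i t' s))) t
    + sg (bdeg t + (bdeg s).+1 * left_deg i t) (bdiff (fun s' => f (graft i t s')) s).
Proof.
elim: t f i => [|g l IHl r IHr] f i hi.
  by rewrite /= muln0 add0r muln0 sg0.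
case: (leqP i (bleaves l)) => il.
  have il' : (0 < i <= bleaves l)%N by move: hi => /=; lia.
  pose f1 l' := f (bnode g l' r); set G := graft i l s.
  have R0 : graft i (bnode g l r) s = bnode g G r by rewrite /= il.
  have R1 : bdiff (fun t' => sg (bdeg s * left_deg i t') (f (graft i t' s))) (bnode g l r) =
      gdiff g (sg (bdeg s * left_deg i l) (f (bnode Gbar G r)))
      + (sg (gdeg g) (sg (bdeg s * left_deg i l) (bdiff (fun r' => f (bnode g G r')) r))
      + sg (gdeg g + bdeg r) (bdiff (fun l' => sg (bdeg s * left_deg i l') (f1 (graft i l' s))) l)).
    rewrite [LHS]/= il; congr (_ + (sg _ _ + sg _ _)); first exact: bdiff_sg.
    by apply: bdiff_ext => l' bleaves' _; rewrite bleaves' il.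
  have R2 : bdiff (fun s' => f (graft i (bnode g l r) s')) s = bdiff (fun s' => f1 (graft i l s')) s.
    by rewrite /= il.
  have R3 : left_deg i (bnode g l r) = left_deg i l by rewrite /= il.
  have IH := IHl f1 i il'; rewrite R0 R1 R2 R3 [bdiff f _]/= gdiff_sg !sgD !sg_sg.
  have -> : sg (bdeg s * left_deg i l + (gdeg g + bdeg r)) (bdiff (fun l' => f (bnode g l' r)) G) =
     sg (gdeg g + bdeg r) (sg (bdeg s * left_deg i l) (bdiff f1 G)).
    by rewrite sg_sg addnC.
  rewrite IH sgD sg_sg !addrA; congr (_ + _ + _ + _); apply: sg_parity; rewrite /=; parity.
have hi' : (0 < i - bleaves l <= bleaves r)%N by move: hi => /=; lia.
set j := (i - bleaves l)%N in hi' *.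
pose f1 r' := f (bnode g l r'); set G := graft j r s.
have il' : (i <= bleaves l)%N = false by apply/negbTE; rewrite -ltnNge.
have R0 : graft i (bnode g l r) s = bnode g l G by rewrite /= il'.
have R3 : left_deg i (bnode g l r) = (bdeg l + left_deg j r)%N by rewrite /= il'.
have R1 : bdiff (fun t' => sg (bdeg s * left_deg i t') (f (graft i t' s))) (bnode g l r) =
    gdiff g (sg (bdeg s * (bdeg l + left_deg j r)) (f (bnode Gbar l G)))
    + (sg (gdeg g) (sg (bdeg s * bdeg l) (bdiff (fun r' => sg (bdeg s * left_deg j r') (f1 (graft j r' s))) r))
    + sg (gdeg g + bdeg r) (sg (bdeg s * ((bdeg l).+1 + left_deg j r)) (bdiff (fun l' => f (bnode g l' G)) l))).
  rewrite [LHS]/= il' -/j; congr (_ + (sg _ _ + sg _ _)).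
    by rewrite -bdiff_sg; apply: bdiff_ext => r' _ _; rewrite sg_sg mulnDr.
  by rewrite -bdiff_sg; apply: bdiff_ext => l' bleaves' d; rewrite bleaves' il' d.
have R2 : bdiff (fun s' => f (graft i (bnode g l r) s')) s = bdiff (fun s' => f1 (graft j r s')) s.
  by rewrite /= il'.
have IH := IHr f1 j hi'; rewrite R0 R1 R2 R3 [bdiff f _]/= gdiff_sg bdeg_graft !sgD !sg_sg.
have -> : sg (bdeg s * (bdeg l + left_deg j r) + gdeg g) (bdiff (fun r' => f (bnode g l r')) G) =
   sg (gdeg g + bdeg s * bdeg l) (sg (bdeg s * left_deg j r) (bdiff f1 G)).
  by rewrite sg_sg; apply: sg_parity; parity.
rewrite IH sgD sg_sg.
rewrite [LHS](AC (1*(2*1)) ((1*(2*4))*3)) /=.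
by congr ((_ + (_ + _)) + _); apply: sg_parity; rewrite /=; parity.
Qed.
End bdiff.

Lemma raddf_bdiff (A B : zmodType) (h : {additive A -> B}) (f : btree -> A) t :
  h (bdiff f t) = bdiff (fun t' => h (f t')) t.
Proof.
elim: t f => [|g l IHl r IHr] f /=; first exact: raddf0.
rewrite !raddfD !raddf_sg IHl IHr; congr (_ + _).
by case: g => //=; rewrite (raddfN, raddf0).
Qed.

Definition F_mod (n k : nat) : zmodType := {freeg {t : btree | btyped n k t} / int}.

(** The basis element of a tree, or 0 in the wrong arity or degree, so that
    arities and degrees need not be carried along as proofs. *)
Definition bmono (n k : nat) (t : btree) : F_mod n k :=
  if insub t is Some b then << b >> else 0.

Lemma bmono_val n k (b : {t : btree | btyped n k t}) : bmono n k (val b) = << b >>.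
Proof. by rewrite /bmono valK. Qed.

Lemma F_eq n k (A : zmodType) (f g : F_mod n k -> A) :
  (forall x y, f (x - y) = f x - f y) -> (forall x y, g (x - y) = g x - g y) ->
  (forall t, btyped n k t -> f (bmono n k t) = g (bmono n k t)) -> f =1 g.
Proof.
move=> fB gB h.
pose f' := GRing.isAdditive.Build _ _ f fB.
pose g' := GRing.isAdditive.Build _ _ g gB.
pose F : {additive F_mod n k -> A} := HB.pack f f'.
pose G : {additive F_mod n k -> A} := HB.pack g g'.
move=> x; rewrite -[f x]/(F x) -[g x]/(G x) -[x]freeg_sumE !raddf_sum.
apply: eq_bigr => b _.
have -> : << coeff b x *g b >> = bmono n k (val b) *~ coeff b x.
  by rewrite bmono_val freeg_mulz -mulrzl mulr1 intz.
by rewrite !raddfMz; congr (_ *~ _); apply: h; case: b.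
Qed.

Definition F_lift (n k : nat) (M : lmodType int) (v : btree -> M) (x : F_mod n k) : M :=
  fglift (fun b : {t : btree | btyped n k t} => v (val b)) x.

Lemma F_liftB n k (M : lmodType int) (v : btree -> M) : additive (@F_lift n k M v).
Proof. exact: fgliftB. Qed.
HB.instance Definition _ n k (M : lmodType int) (v : btree -> M) :=
  GRing.isAdditive.Build (F_mod n k) M (@F_lift n k M v) (@F_liftB n k M v).

Lemma F_lift_bmono n k (M : lmodType int) (v : btree -> M) t : btyped n k t ->
  F_lift v (bmono n k t) = v t.
Proof.
move=> ht; have -> : t = val (exist _ t ht : {t : btree | btyped n k t}) by [].
by rewrite bmono_val /F_lift liftU scale1r.
Qed.

Definition F_comp_bmono (r c i : nat) (t s : btree) : F_mod r c :=
  sg (bdeg s * left_deg i t) (bmono r c (graft i t s)).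

Definition F_comp (m a n b r c i : nat) (x : F_mod m a) (y : F_mod n b) : F_mod r c :=
  F_lift (fun t => F_lift (fun s => F_comp_bmono r c i t s) y) x.

Definition F_d (n k : nat) (x : F_mod n k) : F_mod n k.+1 :=
  F_lift (fun t => bdiff (bmono n k.+1) t) x.

Definition F : dgop :=
  @DGOp F_mod (bmono 1 0 bleaf)
    (fun m a n b r c i _ => @F_comp m a n b r c i) F_d.

Lemma F_ind n k (P : F n k -> Prop) : P 0 ->
  (forall x y, P x -> P y -> P (x + y)) ->
  (forall t c, btyped n k t -> P (bmono n k t *~ c)) ->
  forall x, P x.
Proof.
move=> P0 PD Pt x; rewrite -[x]freeg_sumE; apply: big_ind => // b _.
have -> : << coeff b x *g b >> = bmono n k (val b) *~ coeff b x.
  by rewrite bmono_val freeg_mulz -mulrzl mulr1 intz.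
by apply: Pt; case: b.
Qed.

Lemma F_compBl m a n b r c i (x x' : F_mod m a) (y : F_mod n b) :
  F_comp r c i (x - x') y = F_comp r c i x y - F_comp r c i x' y.
Proof. exact: F_liftB. Qed.

Lemma F_compBr m a n b r c i (x : F_mod m a) (y y' : F_mod n b) :
  F_comp r c i x (y - y') = F_comp r c i x y - F_comp r c i x y'.
Proof.
rewrite /F_comp /F_lift !(fgliftE _ x) -sumrB; apply: eq_bigr => z _.
by rewrite -[fglift _ (y - y')]/(F_lift _ _) raddfB scalerBr.
Qed.

Lemma F_dB n k (x y : F_mod n k) : F_d (x - y) = F_d x - F_d y.
Proof. exact: F_liftB. Qed.

Lemma F_compE m a n b r c i t s : btyped m a t -> btyped n b s ->
  F_comp r c i (bmono m a t) (bmono n b s) = F_comp_bmono r c i t s.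
Proof. by move=> ht hs; rewrite /F_comp !F_lift_bmono. Qed.

Lemma F_dE n k t : btyped n k t -> F_d (bmono n k t) = bdiff (bmono n k.+1) t.
Proof. by move=> ht; rewrite /F_d F_lift_bmono. Qed.

Lemma graft_typed m a n b r c i t s : composable m a n b r c i ->
  btyped m a t -> btyped n b s -> btyped r c (graft i t s).
Proof.
case/and3P=> _ /eqP er /eqP ec /andP[/eqP bt /eqP dt] /andP[/eqP bs /eqP ds].
rewrite /btyped bdeg_graft dt ds ec eqxx andbT.
by have := bleaves_graft i t s; rewrite bt bs -er => -[->].
Qed.

Lemma F_comp_sgl m a n b r c i k (x : F_mod m a) (y : F_mod n b) :
  F_comp r c i (sg k x) y = sg k (F_comp r c i x y).
Proof. exact: (raddf_sg (F_lift (fun t => F_lift (fun s => F_comp_bmono r c i t s) y))). Qed.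

Lemma F_comp_sgr m a n b r c i k (x : F_mod m a) (y : F_mod n b) :
  F_comp r c i x (sg k y) = sg k (F_comp r c i x y).
Proof. exact: (sub_morph_sg (fun y y' => F_compBr r c i x y y')). Qed.

Lemma F_comp_compl m a n b p e r c t g i j x y z : composable m a n b r c i ->
  btyped m a x -> btyped n b y -> btyped p e z ->
  F_comp t g j (F_comp r c i (bmono m a x) (bmono n b y)) (bmono p e z) =
  sg (b * left_deg i x + e * left_deg j (graft i x y)) (bmono t g (graft j (graft i x y) z)).
Proof.
move=> h hx hy hz; rewrite F_compE // F_comp_sgl F_compE //; last exact: graft_typed h _ _.
by rewrite sg_sg; case/andP: hy => _ /eqP->; case/andP: hz => _ /eqP->.
Qed.

Lemma F_comp_compr m a n b p e r c t g i j x y z : composable n b p e r c j ->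
  btyped m a x -> btyped n b y -> btyped p e z ->
  F_comp t g i (bmono m a x) (F_comp r c j (bmono n b y) (bmono p e z)) =
  sg (e * left_deg j y + (b + e) * left_deg i x) (bmono t g (graft i x (graft j y z))).
Proof.
move=> h hx hy hz; rewrite (F_compE r c) // F_comp_sgr F_compE //; last exact: graft_typed h _ _.
by rewrite sg_sg bdeg_graft; case/andP: hy => _ /eqP->; case/andP: hz => _ /eqP->.
Qed.

Theorem F_axioms : dgop_axioms F.
Proof.
split.
- by move=> *; apply: (subr_add (f := fun x => F_comp _ _ _ x _)) => *; exact: F_compBl.
- by move=> *; apply: (subr_add (f := fun x => F_comp _ _ _ _ x)) => *; exact: F_compBr.
- move=> n a h; apply: F_eq => [x y|//|t ht]; first exact: F_compBr.
  by rewrite [LHS]F_compE // /F_comp_bmono muln0.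
- move=> m a i h; apply: F_eq => [x y|//|t ht]; first exact: F_compBl.
  rewrite [LHS]F_compE // /F_comp_bmono mul0n sg0; congr bmono.
  have /and3P[hi _ _] := h; have /andP[/eqP bt _] := ht; rewrite -bt in hi.
  elim: t i hi {ht bt h} => [|g l IHl r IHr] i hi //=.
  case: leqP => il; first by rewrite IHl //; move: hi => /=; lia.
  by rewrite IHr //; move: hi => /=; lia.
- move=> m a n b p e r c s f t g i j h1 h2 h3 h4 x y z.
  rewrite /op_comp /=; move: x; apply: F_eq => [x x'|x x'|u hu]; rewrite ?F_compBl //.
  move: y; apply: F_eq => [y y'|y y'|v hv]; rewrite ?(F_compBl, F_compBr) //.
  move: z; apply: F_eq => [z z'|z z'|w hw]; rewrite ?(F_compBl, F_compBr) //.
  rewrite (F_comp_compl _ _ _ h1) // (F_comp_compr _ _ _ h3) //.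
  have /and3P[hi _ _] := h1; have /and3P[hj _ _] := h3.
  have /andP[/eqP bu /eqP du] := hu; have /andP[/eqP bv /eqP dv] := hv.
  have [||-> ->] := @graft_seq i j u v w; [by rewrite bu|by rewrite bv|].
  by apply: sg_parity; parity.
- move=> m a n b p e r c s f t g i k h1 h2 h3 h4 x y z ik; rewrite sgE.
  rewrite /op_comp /=; move: x; apply: F_eq => [x x'|x x'|u hu]; rewrite ?(F_compBl, sgB) //.
  move: y; apply: F_eq => [y y'|y y'|v hv]; rewrite ?(F_compBl, F_compBr, sgB) //.
  move: z; apply: F_eq => [z z'|z z'|w hw]; rewrite ?(F_compBl, F_compBr, sgB) //.
  rewrite (F_comp_compl _ _ _ h1) // (F_comp_compl _ _ _ h3) //.
  have /and3P[/andP[i0 _] _ _] := h1; have /and3P[/andP[_ hk] _ _] := h3.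
  have /andP[/eqP bu /eqP du] := hu; have /andP[/eqP bv /eqP dv] := hv.
  rewrite -bv; have [|-> -> ->] := @graft_par i k u v w i0 ik; first by rewrite bu.
  by rewrite sg_sg dv; apply: sg_parity; parity.
- by move=> *; apply: (subr_add (@F_dB _ _)).
- move=> n a; apply: F_eq => [x y|x y|t ht]; rewrite /op_d /= ?F_dB ?subrr //.
  rewrite F_dE // [LHS](raddf_bdiff (F_lift (fun t => bdiff (bmono n a.+2) t))).
  rewrite -[RHS](bdiff_bdiff (bmono n a.+2) t); apply: bdiff_ext => t' b d.
  apply: F_lift_bmono; move: ht; rewrite /btyped b d => /andP[-> /eqP->] /=; exact: eqxx.
- move=> m a n b r c i h h1 h2 x y; rewrite sgE /op_comp /op_d /=; move: x.
  apply: F_eq => [x x'|x x'|u hu]; rewrite ?(F_compBl, F_dB, sgB) // ?opprD 1?addrACA //.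
  move: y; apply: F_eq => [y y'|y y'|v hv];
    rewrite ?(F_compBr, F_dB, sgB) // ?opprD 1?addrACA //.
  have /andP[/eqP bu /eqP du] := hu; have /andP[/eqP bv /eqP dv] := hv.
  rewrite F_compE // [LHS](sub_morph_sg (@F_dB r c)) !F_dE //; last exact: graft_typed h _ _.
  have /and3P[hi _ _] := h; rewrite -bu in hi; rewrite bdiff_graft //.
  congr (_ + _).
    rewrite [RHS](raddf_bdiff (F_lift (fun t => F_lift (fun s => F_comp_bmono r c.+1 i t s) (bmono n b v)))).
    apply: bdiff_ext => t' bt dt; rewrite /= F_lift_bmono ?F_lift_bmono //.
    by rewrite /btyped bt dt bu du !eqxx.
  transitivity (sg a (bdiff (fun s' => F_comp r c.+1 i (bmono m a u) (bmono n b.+1 s')) v)).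
    rewrite -!bdiff_sg; apply: bdiff_ext => s' bs ds; rewrite F_compE //; last first.
      by rewrite /btyped bs ds bv dv !eqxx.
    by rewrite sg_sg ds du.
  congr sg; pose G := GRing.isAdditive.Build _ _ (F_comp r c.+1 i (bmono m a u))
     (F_compBr r c.+1 i (bmono m a u) : additive (F_comp r c.+1 i (bmono m a u) : F_mod n b.+1 -> _)).
  pose H : {additive F_mod n b.+1 -> F_mod r c.+1} := HB.pack (F_comp r c.+1 i (bmono m a u)) G.
  by rewrite -[RHS]/(H _) raddf_bdiff.
Qed.

(** * The universal property of the free operad *)

Section CompAdditive.
Variables (Q : dgop) (hQ : dgop_axioms Q).
Variables (m a n b r c i : nat) (h : composable m a n b r c i).

Lemma compBl (x x' : Q m a) (y : Q n b) :
  op_comp Q h (x - x') y = op_comp Q h x y - op_comp Q h x' y.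
Proof. by apply: (add_morphB (f := fun x => op_comp Q h x y)) => *; exact: comp_addl. Qed.

Lemma compBr (x : Q m a) (y y' : Q n b) :
  op_comp Q h x (y - y') = op_comp Q h x y - op_comp Q h x y'.
Proof. by apply: (add_morphB (f := op_comp Q h x)) => *; exact: comp_addr. Qed.

Definition compl (y : Q n b) : {additive Q m a -> Q r c} :=
  pack_additive (fun x x' => compBl x x' y).

Definition compr (x : Q m a) : {additive Q n b -> Q r c} :=
  pack_additive (compBr x).

Lemma comp_sgl k (x : Q m a) (y : Q n b) : op_comp Q h (sg k x) y = sg k (op_comp Q h x y).
Proof. exact: (raddf_sg (compl y)). Qed.

Lemma comp_sgr k (x : Q m a) (y : Q n b) : op_comp Q h x (sg k y) = sg k (op_comp Q h x y).
Proof. exact: (raddf_sg (compr x)). Qed.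
End CompAdditive.

Section Ev.
Variables (Q : dgop) (v : forall g, Q 2%N (gdeg g)).

(** Composition with a decidable side condition, extended by 0: [ev] is defined
    by recursion on all trees without any typing hypothesis. *)
Definition comp0 m a n b r c i (x : Q m a) (y : Q n b) : Q r c :=
  match @idP (composable m a n b r c i) with
  | ReflectT h => op_comp Q h x y
  | ReflectF _ => 0
  end.

Lemma comp0E m a n b r c i (h : composable m a n b r c i) (x : Q m a) (y : Q n b) :
  comp0 r c i x y = op_comp Q h x y.
Proof.
rewrite /comp0; case: {-}_ / idP => [h'|//]; by rewrite (bool_irrelevance h' h).
Qed.

Definition one0 (n k : nat) : Q n k :=
  match n, k with 1%N, 0%N => op_one Q | _, _ => 0 end.

Fixpoint ev (t : btree) (n k : nat) : Q n k :=
  if t is bnode g l r then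
    comp0 n k 1
      (comp0 (bleaves r).+1 (gdeg g + bdeg r) 2 (v g) (ev r (bleaves r) (bdeg r)))
      (ev l (bleaves l) (bdeg l))
  else one0 n k.

Lemma node_comp2 g r :
  composable 2 (gdeg g) (bleaves r) (bdeg r) (bleaves r).+1 (gdeg g + bdeg r) 2.
Proof. by rewrite /composable /= !eqxx. Qed.

Lemma node_comp1 g l r n k : btyped n k (bnode g l r) ->
  composable (bleaves r).+1 (gdeg g + bdeg r) (bleaves l) (bdeg l) n k 1.
Proof.
case/andP=> /eqP<- /eqP<-; rewrite /composable /= addSn addnC !eqxx //.
Qed.

Lemma ev_node g l r n k (h2 : composable 2 (gdeg g) (bleaves r) (bdeg r) (bleaves r).+1 (gdeg g + bdeg r) 2)
   (h1 : composable (bleaves r).+1 (gdeg g + bdeg r) (bleaves l) (bdeg l) n k 1) :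
  ev (bnode g l r) n k =
    op_comp Q h1 (op_comp Q h2 (v g) (ev r (bleaves r) (bdeg r))) (ev l (bleaves l) (bdeg l)).
Proof. by rewrite /= (comp0E h1) (comp0E h2). Qed.

Hypothesis hQ : dgop_axioms Q.

Lemma typed_self t : btyped (bleaves t) (bdeg t) t.
Proof. by rewrite /btyped !eqxx. Qed.

(** Grafting into the left subtree is an instance of sequential associativity.
    Before grafting into the right one, the tree is exchanged with the left
    subtree by the parallel axiom, which produces the sign of [left_deg]. *)
Lemma ev_graft t i s m a n b r c (h : composable m a n b r c i) :
  btyped m a t -> btyped n b s ->
  op_comp Q h (ev t m a) (ev s n b) = sg (bdeg s * left_deg i t) (ev (graft i t s) r c).
Proof.
move=> ht hs; have /andP[/eqP bs /eqP ds] := hs; subst n b.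
elim: t i m a r c h ht => [|g l IHl x IHx] i m a r c h ht.
  have /andP[/eqP bt /eqP dt] := ht; simpl in bt, dt; subst m a.
  have /and3P[hi /eqP [er] /eqP ec] := h.
  have ei : i = 1%N by move: hi; lia.
  move: h er ec; rewrite ei add0n => h er ec; subst r c.
  rewrite [ev bleaf _ _]/= (comp_1l hQ) muln0 //.
have /andP[/eqP bt /eqP dt] := ht; simpl in bt, dt; subst m a.
have /and3P[hi /eqP er /eqP ec] := h.
have h2 := node_comp2 g x; have h1 := node_comp1 (typed_self (bnode g l x)).
have h1' : composable (bleaves x).+1 (gdeg g + bdeg x) (bleaves l) (bdeg l) (bleaves l + bleaves x) (gdeg g + bdeg x + bdeg l) 1 := h1.
rewrite (ev_node h2 h1').
case: (leqP i (bleaves l)) => il.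
  pose G := graft i l s.
  have hG : composable (bleaves l) (bdeg l) (bleaves s) (bdeg s) (bleaves G) (bdeg G) i.
    by rewrite /composable bleaves_graft bdeg_graft !eqxx il !andbT; case/andP: hi.
  have h4 : composable (bleaves x).+1 (gdeg g + bdeg x) (bleaves G) (bdeg G) r c 1.
    rewrite /composable /= bdeg_graft addSn er ec !addnA eqxx andbT.
    by apply/eqP; have := bleaves_graft i l s; rewrite -/G; lia.
  rewrite (comp_seq hQ h1' h hG h4) (IHl i _ _ _ _ hG) ?typed_self //.
  have -> : graft i (bnode g l x) s = bnode g G x by rewrite /= il.
  have -> : left_deg i (bnode g l x) = left_deg i l by rewrite /= il.
  by rewrite (comp_sgr hQ) (ev_node h2 h4).
pose j := (i - bleaves l)%N; have ei : i = (j.+1 + bleaves l).-1 by rewrite /j; lia.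
pose G := graft j x s.
have j0 : (0 < j <= bleaves x)%N by rewrite /j; move: hi; lia.
have hG : composable (bleaves x) (bdeg x) (bleaves s) (bdeg s) (bleaves G) (bdeg G) j.
  by rewrite /composable bleaves_graft bdeg_graft !eqxx j0.
have h3 : composable (bleaves x).+1 (gdeg g + bdeg x) (bleaves s) (bdeg s) (bleaves G).+1 (gdeg g + bdeg G) j.+1.
  rewrite /composable /= bdeg_graft addnA eqxx andbT; apply/andP; split; first by move: j0; lia.
  by apply/eqP; have := bleaves_graft j x s; rewrite -/G; lia.
have h2' : composable 2 (gdeg g) (bleaves G) (bdeg G) (bleaves G).+1 (gdeg g + bdeg G) 2.
  exact: node_comp2.
have h4 : composable (bleaves G).+1 (gdeg g + bdeg G) (bleaves l) (bdeg l) r c 1.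
  apply/and3P; split=> //; apply/eqP.
    by have := bleaves_graft j x s; rewrite -/G; lia.
  by rewrite ec /G bdeg_graft; lia.
have -> : graft i (bnode g l x) s = bnode g l G by rewrite /= leqNgt il.
have -> : left_deg i (bnode g l x) = (bdeg l + left_deg j x)%N by rewrite /= leqNgt il.
move: h; rewrite ei => h.
have j1 : (1 < j.+1)%N by case/andP: j0.
rewrite (comp_par hQ h1' h h3 h4 _ _ _ j1) sgE.
have -> : op_comp Q h3 (op_comp Q h2 (v g) (ev x (bleaves x) (bdeg x))) (ev s (bleaves s) (bdeg s)) =
   op_comp Q h2' (v g) (op_comp Q hG (ev x (bleaves x) (bdeg x)) (ev s (bleaves s) (bdeg s))).
  exact: (comp_seq hQ (i := 2) (j := j) h2 h3 hG h2').
rewrite (IHx j _ _ _ _ hG) ?typed_self // (comp_sgr hQ) (comp_sgl hQ) sg_sg.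
rewrite (ev_node h2' h4); apply: sg_parity; parity.
Qed.

Variable dv : forall g, Q 2%N (gdeg g).+1.
Hypothesis d_v : forall g, op_d Q (v g) = dv g.
Hypothesis dvE : forall g r l n k, btyped n k (bnode g l r) ->
  forall (h2 : composable 2 (gdeg g).+1 (bleaves r) (bdeg r) (bleaves r).+1 (gdeg g + bdeg r).+1 2)
   (h1 : composable (bleaves r).+1 (gdeg g + bdeg r).+1 (bleaves l) (bdeg l) n k.+1 1),
  op_comp Q h1 (op_comp Q h2 (dv g) (ev r (bleaves r) (bdeg r))) (ev l (bleaves l) (bdeg l)) =
  gdiff g (ev (bnode Gbar l r) n k.+1).

Lemma d_one : op_d Q (op_one Q) = 0.
Proof.
have h : composable 1 0 1 0 1 0 1 by [].
have h1 : composable 1 1 1 0 1 1 1 by [].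
have h2 : composable 1 0 1 1 1 1 1 by [].
have := d_comp hQ h h1 h2 (op_one Q) (op_one Q).
rewrite (comp_1l hQ) (comp_1l hQ) (comp_1r hQ) => /eqP.
by rewrite -subr_eq0 opprD addrA subrr sub0r oppr_eq0 mulr1z => /eqP.
Qed.

Lemma ev_bdiff t n k : btyped n k t ->
  op_d Q (ev t n k) = bdiff (fun t' => ev t' n k.+1) t.
Proof.
elim: t n k => [|g l IHl r IHr] n k ht.
  have /andP[/eqP bt /eqP dt] := ht; simpl in bt, dt; subst n k.
  exact: d_one.
have h2 := node_comp2 g r; have h1 := node_comp1 ht.
have /andP[/eqP bt /eqP dt] := ht; simpl in bt, dt.
have h2d : composable 2 (gdeg g).+1 (bleaves r) (bdeg r) (bleaves r).+1 (gdeg g + bdeg r).+1 2.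
  by rewrite /composable /= addSn !eqxx.
have h2r : composable 2 (gdeg g) (bleaves r) (bdeg r).+1 (bleaves r).+1 (gdeg g + bdeg r).+1 2.
  by rewrite /composable /= addnS !eqxx.
have h1d : composable (bleaves r).+1 (gdeg g + bdeg r).+1 (bleaves l) (bdeg l) n k.+1 1.
  by move: h1; rewrite /composable addSn eqSS.
have h1l : composable (bleaves r).+1 (gdeg g + bdeg r) (bleaves l) (bdeg l).+1 n k.+1 1.
  by move: h1; rewrite /composable addnS eqSS.
rewrite (ev_node h2 h1) (d_comp hQ h1 h1d h1l) (d_comp hQ h2 h2d h2r) !sgE.
rewrite d_v (comp_addl hQ) dvE // -addrA [RHS]/=; congr (_ + (_ + sg _ _)).
  rewrite (comp_sgl hQ) IHr ?typed_self //; congr sg.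
  rewrite -[LHS]/(compl hQ h1d (ev l (bleaves l) (bdeg l)) (compr hQ h2r (v g) _)).
  rewrite !raddf_bdiff; apply: bdiff_ext => r' br dr.
  have h2' := node_comp2 g r'.
  have hr : btyped n k.+1 (bnode g l r').
    by rewrite /btyped /= br dr addnS addSn bt dt !eqxx.
  move: (node_comp1 hr) h2'; rewrite /= br dr addnS => h1' h2'.
  rewrite (comp0E h1') (comp0E h2') /=.
  by rewrite (bool_irrelevance h1' h1d) (bool_irrelevance h2' h2r).
rewrite IHl ?typed_self // -[LHS]/(compr hQ h1l _ _) raddf_bdiff.
apply: bdiff_ext => l' b' d' /=; rewrite b' d'.
by rewrite (comp0E h1l) (comp0E h2).
Qed.
End Ev.

Definition corolla (g : gen) : btree := bnode g bleaf bleaf.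
Definition Fgen (g : gen) : F 2%N (gdeg g) := bmono 2 (gdeg g) (corolla g).

Notation rlt := (Fgen Glt : F 2%N 0%N).
Notation rgt := (Fgen Ggt : F 2%N 0%N).
Notation rbar := (Fgen Gbar : F 2%N 1%N).

Notation Frel := (K_relations rlt rgt rbar).

Lemma corolla_typed g : btyped 2 (gdeg g) (corolla g).
Proof. by rewrite /btyped /= !addn0 !eqxx. Qed.

Lemma F_node g l r n k (h2 : composable 2 (gdeg g) (bleaves r) (bdeg r) (bleaves r).+1 (gdeg g + bdeg r) 2)
   (h1 : composable (bleaves r).+1 (gdeg g + bdeg r) (bleaves l) (bdeg l) n k 1) :
  op_comp F h1 (op_comp F h2 (Fgen g) (bmono (bleaves r) (bdeg r) r)) (bmono (bleaves l) (bdeg l) l) =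
  bmono n k (bnode g l r).
Proof.
rewrite /op_comp /= (F_comp_compl _ _ _ h2) ?corolla_typed ?typed_self //=.
by rewrite /= !muln0.
Qed.

Section Universal.
Variables (Q : dgop) (v : forall g, Q 2%N (gdeg g)).
Hypothesis hQ : dgop_axioms Q.
Hypothesis d_lt : op_d Q (v Glt) = v Gbar.
Hypothesis d_gt : op_d Q (v Ggt) = - v Gbar.
Hypothesis d_bar : op_d Q (v Gbar) = 0.

(** The free module lifts maps into modules over [int], hence the passage
    through the canonical module structure of an abelian group. *)
Definition ev_lin (n k : nat) (x : F n k) : Q n k :=
  (@F_lift n k (zmodule (Q n k)) (fun t => ev v t n k) x : zmodule (Q n k)).

Lemma ev_linB n k (x y : F n k) : ev_lin (x - y) = ev_lin x - ev_lin y.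
Proof. exact: (@F_liftB n k (zmodule (Q n k))). Qed.

Definition free_map : op_family F Q := fun n k => pack_additive (@ev_linB n k).

Lemma free_map_bmono n k t : btyped n k t -> free_map n k (bmono n k t) = ev v t n k.
Proof. exact: (@F_lift_bmono n k (zmodule (Q n k))). Qed.

Lemma free_map_morphism : op_morphism free_map.
Proof.
split.
- exact: (@free_map_bmono 1 0 bleaf isT).
- move=> m a n b r c i h x y.
  move: x; apply: F_eq => [x x'|x x'|t ht].
  + by rewrite /op_comp /= F_compBl ev_linB.
  + by rewrite raddfB (compBl hQ).
  move: y; apply: F_eq => [y y'|y y'|s hs].
  + by rewrite /op_comp /= F_compBr ev_linB.
  + by rewrite raddfB (compBr hQ).
  rewrite !free_map_bmono // (ev_graft v hQ h ht hs) /op_comp /= F_compE // /F_comp_bmono.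
  rewrite -[LHS]/(free_map r c _) raddf_sg free_map_bmono //; exact: graft_typed h ht hs.
- move=> n k x; move: x; apply: F_eq => [x x'|x x'|t ht].
  + by rewrite /op_d /= F_dB ev_linB.
  + by rewrite raddfB (add_morphB (d_add hQ (n := n) (a := k))).
  rewrite free_map_bmono // /op_d /= F_dE // -[LHS]/(free_map n k.+1 _) raddf_bdiff.
  pose dv g : Q 2%N (gdeg g).+1 :=
    match g with Glt => v Gbar | Ggt => - v Gbar | Gbar => 0 end.
  rewrite -[RHS]/(op_d Q _) (@ev_bdiff Q v hQ dv) //.
  + apply: bdiff_ext => t' b d; apply: free_map_bmono; move: ht; rewrite /btyped b d => /andP[-> /eqP->].
    by rewrite /= eqxx.
  + by case.
  + move=> g r l n' k' ht' h2 h1; case: g ht' h2 h1 => ht' h2 h1 /=.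
    * by rewrite -[RHS]/(ev v (bnode Gbar l r) n' k'.+1) (@ev_node Q v Gbar l r n' k'.+1 h2 h1).
    * rewrite -[RHS]/(- ev v (bnode Gbar l r) n' k'.+1) (@ev_node Q v Gbar l r n' k'.+1 h2 h1).
      by rewrite -[- v Gbar]/(sg 1 _) (comp_sgl hQ) (comp_sgl hQ).
    * rewrite (sub_morph0 (fun x y => compBl hQ h2 x y _)).
      by rewrite (sub_morph0 (fun x y => compBl hQ h1 x y _)).
Qed.

Lemma free_map_gen g : free_map 2%N (gdeg g) (Fgen g) = v g.
Proof.
rewrite free_map_bmono ?corolla_typed //.
have h2 := node_comp2 g bleaf.
have h1 : composable 2 (gdeg g + 0) 1 0 2 (gdeg g) 1.
  by rewrite /composable /= !addn0 eqxx.
rewrite (@ev_node Q v g bleaf bleaf 2 (gdeg g) h2 h1) /=.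
case: g h2 h1 => h2 h1 /=; by rewrite (comp_1r hQ) (comp_1r hQ).
Qed.

(** A tree is an iterated composite of generators. *)
Lemma free_map_unique (f : op_family F Q) : op_morphism f ->
  (forall g, f 2%N (gdeg g) (Fgen g) = v g) ->
  forall n k (x : F n k), f n k x = free_map n k x.
Proof.
move=> fm fg n k; apply: F_eq => [x y|x y|t ht]; rewrite ?raddfB //.
rewrite free_map_bmono //; elim: t n k ht => [|g l IHl r IHr] n k ht.
  have /andP[/eqP bt /eqP dt] := ht; simpl in bt, dt; subst n k.
  exact: (morph_one fm).
have h2 := node_comp2 g r; have h1 := node_comp1 ht.
rewrite -(F_node h2 h1) (morph_comp fm) (morph_comp fm) fg.
by rewrite IHl ?IHr ?typed_self // (ev_node v h2 h1).
Qed.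
End Universal.

(** * Rewriting binary trees modulo the relations *)

Lemma bmono_out n k t : ~~ btyped n k t -> bmono n k t = 0.
Proof. by move=> h; rewrite /bmono insubN. Qed.

Section Spanning.
Variable J : forall n k, zmodClosed (F n k).
Hypothesis hJ : op_ideal J.
Hypothesis relJ : forall n k (x : F n k),
  Frel x -> x \in J n k.

(** Membership in the subgroup generated by [J] and a set of trees: what is
    left of an equality modulo [J] when coefficients and signs are dropped. *)
Inductive spans (P : btree -> Prop) n k : F n k -> Prop :=
| spans_J x : x \in J n k -> spans P x
| spans_gen t : P t -> spans P (bmono n k t : F n k)
| spans_sub x y : spans P x -> spans P y -> spans P (x - y).

Lemma spans0 P n k : spans P (0 : F n k).
Proof. by apply: spans_J; exact: rpred0. Qed.

Lemma spansN P n k (x : F n k) : spans P x -> spans P (- x).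
Proof. by move=> h; rewrite -sub0r; apply: spans_sub => //; exact: spans0. Qed.

Lemma spansD P n k (x y : F n k) : spans P x -> spans P y -> spans P (x + y).
Proof. by move=> hx hy; rewrite -[y]opprK; apply: spans_sub => //; exact: spansN. Qed.

Lemma spans_sg P n k m (x : F n k) : spans P x -> spans P (sg m x).
Proof. by rewrite /sg; case: odd => //; exact: spansN. Qed.

Lemma spans_mod P n k (x y : F n k) : x - y \in J n k -> spans P y -> spans P x.
Proof. by move=> h hy; rewrite -(subrK y x); apply: spansD => //; exact: spans_J. Qed.

Lemma spans_map P P' n k n' k' (h : {additive F n k -> F n' k'}) (x : F n k) :
  (forall y, y \in J n k -> h y \in J n' k') ->
  (forall t, P t -> btyped n k t -> spans P' (h (bmono n k t))) ->
  spans P x -> spans P' (h x).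
Proof.
move=> hj hp; elim=> [y /hj|t Pt|y z _ hy _ hz]; first exact: spans_J.
  case: (boolP (btyped n k t)) => [|/bmono_out->]; first exact: hp.
  by rewrite raddf0; exact: spans0.
by rewrite raddfB; exact: spans_sub.
Qed.

Lemma spans_mono (P P' : btree -> Prop) n k (x : F n k) :
  (forall t, P t -> P' t) -> spans P x -> spans P' x.
Proof.
by move=> h; elim=> [y yJ|t /h Pt|y z _ hy _ hz]; [exact: spans_J | exact: spans_gen | exact: spans_sub].
Qed.

(** In the wrong arity or degree [bmono] is 0, so this is then automatic. *)
Definition reduces P n k t := spans P (bmono n k t : F n k).

(** Rewriting a subtree is allowed because [J] is an ideal. *)
Lemma reduces_ctxl P P' n k g l r : reduces P (bleaves l) (bdeg l) l ->
  (forall l', P l' -> bleaves l' = bleaves l -> bdeg l' = bdeg l -> reduces P' n k (bnode g l' r)) ->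
  reduces P' n k (bnode g l r).
Proof.
move=> hl h; case: (boolP (btyped n k (bnode g l r))) => [ht|/bmono_out e]; last first.
  by rewrite /reduces e; exact: spans0.
have h2 := node_comp2 g r; have h1 := node_comp1 ht.
rewrite /reduces -(F_node h2 h1).
apply: (spans_map (h := compr F_axioms h1 (op_comp F h2 (Fgen g) (bmono (bleaves r) (bdeg r) r))) _ _ hl).
  by move=> y yJ; apply: hJ; right.
move=> l' Pl' /andP[/eqP b' /eqP d'].
rewrite -[X in spans _ X]/(op_comp F h1 (op_comp F h2 (Fgen g) (bmono (bleaves r) (bdeg r) r)) (bmono (bleaves l) (bdeg l) l')).
move: h1; rewrite -b' -d' => h1; rewrite (F_node h2 h1); exact: h.
Qed.

Lemma reduces_ctxr P P' n k g l r : reduces P (bleaves r) (bdeg r) r ->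
  (forall r', P r' -> bleaves r' = bleaves r -> bdeg r' = bdeg r -> reduces P' n k (bnode g l r')) ->
  reduces P' n k (bnode g l r).
Proof.
move=> hr h; case: (boolP (btyped n k (bnode g l r))) => [ht|/bmono_out e]; last first.
  by rewrite /reduces e; exact: spans0.
have h2 := node_comp2 g r; have h1 := node_comp1 ht.
rewrite /reduces -(F_node h2 h1).
rewrite -[X in spans _ X]/(compl F_axioms h1 (bmono (bleaves l) (bdeg l) l) _).
apply: (spans_map (P := fun t => exists2 r', P r' & [/\ bleaves r' = bleaves r, bdeg r' = bdeg r & t = bnode g bleaf r'])).
- by move=> y yJ; apply: hJ; left.
- move=> _ [r' Pr' [b' d' ->]] _.
  rewrite -[X in spans _ X]/(op_comp F h1 (bmono (bleaves r).+1 (gdeg g + bdeg r) (bnode g bleaf r')) (bmono (bleaves l) (bdeg l) l)).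
  move: h2 h1; rewrite -b' -d' => h2 h1.
  have h1' : composable (bleaves r').+1 (gdeg g + bdeg r') (bleaves bleaf) (bdeg bleaf) (bleaves r').+1 (gdeg g + bdeg r') 1.
    by rewrite /composable /= addn1 addn0 !eqxx.
  rewrite -(F_node h2 h1') (comp_1r F_axioms) (F_node h2 h1); exact: h.
rewrite -[X in spans _ X]/(compr F_axioms h2 (Fgen g) _).
apply: (spans_map _ _ hr); first by move=> y yJ; apply: hJ; right.
move=> r' Pr' /andP[/eqP b' /eqP d'].
rewrite -[X in spans _ X]/(op_comp F h2 (Fgen g) (bmono (bleaves r) (bdeg r) r')).
move: h2; rewrite -b' -d' => h2.
have h1' : composable (bleaves r').+1 (gdeg g + bdeg r') (bleaves bleaf) (bdeg bleaf) (bleaves r').+1 (gdeg g + bdeg r') 1.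
  by rewrite /composable /= addn1 addn0 !eqxx.
have := F_node h2 h1'; rewrite (comp_1r F_axioms) => ->.
by apply: spans_gen; exists r'; rewrite ?b' ?d'.
Qed.

(** The two shapes of a product of three trees: each relation exchanges shapes
    of the first kind for shapes of the second. *)
Definition nestr g h L M R := bnode g L (bnode h M R).
Definition nestl g h L M R := bnode g (bnode h L M) R.

Lemma comp2_2 g h : comp2 (i := 2) isT (Fgen g) (Fgen h) =
  bmono 3 (gdeg g + gdeg h) (bnode g bleaf (corolla h)) :> F 3 _.
Proof.
rewrite /comp2 /op_comp /= F_compE ?corolla_typed //.
by rewrite /F_comp_bmono /= muln0.
Qed.

Lemma comp2_1 g h : comp2 (i := 1) isT (Fgen g) (Fgen h) =
  bmono 3 (gdeg g + gdeg h) (bnode g (corolla h) bleaf) :> F 3 _.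
Proof.
rewrite /comp2 /op_comp /= F_compE ?corolla_typed //.
by rewrite /F_comp_bmono /= muln0.
Qed.
(** Substituting three trees in an element of arity 3, from right to left so
    that the inputs still to be filled keep their numbers. *)
Definition fill d n k L M R (x : F 3 d) : F n k :=
  F_comp n k 1 (F_comp (bleaves R + bleaves M).+1 (d + bdeg R + bdeg M) 2
     (F_comp (bleaves R).+2 (d + bdeg R) 3 x (bmono (bleaves R) (bdeg R) R)) (bmono (bleaves M) (bdeg M) M))
     (bmono (bleaves L) (bdeg L) L).

Lemma fillB d n k L M R (x y : F 3 d) :
  fill n k L M R (x - y) = fill n k L M R x - fill n k L M R y.
Proof. by rewrite /fill !F_compBl. Qed.

Lemma fill_J d n k L M R (x : F 3 d) :
  (bleaves L + (bleaves M + bleaves R))%N = n -> (d + bdeg R + bdeg M + bdeg L)%N = k ->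
  x \in J 3 d -> fill n k L M R x \in J n k.
Proof.
move=> en ek xJ.
have h1 : composable 3 d (bleaves R) (bdeg R) (bleaves R).+2 (d + bdeg R) 3.
  by rewrite /composable /= !eqxx.
have h2 : composable (bleaves R).+2 (d + bdeg R) (bleaves M) (bdeg M) (bleaves R + bleaves M).+1 (d + bdeg R + bdeg M) 2.
  by rewrite /composable /= !eqxx.
have h3 : composable (bleaves R + bleaves M).+1 (d + bdeg R + bdeg M) (bleaves L) (bdeg L) n k 1.
  by rewrite /composable /= -en -ek eqxx andbT; apply/eqP; lia.
by apply: (hJ h3); left; apply: (hJ h2); left; apply: (hJ h1); left.
Qed.

Lemma fill_nestr g h L M R n k :
  (bleaves L + (bleaves M + bleaves R))%N = n -> (gdeg g + gdeg h + bdeg R + bdeg M + bdeg L)%N = k ->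
  fill n k L M R (bmono 3 (gdeg g + gdeg h) (bnode g bleaf (corolla h))) =
  bmono n k (nestr g h L M R).
Proof.
move=> en ek; rewrite /fill F_compE ?typed_self //; last first.
  by rewrite /btyped /= !addn0 !eqxx.
rewrite /F_comp_bmono /= muln0 sg0 F_compE ?typed_self //; last first.
  by rewrite /btyped /= !addn0 !addnA !eqxx.
rewrite /F_comp_bmono /= muln0 sg0 F_compE ?typed_self //; last first.
  by rewrite /btyped /= !addn0; apply/andP; split; apply/eqP; lia.
by rewrite /F_comp_bmono /= muln0 sg0.
Qed.

Lemma fill_nestl g h L M R n k :
  (bleaves L + (bleaves M + bleaves R))%N = n -> (gdeg g + gdeg h + bdeg R + bdeg M + bdeg L)%N = k ->
  fill n k L M R (bmono 3 (gdeg g + gdeg h) (bnode g (corolla h) bleaf)) =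
  sg (bdeg R * gdeg h) (bmono n k (nestl g h L M R)).
Proof.
move=> en ek; rewrite /fill F_compE ?typed_self //; last first.
  by rewrite /btyped /= !addn0 !eqxx.
rewrite /F_comp_bmono /= !addn0 !F_comp_sgl F_compE ?typed_self //; last first.
  by rewrite /btyped /= !addn0; apply/andP; split; apply/eqP; lia.
rewrite /F_comp_bmono /= muln0 sg0 F_compE ?typed_self //; last first.
  by rewrite /btyped /= !addn0; apply/andP; split; apply/eqP; lia.
by rewrite /F_comp_bmono /= muln0 sg0.
Qed.

Lemma typed_c n k g h L M R : btyped n k (nestr g h L M R) ->
  (bleaves L + (bleaves M + bleaves R))%N = n /\ (gdeg g + gdeg h + bdeg R + bdeg M + bdeg L)%N = k.
Proof.
by rewrite /btyped /nestr /= => /andP[/eqP <- /eqP <-]; split=> //; lia.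
Qed.

Lemma typed_cLR n k g h g' h' L M R : (gdeg g + gdeg h = gdeg g' + gdeg h')%N ->
  btyped n k (nestl g h L M R) = btyped n k (nestr g' h' L M R).
Proof. by rewrite /btyped /nestl /nestr /= => e; congr andb; apply/eqP/eqP; lia. Qed.
(** Substitution turns the two sides of the relation into the two nestings of
    [L], [M] and [R], up to signs that [spans] ignores. *)
Lemma two_term P n k g h g' h' L M R m :
  (gdeg g + gdeg h)%N = (gdeg g' + gdeg h')%N ->
  bmono 3 (gdeg g + gdeg h) (bnode g bleaf (corolla h))
    - sg m (bmono 3 (gdeg g + gdeg h) (bnode g' (corolla h') bleaf)) \in J 3 (gdeg g + gdeg h) ->
  reduces P n k (nestr g h L M R) <-> reduces P n k (nestl g' h' L M R).
Proof.
move=> e rJ; case: (boolP (btyped n k (nestr g h L M R))) => [ht|ht]; last first.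
  by rewrite /reduces !bmono_out // (typed_cLR _ _ _ _ _ (esym e)).
have [en ek] := typed_c ht.
have := fill_J en ek rJ; rewrite fillB fill_nestr //.
have -> : fill n k L M R (sg m (bmono 3 (gdeg g + gdeg h) (bnode g' (corolla h') bleaf))) =
  sg (m + bdeg R * gdeg h') (bmono n k (nestl g' h' L M R)).
  rewrite [LHS](sub_morph_sg (@fillB _ n k L M R)) -sg_sg; congr sg.
  move: ek; rewrite e => ek; exact: fill_nestl.
move=> hj; split=> hh.
  rewrite /reduces (sg_inj (erefl (sg (m + bdeg R * gdeg h') (bmono n k (nestl g' h' L M R))))).
  apply: spans_sg; apply: spans_mod hh; rewrite -opprB rpredN; exact: hj.
by apply: (spans_mod hj); apply: spans_sg.
Qed.
(** The two relations with three terms are used in one direction only: a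
    product nested on one side is replaced by a sum of two products nested on
    the other side. *)
Lemma three_term_R P n k L M R :
  reduces P n k (nestl Ggt Ggt L M R) -> reduces P n k (nestl Ggt Glt L M R) ->
  reduces P n k (nestr Ggt Ggt L M R).
Proof.
move=> h1 h2; case: (boolP (btyped n k (nestr Ggt Ggt L M R))) => [ht|/bmono_out e]; last first.
  by rewrite /reduces e; exact: spans0.
have [en ek] := typed_c ht.
have := relJ (K_rel2 rlt rgt rbar).
rewrite (comp2_2 Ggt Ggt) (comp2_1 Ggt Ggt) (comp2_1 Ggt Glt) => /(fill_J en ek).
rewrite fillB -[X in _ - fill _ _ _ _ _ (_ + X)]opprK fillB (sub_morphN (@fillB _ n k L M R)) opprK.
rewrite (@fill_nestr Ggt Ggt) // (@fill_nestl Ggt Ggt) // (@fill_nestl Ggt Glt) // muln0 !sg0 => hj.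
by apply: (spans_mod hj); exact: spansD.
Qed.

Lemma three_term_L P n k L M R :
  reduces P n k (nestr Glt Glt L M R) -> reduces P n k (nestr Glt Ggt L M R) ->
  reduces P n k (nestl Glt Glt L M R).
Proof.
move=> h1 h2; case: (boolP (btyped n k (nestr Glt Glt L M R))) => [ht|ht]; last first.
  by rewrite /reduces bmono_out ?(typed_cLR n k L M R (erefl (gdeg Glt + gdeg Glt)%N)) //; exact: spans0.
have [en ek] := typed_c ht.
have := relJ (K_rel3 rlt rgt rbar).
rewrite (comp2_1 Glt Glt) (comp2_2 Glt Glt) (comp2_2 Glt Ggt) => /(fill_J en ek).
rewrite fillB -[X in _ - fill _ _ _ _ _ (_ + X)]opprK fillB (sub_morphN (@fillB _ n k L M R)) opprK.
rewrite (@fill_nestl Glt Glt) // (@fill_nestr Glt Glt) // (@fill_nestr Glt Ggt) // muln0 !sg0 => hj.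
by apply: (spans_mod hj); exact: spansD.
Qed.

(** In infix notation the rules below are
    [L > (M < R) = (L > M) < R], [L > (M | R) = (L > M) | R],
    [L | (M < R) = (L | M) < R], [L | (M > R) = (L < M) | R] and
    [L | (M | R) = (L | M) | R], up to sign. *)
Lemma rule1 P n k L M R :
  reduces P n k (nestr Ggt Glt L M R) <-> reduces P n k (nestl Glt Ggt L M R).
Proof.
apply: (@two_term _ _ _ _ _ _ _ _ _ _ 0) => //.
have := relJ (K_rel1 rlt rgt rbar); by rewrite (comp2_2 Ggt Glt) (comp2_1 Glt Ggt).
Qed.

Lemma rule4 P n k L M R :
  reduces P n k (nestr Ggt Gbar L M R) <-> reduces P n k (nestl Gbar Ggt L M R).
Proof.
apply: (@two_term _ _ _ _ _ _ _ _ _ _ 0) => //.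
have := relJ (K_rel4 rlt rgt rbar); by rewrite (comp2_2 Ggt Gbar) (comp2_1 Gbar Ggt).
Qed.

Lemma rule5 P n k L M R :
  reduces P n k (nestr Gbar Glt L M R) <-> reduces P n k (nestl Glt Gbar L M R).
Proof.
apply: (@two_term _ _ _ _ _ _ _ _ _ _ 0) => //.
have := relJ (K_rel5 rlt rgt rbar); rewrite (comp2_1 Glt Gbar) (comp2_2 Gbar Glt).
by rewrite -rpredN opprB.
Qed.

Lemma rule6 P n k L M R :
  reduces P n k (nestr Gbar Ggt L M R) <-> reduces P n k (nestl Gbar Glt L M R).
Proof.
apply: (@two_term _ _ _ _ _ _ _ _ _ _ 0) => //.
have := relJ (K_rel6 rlt rgt rbar); rewrite (comp2_1 Gbar Glt) (comp2_2 Gbar Ggt).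
by rewrite -rpredN opprB.
Qed.

Lemma rule7 P n k L M R :
  reduces P n k (nestr Gbar Gbar L M R) <-> reduces P n k (nestl Gbar Gbar L M R).
Proof.
apply: (@two_term _ _ _ _ _ _ _ _ _ _ 1) => //.
have := relJ (K_rel7 rlt rgt rbar); rewrite (comp2_1 Gbar Gbar) (comp2_2 Gbar Gbar).
by rewrite !opprK addrC.
Qed.

(** The binary tree [nf T] described above. The inner loop is [nf_comb], and
    the factors of the products are given by [nf_prec]; [nf_Node] restates the
    recursion in these terms. *)
Fixpoint nf (t : ptree) : btree :=
  if t is Node (t0 :: us) then
    let c := (fix go us :=
      match us with
      | [::] => bleaf
      | [:: u] => if u is Leaf then bleaf else bnode Glt bleaf (nf u)
      | u :: us' => bnode Gbar (if u is Leaf then bleaf else bnode Glt bleaf (nf u)) (go us')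
      end) us in
    if t0 is Leaf then c else bnode Ggt (nf t0) c
  else bleaf.

Definition nf_prec (u : ptree) : btree :=
  if u is Leaf then bleaf else bnode Glt bleaf (nf u).

Fixpoint nf_comb (us : seq ptree) : btree :=
  match us with
  | [::] => bleaf
  | [:: u] => nf_prec u
  | u :: us' => bnode Gbar (nf_prec u) (nf_comb us')
  end.

Definition nf_succ (t : ptree) (c : btree) : btree :=
  if t is Leaf then c else bnode Ggt (nf t) c.

Lemma nf_Node t0 us : nf (Node (t0 :: us)) = nf_succ t0 (nf_comb us).
Proof.
rewrite /nf_succ; case: t0 => [|ts0] /=.
  by elim: us => // u us /= IH; case: us IH => // v us ->.
by congr (bnode _ _ _); elim: us => // u us /= IH; case: us IH => // v us ->.
Qed.

Lemma nf_comb_cons u v us : nf_comb (u :: v :: us) = bnode Gbar (nf_prec u) (nf_comb (v :: us)).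
Proof. by []. Qed.

Definition nonleaf (t : ptree) : bool := if t is Leaf then false else true.

Definition is_nf (x : btree) := exists t, [/\ nonleaf t, branching t & x = nf t].
Definition is_nf_comb (x : btree) := exists us, [/\ us != [::], all branching us & x = nf_comb us].
Definition is_nf_prec (x : btree) := exists u, branching u /\ x = nf_prec u.

Lemma nf_precE u : nonleaf u -> nf_prec u = bnode Glt bleaf (nf u).
Proof. by case: u. Qed.

Lemma nf_succE u c : nonleaf u -> nf_succ u c = bnode Ggt (nf u) c.
Proof. by case: u. Qed.

Lemma branching_split s : nonleaf s -> branching s ->
  exists s0 ss, [/\ s = Node (s0 :: ss), branching s0, ss != [::] & all branching ss].
Proof. by case: s => // -[//|s0 [//|s1 ss]] _ /= /andP[b0 bs]; exists s0, (s1 :: ss). Qed.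

(** The induction on the number of leaves is over this predicate, because the
    lemmas on the single factors of a normal form use it as well. *)
Definition mul_reduces N := forall g t s n k, nonleaf t -> branching t ->
  nonleaf s -> branching s -> (bleaves (nf t) + bleaves (nf s) < N)%N ->
  reduces is_nf n k (bnode g (nf t) (nf s)).

Section Step.
Variable N : nat.
Hypothesis IHN : mul_reduces N.

(** [(1 < u) < s] equals [1 < (u < s)] plus [1 < (u > s)], and the products of
    [u] and [s] involve one leaf less. *)
Lemma prec_nf_prec u s n k : branching u -> nonleaf s -> branching s ->
  (bleaves (nf_prec u) + bleaves (nf s) <= N)%N ->
  reduces is_nf_prec n k (bnode Glt (nf_prec u) (nf s)).
Proof.
move=> bu ns bs hN; case: (boolP (nonleaf u)) => [nu|]; last first.
  by case: (u) => // _; apply: spans_gen; exists s; rewrite (nf_precE ns).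
rewrite nf_precE //; rewrite nf_precE //= in hN.
apply: three_term_L; apply: (@reduces_ctxr is_nf).
- by apply: IHN => //; lia.
- by move=> _ [w [nw bw ->]] _ _; apply: spans_gen; exists w; rewrite (nf_precE nw).
- by apply: IHN => //; lia.
- by move=> _ [w [nw bw ->]] _ _; apply: spans_gen; exists w; rewrite (nf_precE nw).
Qed.

(** [(c | C) < s] is [c | (C < s)]. *)
Lemma prec_nf_comb us s n k : us != [::] -> all branching us -> nonleaf s -> branching s ->
  (bleaves (nf_comb us) + bleaves (nf s) <= N)%N ->
  reduces is_nf_comb n k (bnode Glt (nf_comb us) (nf s)).
Proof.
move=> + + ns bs; elim: us n k => // u us IH n k _ /andP[bu bus].
case: us IH bus => [|v us] IH bus hN.
  apply: (@spans_mono is_nf_prec); last exact: prec_nf_prec.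
  by move=> _ [w [bw ->]]; exists [:: w]; rewrite /= bw.
rewrite nf_comb_cons; apply/rule5; apply: (@reduces_ctxr is_nf_comb).
  by apply: IH => //; move: hN; rewrite nf_comb_cons /=; lia.
move=> _ [ws [w0 bws ->]] _ _; apply: spans_gen; exists (u :: ws); split=> //=.
- by rewrite bu.
- by case: (ws) w0.
Qed.

(** [(c | C) | s] is [c | (C | s)] up to sign. When a single factor [c] is left
    and [s = s_0 > C'], the product [c | (s_0 > C')] is [(c < s_0) | C']. *)
Lemma bar_nf_comb us s n k : us != [::] -> all branching us -> nonleaf s -> branching s ->
  (bleaves (nf_comb us) + bleaves (nf s) <= N)%N ->
  reduces is_nf_comb n k (bnode Gbar (nf_comb us) (nf s)).
Proof.
move=> + + ns bs; elim: us n k => // u us IH n k _ /andP[bu bus].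
have [s0 [ss [es bs0 ss0 bss]]] := branching_split ns bs.
case: us IH bus => [|v us] IH bus hN.
  rewrite es nf_Node; case: (boolP (nonleaf s0)) => [ns0|]; last first.
    case: (s0) => // _; apply: spans_gen; exists (u :: ss).
    by split=> //=; [rewrite bu | case: (ss) ss0].
  rewrite nf_succE //; apply/rule6; apply: (@reduces_ctxl is_nf_prec).
    apply: prec_nf_prec => //; move: hN; rewrite es nf_Node nf_succE //=.
    by have := bleaves_gt0 (nf_comb ss); lia.
  move=> _ [w [bw ->]] _ _; apply: spans_gen; exists (w :: ss).
  by split=> //=; [rewrite bw | case: (ss) ss0].
rewrite nf_comb_cons; apply/rule7; apply: (@reduces_ctxr is_nf_comb).
  by apply: IH => //; move: hN; rewrite nf_comb_cons /=; lia.
move=> _ [ws [w0 bws ->]] _ _; apply: spans_gen; exists (u :: ws); split=> //=.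
- by rewrite bu.
- by case: (ws) w0.
Qed.

(** With [t = t_0 > C] and [s = s_0 > C'], the products [t < s] and [t | s] are
    [t_0 > (C < s)] and [t_0 > (C | s)], while [t > s] is the sum of
    [(t > s_0) > C'] and [(t < s_0) > C'], whose inner products are smaller. *)
Lemma mul_step : mul_reduces N.+1.
Proof.
move=> g t s n k nt bt ns bs; rewrite ltnS => hN.
have [t0 [us [et bt0 us0 bus]]] := branching_split nt bt.
have [s0 [ss [es bs0 ss0 bss]]] := branching_split ns bs.
have isE w vs : branching w -> all branching vs -> vs != [::] -> is_nf (nf_succ w (nf_comb vs)).
  move=> bw bvs vs0; exists (Node (w :: vs)); rewrite nf_Node; split=> //=.
  by rewrite bw bvs; case: (vs) vs0.
case: g.
- rewrite et nf_Node; case: (boolP (nonleaf t0)) => [nt0|nt0].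
    rewrite nf_succE //; apply/rule1; apply: (@reduces_ctxr is_nf_comb).
      by apply: prec_nf_comb => //; move: hN; rewrite et nf_Node nf_succE //=; lia.
    by move=> _ [ws [w0 bws ->]] _ _; apply: spans_gen; rewrite -nf_succE //; exact: isE.
  have el c : nf_succ t0 c = c by case: (t0) nt0.
  rewrite el; have hN' : (bleaves (nf_comb us) + bleaves (nf s) <= N)%N by move: hN; rewrite et nf_Node el.
  apply: (@spans_mono is_nf_comb); last exact: prec_nf_comb.
  by move=> _ [ws [w0 bws ->]]; rewrite -[nf_comb ws]/(nf_succ Leaf (nf_comb ws)); exact: isE.
- rewrite es nf_Node; case: (boolP (nonleaf s0)) => [ns0|]; last first.
    by case: (s0) => // _; apply: spans_gen; rewrite -nf_succE //; exact: isE.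
  have hN' : (bleaves (nf t) + bleaves (nf s0) < N)%N.
    by move: hN; rewrite es nf_Node nf_succE //=; have := bleaves_gt0 (nf_comb ss); lia.
  rewrite nf_succE //; apply: three_term_R; apply: (@reduces_ctxl is_nf).
  + exact: IHN.
  + by move=> _ [w [nw bw ->]] _ _; apply: spans_gen; rewrite -nf_succE //; exact: isE.
  + exact: IHN.
  + by move=> _ [w [nw bw ->]] _ _; apply: spans_gen; rewrite -nf_succE //; exact: isE.
- rewrite et nf_Node; case: (boolP (nonleaf t0)) => [nt0|nt0].
    rewrite nf_succE //; apply/rule4; apply: (@reduces_ctxr is_nf_comb).
      by apply: bar_nf_comb => //; move: hN; rewrite et nf_Node nf_succE //=; lia.
    by move=> _ [ws [w0 bws ->]] _ _; apply: spans_gen; rewrite -nf_succE //; exact: isE.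
  have el c : nf_succ t0 c = c by case: (t0) nt0.
  rewrite el; have hN' : (bleaves (nf_comb us) + bleaves (nf s) <= N)%N by move: hN; rewrite et nf_Node el.
  apply: (@spans_mono is_nf_comb); last exact: bar_nf_comb.
  by move=> _ [ws [w0 bws ->]]; rewrite -[nf_comb ws]/(nf_succ Leaf (nf_comb ws)); exact: isE.
Qed.
End Step.

Lemma mul_all N : mul_reduces N.
Proof. by elim: N => [|N IH]; [move=> ? ? ? ? ? _ _ _ _ /=; rewrite ltn0 | exact: mul_step]. Qed.

Lemma reduces_all t n k : reduces is_nf n k t.
Proof.
elim: t n k => [|g l IHl r IHr] n k.
  (* The identity is the normal form of the corolla with two leaves. *)
  by apply: spans_gen; exists (Node [:: Leaf; Leaf]).
apply: (@reduces_ctxl is_nf) => // _ [t [nt bt ->]] _ _.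
apply: (@reduces_ctxr is_nf) => // _ [s [ns bs ->]] _ _.
exact: (@mul_all (bleaves (nf t) + bleaves (nf s)).+1).
Qed.

Lemma spans_all n k (x : F n k) : spans is_nf x.
Proof.
elim/F_ind: x => [|x y|t c _]; [exact: spans0|exact: spansD|].
have h m : spans is_nf (bmono n k t *+ m : F n k).
  by elim: m => [|m IH]; [exact: spans0 | rewrite mulrS; apply: spansD => //; exact: reduces_all].
by case: c => m; [exact: h | apply: spansN; exact: h].
Qed.

End Spanning.

(** * The images of the normal forms in [Pi] *)

Definition Pi_gen (g : gen) : Pi 2%N (gdeg g) :=
  match g with
  | Glt => expr 2 0 [:: [:: 1%N]; [:: 2%N]]
  | Ggt => expr 2 0 [:: [:: 2%N]; [:: 1%N]]
  | Gbar => expr 2 1 [:: [:: 1%N; 2%N]]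
  end.

Lemma dims_dfs o t : dims (dfs_word o t) = dims (dfs_word 0 t).
Proof. by rewrite -[o]add0n (dfs_shift o).1 dims_relabel. Qed.

Lemma dims_dfs_forest o us : dims (dfs_forest o us) = dims (dfs_forest 0 us).
Proof. by rewrite -[o]add0n (dfs_shift o).2 dims_relabel. Qed.

Lemma dims_forest_cons u us :
  dims (dfs_forest 0 (u :: us)) = (dims (dfs_word 0 u) + dims (dfs_forest 0 us))%N.
Proof. by rewrite /= dims_cat [dims (dfs_forest (0 + _) _)]dims_dfs_forest. Qed.

Lemma dims_Node o ts : dims (dfs_word o (Node ts)) = ((size ts).-2 + dims (dfs_forest 0 ts))%N.
Proof.
rewrite dfs_Node dims_cons dims_dfs_forest; congr (_ + _)%N.
case: ts => //= t ts; rewrite /Defs.dim; congr (_.-1).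
by elim: ts (o + leaves t)%N => //= u us IH p; rewrite IH.
Qed.

(** The number of leaves drops by one, since [n] inputs correspond to [n + 1]
    leaves of a plane tree. *)
Lemma size_nf :
  (forall t, nonleaf t -> branching t ->
    (bleaves (nf t)).+1 = leaves t /\ bdeg (nf t) = dims (dfs_word 0 t)) /\
  (forall us, us != [::] -> all branching us ->
    bleaves (nf_comb us) = forest_leaves us /\
    bdeg (nf_comb us) = ((size us).-1 + dims (dfs_forest 0 us))%N).
Proof.
pose P t := nonleaf t -> branching t ->
    (bleaves (nf t)).+1 = leaves t /\ bdeg (nf t) = dims (dfs_word 0 t).
pose P2 us := us != [::] -> all branching us ->
    bleaves (nf_comb us) = forest_leaves us /\
    bdeg (nf_comb us) = ((size us).-1 + dims (dfs_forest 0 us))%N.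
pose Q us := P2 us /\ (forall t0 vs, us = t0 :: vs -> P t0 /\ P2 vs).
have PL : P Leaf by [].
have PN ts : Q ts -> P (Node ts).
  move=> [_ Qts] _; case: ts Qts => // t ts /(_ _ _ erefl)[Pt Pts].
  case/andP=> s /andP[bt bts]; have ts0 : ts != [::] by case: (ts) s.
  have [e1 e2] := Pts ts0 bts; rewrite dims_Node nf_Node dims_forest_cons.
  case: (boolP (nonleaf t)) => nt.
    have [e3 e4] := Pt nt bt; rewrite nf_succE //= e1 e2 e4; move: e3 ts0.
    by rewrite /forest_leaves; case: (ts) => //= u us <- _; split; lia.
  by case: (t) nt => //= _; rewrite e1 e2 add1n /dims /= add0n; split=> //; case: (ts) ts0.
have Q0 : Q [::] by [].
have QS t ts : P t -> Q ts -> Q (t :: ts).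
  move=> Pt [Pts _]; split; last by move=> _ _ [<- <-].
  move=> _ /andP[bt bts].
  have [e1 e2] : bleaves (nf_prec t) = leaves t /\ bdeg (nf_prec t) = dims (dfs_word 0 t).
    case: (boolP (nonleaf t)) => nt; last by case: (t) nt.
    by have [e3 e4] := Pt nt bt; rewrite nf_precE //= e4 -e3; split; lia.
  rewrite dims_forest_cons; case: ts Pts bts => [|u us] Pts bts.
    by rewrite /= e1 e2 /forest_leaves /=; split; rewrite ?addn0.
  have [e3 e4] := Pts isT bts; rewrite nf_comb_cons /= e1 e2 in e3 e4 *.
  rewrite e3 e4 /forest_leaves /=; split=> //; lia.
split; first exact: (ptree_ind2 PL PN Q0 QS).
by move=> us; have [] := forest_ind2 PL PN Q0 QS us.
Qed.

Lemma nf_cell n k t : nonleaf t -> branching t ->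
  is_cell n k t = btyped n k (nf t).
Proof.
move=> nt bt; have [e1 e2] := size_nf.1 t nt bt.
by rewrite /is_cell bt -e1 eqSS /btyped e2 /tree_vertices dfs_vertices.
Qed.

Lemma low2 w : low 2 w = relabel (addn 1) w.
Proof. by apply: eq_relabel => x _; rewrite /lowl; lia. Qed.

Lemma low1 w : low 1 w = w.
Proof. by apply: relabel_id => x _; rewrite /lowl addn1. Qed.

Lemma comp_lt n b v (h : composable 2 0 n b n.+1 b 2) : is_expr n b v ->
  pi_comp n.+1 b 2 (Pi_gen Glt) (expr n b v) = expr n.+1 b ([:: 1%N] :: relabel (addn 1) v).
Proof.
move=> ev_; rewrite (pi_comp_expr2 h) // low2.
have -> : up 2 n [:: [:: 1%N]; [:: 2%N]] = [:: [:: 1%N]; [:: 2%N]] by [].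
rewrite wcomp_notin // wcomp_1l // relabel_nil; exact: is_expr_nil ev_.
Qed.

Lemma up1_low2 m w : (0 < m)%N -> {in flatten w, forall x, 0 < x}%N ->
  up 1 m (relabel (addn 1) w) = relabel (addn m) w.
Proof.
move=> m0 h; rewrite /up relabel_comp; apply: eq_relabel => x /h x0 /=.
by rewrite /upl; case: ltnP => ?; lia.
Qed.

Lemma relabel_cons r c w : relabel r (c :: w) = map r c :: relabel r w.
Proof. by []. Qed.
Lemma is_expr_pos n k w : is_expr n k w -> {in flatten w, forall x, 0 < x}%N.
Proof. by move=> h x; rewrite (is_expr_mem h) => /andP[]. Qed.

(** The composite [c | C], where [c] starts with the block of the letter 1: this
    letter is put in front of the first block of [C]. *)
Lemma comp_bar m a n b r c u w v
  (h2 : composable 2 1 n b n.+1 (1 + b) 2)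
  (h1 : composable n.+1 (1 + b) m a r c 1) :
  is_expr m a ([:: 1%N] :: w) -> is_expr n b (u :: v) ->
  pi_comp r c 1 (pi_comp n.+1 (1 + b) 2 (Pi_gen Gbar) (expr n b (u :: v)))
     (expr m a ([:: 1%N] :: w)) =
  sg (dims v * dims w)
   (shw (fun t => expr r c ((1%N :: map (addn m) u) :: t)) w (relabel (addn m) v)).
Proof.
move=> ew ev_.
have -> : pi_comp n.+1 (1 + b) 2 (Pi_gen Gbar) (expr n b (u :: v)) =
   expr n.+1 (1 + b) ((1%N :: map (addn 1) u) :: relabel (addn 1) v).
  rewrite (pi_comp_expr2 h2) // low2.
  have -> : up 2 n [:: [:: 1%N; 2%N]] = [:: [:: 1%N; 2%N]] by [].
  by rewrite relabel_cons wcomp_in // sh0s /= muln0.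
have ev' : is_expr n.+1 (1 + b) ((1%N :: map (addn 1) u) :: relabel (addn 1) v).
  apply: (composite_expr h2 (w := [:: [:: 1%N; 2%N]]) _ ev_) => //.
  have [u0 bv] : u != [::] /\ blocky v by apply/andP; exact: (is_expr_blocky ev_).
  rewrite low2; apply/and3P; split; first exact: perm_refl.
    rewrite !dims_cons !dims_relabel /dims /Defs.dim /= !size_map.
    by case: (u) u0 => //= x s _; apply/eqP; lia.
  by change (is_true (blocky (relabel (addn 1) v))); rewrite blocky_relabel.
rewrite (pi_comp_expr2 h1) // low1.
have m0 := is_expr_gt0 ew; have pv := is_expr_pos ev_.
have -> : up 1 m ((1%N :: map (addn 1) u) :: relabel (addn 1) v) =
   (1%N :: map (addn m) u) :: relabel (addn m) v.
  have := @up1_low2 m (u :: v) m0 pv; rewrite !relabel_cons.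
  by rewrite [up 1 m _]/= => -[<- <-].
rewrite wcomp_in ?inE // /= mul0n addn0 {1}/after /= subn1 /= size_map.
rewrite (eq_sh (g := fun t => sg (size u) (expr r c ((1%N :: map (addn m) u) :: t)))); last first.
  move=> t; have := @swapping_head _ (expr r c) (map (addn m) u) [:: 1%N] t [::] (@expr_swapping r c).
  by rewrite size_map muln1.
rewrite sh_sg sg_sg sg_even ?oddD ?addbb // sh_comm !dimsE dims_relabel //.
Qed.

(** The composite [t > C]: the first block of [C] stays in front, and [t] is
    shuffled into the rest. *)
Lemma comp_gt m a n b r c u w v
  (h2 : composable 2 0 n b n.+1 (0 + b) 2)
  (h1 : composable n.+1 (0 + b) m a r c 1) :
  is_expr m a w -> is_expr n b (u :: v) ->
  pi_comp r c 1 (pi_comp n.+1 (0 + b) 2 (Pi_gen Ggt) (expr n b (u :: v))) (expr m a w) =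
  sg (dims w * dims v)
   (shw (fun t => expr r c (map (addn m) u :: t)) w (relabel (addn m) v)).
Proof.
move=> ew ev_.
have m0 := is_expr_gt0 ew; have pv := is_expr_pos ev_.
have u2 : up 2 n [:: [:: 2%N]; [:: 1%N]] = [:: [:: 2%N]; [:: 1%N]] by [].
rewrite (@pi_comp_expr2 2 0 n b n.+1 (0 + b) 2 _ (u :: v) h2) //.
rewrite (pi_comp_wcompl h2 h1) // u2 low2 relabel_cons wcomp_in // muln0 /=.
rewrite [after _ _]/= sg0 low1.
have -> : shw (fun t => wcomp (expr r c) 1 (up 1 m (map (addn 1) u :: t)) w)
    [:: [:: 1%N]] (relabel (addn 1) v) =
  shw (fun t => wcomp (fun t => expr r c (map (addn m) u :: t)) 1 t w)
     [:: [:: 1%N]] (relabel (addn m) v).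
  have := @up1_low2 m (u :: v) m0 pv; rewrite !relabel_cons [up 1 m _]/= => -[eu ev'].
  rewrite -ev' -[[:: [:: 1%N]] in RHS]/(relabel (upl 1 m) [:: [:: 1%N]]).
  rewrite /relabel (@sh_map _ _ dim dim) => [|b']; last by rewrite /dim size_map.
  apply: eq_sh => t; rewrite [up 1 m _]/= eu wcomp_notin //.
  apply/mapP => -[x xu]; have := pv x; rewrite /= mem_cat xu => /(_ isT); lia.
have n1 : 1%N \notin flatten (relabel (addn m) v).
  rewrite flatten_relabel; apply/mapP => -[x xv].
  have := pv x; rewrite /= mem_cat xv orbT => /(_ isT); lia.
rewrite sh_wcompl ?(is_expr_blocky ew) ?(is_expr_nil ew) //.
by rewrite wcomp_1l ?(is_expr_nil ew) // dims_relabel.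
Qed.

Arguments tsum : simpl never.
Arguments fsum : simpl never.

(** The signs relating [nf T] to [t_T] depend on [T] in a complicated way, and
    only their existence matters. *)
Definition eq_pm (V : zmodType) (x y : V) := exists k, x = sg k y.

Lemma tsum_expr_ext (A : zmodType) n k t (f g : word -> A) : (0 < n)%N -> is_cell n k t ->
  (forall w, is_expr n k w -> perm_eq w (dfs_word 0 t) -> f w = g w) ->
  tsum t 0 f = tsum t 0 g.
Proof. by move=> n0 ct h; apply: tsum_ext => w p; apply: h => //; exact: cell_expr p. Qed.

Lemma tsum_comb (A : zmodType) us o (f : word -> A) :
  tsum (Node (Leaf :: us)) o f = fsum us (o + 1) (fun w => f (starts (o + 1) us :: w)).
Proof. by rewrite tsum_Node fsum_cons /=; apply: fsum_ext => w _; rewrite sh0s. Qed.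

Lemma comb_cell n k us : us != [::] -> all branching us ->
  btyped n k (nf_comb us) -> is_cell n k (Node (Leaf :: us)).
Proof.
move=> us0 bus; have [e1 e2] := size_nf.2 us us0 bus.
have b : branching (Node (Leaf :: us)) by rewrite /= bus; case: (us) us0.
by rewrite (@nf_cell n k (Node (Leaf :: us))) // nf_Node.
Qed.

Lemma pi_comp_tsumr m a n b r c i (x : Pi_mod m a) t o (f : word -> Pi_mod n b) :
  pi_comp r c i x (tsum t o f) = tsum t o (fun w => pi_comp r c i x (f w)).
Proof. exact: (raddf_tsum (pi_compr r c i x)). Qed.

Lemma pi_comp_fsumr m a n b r c i (x : Pi_mod m a) us o (f : word -> Pi_mod n b) :
  pi_comp r c i x (fsum us o f) = fsum us o (fun w => pi_comp r c i x (f w)).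
Proof. exact: (raddf_fsum (pi_compr r c i x)). Qed.

Lemma pi_comp_fsuml m a n b r c i (y : Pi_mod n b) us o (f : word -> Pi_mod m a) :
  pi_comp r c i (fsum us o f) y = fsum us o (fun w => pi_comp r c i (f w) y).
Proof. exact: (raddf_fsum (pi_compl r c i y)). Qed.

Lemma cell_gt0 n k t : nonleaf t -> branching t -> is_cell n k t -> (0 < n)%N.
Proof.
by move=> nt bt; rewrite nf_cell // => /andP[/eqP<- _]; exact: bleaves_gt0.
Qed.
(** Composing with [1 (x) 2] prepends the block of the letter 1. *)
Lemma ev_prec t n k : nonleaf t -> branching t -> is_cell n k t ->
  eq_pm (ev Pi_gen (nf t) n k) (tsum t 0 (expr n k)) ->
  eq_pm (ev Pi_gen (nf_prec t) n.+1 k) (tsum t 1 (fun w => expr n.+1 k ([:: 1%N] :: w))).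
Proof.
move=> nt bt ct [p ep]; exists p; have n0 := cell_gt0 nt bt ct.
have := ct; rewrite nf_cell // => /andP[/eqP bn /eqP bk].
rewrite nf_precE //; subst n k; set n := bleaves (nf t) in n0 ct ep *; set k := bdeg (nf t) in ct ep *.
have h2 : composable 2 (gdeg Glt) n k n.+1 (gdeg Glt + k) 2 := node_comp2 Glt (nf t).
have h1 : composable n.+1 (gdeg Glt + k) 1 0 n.+1 k 1.
  by rewrite /composable /= addn1 addn0 !eqxx.
rewrite (@ev_node Pi Pi_gen Glt bleaf (nf t) n.+1 k h2 h1) ep.
have -> : op_comp Pi h1 (op_comp Pi h2 (Pi_gen Glt) (sg p (tsum t 0 (expr n k)))) (op_one Pi) =
    op_comp Pi h2 (Pi_gen Glt) (sg p (tsum t 0 (expr n k))) by exact: (comp_1r Pi_axioms).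
rewrite (comp_sgr Pi_axioms); congr sg.
rewrite -[1%N in RHS]/(0 + 1)%N (tsum_fsum_shift _ 1).1 /op_comp /= pi_comp_tsumr.
by apply: (tsum_expr_ext n0 ct) => w ew _; exact: (comp_lt h2).
Qed.

Lemma size_nf_prec u : branching u ->
  bleaves (nf_prec u) = leaves u /\ bdeg (nf_prec u) = dims (dfs_word 0 u).
Proof.
move=> bu; have [//|e1 e2] := size_nf.2 [:: u] isT; first by rewrite /= bu.
by move: e1 e2; rewrite /forest_leaves /= cats0 addn0.
Qed.

Lemma prec_cell u : branching u -> is_cell (bleaves (nf_prec u)) (bdeg (nf_prec u)) (Node [:: Leaf; u]).
Proof. by move=> bu; apply: comb_cell => //=; rewrite ?bu ?typed_self. Qed.

Lemma ev_bar u us n k : us != [::] -> all branching us -> branching u ->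
  btyped n k (bnode Gbar (nf_prec u) (nf_comb us)) ->
  eq_pm (ev Pi_gen (nf_prec u) (bleaves (nf_prec u)) (bdeg (nf_prec u)))
     (tsum u 1 (fun w => expr (bleaves (nf_prec u)) (bdeg (nf_prec u)) ([:: 1%N] :: w))) ->
  eq_pm (ev Pi_gen (nf_comb us) (bleaves (nf_comb us)) (bdeg (nf_comb us)))
     (tsum (Node (Leaf :: us)) 0 (expr (bleaves (nf_comb us)) (bdeg (nf_comb us)))) ->
  eq_pm (ev Pi_gen (bnode Gbar (nf_prec u) (nf_comb us)) n k)
     (tsum (Node (Leaf :: u :: us)) 0 (expr n k)).
Proof.
move=> us0 bus bu ht [p ep] [q eq].
exists (p + q + dims (dfs_forest 0 us) * dims (dfs_word 0 u))%N.
have h2 := node_comp2 Gbar (nf_comb us); have h1 := node_comp1 ht.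
rewrite (ev_node Pi_gen h2 h1) ep eq (comp_sgr Pi_axioms h1) (comp_sgr Pi_axioms h2).
rewrite (comp_sgl Pi_axioms h1) sg_sg -[in RHS]sg_sg; congr sg.
rewrite /op_comp /= !tsum_comb add0n pi_comp_tsumr fsum_cons -tsum_sg.
apply: tsum_ext => w pw; rewrite pi_comp_fsumr pi_comp_fsuml.
have [e1 e2] := size_nf_prec bu.
rewrite -e1 (tsum_fsum_shift _ (bleaves (nf_prec u))).2 -fsum_sg; apply: fsum_ext => v pv.
have cu := prec_cell bu; have cus := comb_cell us0 bus (typed_self _).
have ew : is_expr (bleaves (nf_prec u)) (bdeg (nf_prec u)) ([:: 1%N] :: w).
  apply: (cell_expr (bleaves_gt0 _) cu); rewrite dfs_Node /= add0n perm_cons.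
  by rewrite cats0.
have ev_ : is_expr (bleaves (nf_comb us)) (bdeg (nf_comb us)) (starts 1 us :: v).
  by apply: (cell_expr (bleaves_gt0 _) cus); rewrite dfs_Node /= add0n perm_cons.
apply: (etrans (comp_bar h2 h1 ew ev_)); rewrite (dims_perm pv) dims_dfs_forest (dims_perm pw) dims_dfs.
by congr sg; rewrite /= -e1 starts_shift.
Qed.

Lemma ev_succ t us n k : us != [::] -> all branching us -> nonleaf t -> branching t ->
  btyped n k (bnode Ggt (nf t) (nf_comb us)) ->
  eq_pm (ev Pi_gen (nf t) (bleaves (nf t)) (bdeg (nf t)))
     (tsum t 0 (expr (bleaves (nf t)) (bdeg (nf t)))) ->
  eq_pm (ev Pi_gen (nf_comb us) (bleaves (nf_comb us)) (bdeg (nf_comb us)))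
     (tsum (Node (Leaf :: us)) 0 (expr (bleaves (nf_comb us)) (bdeg (nf_comb us)))) ->
  eq_pm (ev Pi_gen (bnode Ggt (nf t) (nf_comb us)) n k)
     (tsum (Node (t :: us)) 0 (expr n k)).
Proof.
move=> us0 bus nt bt ht [p ep] [q eq].
exists (p + q + dims (dfs_word 0 t) * dims (dfs_forest 0 us))%N.
have h2 := node_comp2 Ggt (nf_comb us); have h1 := node_comp1 ht.
rewrite (ev_node Pi_gen h2 h1) ep eq (comp_sgr Pi_axioms h1) (comp_sgr Pi_axioms h2).
rewrite (comp_sgl Pi_axioms h1) sg_sg -[in RHS]sg_sg; congr sg.
rewrite /op_comp /= tsum_comb add0n pi_comp_tsumr tsum_Node fsum_cons -tsum_sg.
apply: tsum_ext => w pw; rewrite pi_comp_fsumr pi_comp_fsuml.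
have [e1 e2] := size_nf.1 t nt bt.
rewrite add0n -e1 -[(bleaves (nf t)).+1]add1n (tsum_fsum_shift _ (bleaves (nf t))).2 -fsum_sg; apply: fsum_ext => v pv.
have ct : is_cell (bleaves (nf t)) (bdeg (nf t)) t by rewrite nf_cell ?typed_self.
have cus := comb_cell us0 bus (typed_self _).
have ew := cell_expr (bleaves_gt0 _) ct pw.
have ev_ : is_expr (bleaves (nf_comb us)) (bdeg (nf_comb us)) (starts 1 us :: v).
  by apply: (cell_expr (bleaves_gt0 _) cus); rewrite dfs_Node /= add0n perm_cons.
apply: (etrans (comp_gt h2 h1 ew ev_)); rewrite (dims_perm pv) dims_dfs_forest (dims_perm pw).
by congr sg; rewrite /= add0n -e1 -[(bleaves (nf t)).+1]add1n starts_shift.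
Qed.

(** In the induction, [nf_comb us] corresponds to the tree with a leaf followed
    by the subtrees [us]: it is what remains of [nf] when the first subtree is
    a leaf. *)
Lemma ev_nf :
  (forall t, nonleaf t -> branching t -> forall n k, btyped n k (nf t) ->
    eq_pm (ev Pi_gen (nf t) n k) (tsum t 0 (expr n k))) /\
  (forall us, us != [::] -> all branching us -> forall n k, btyped n k (nf_comb us) ->
    eq_pm (ev Pi_gen (nf_comb us) n k) (tsum (Node (Leaf :: us)) 0 (expr n k))).
Proof.
pose P t := nonleaf t -> branching t -> forall n k, btyped n k (nf t) ->
    eq_pm (ev Pi_gen (nf t) n k) (tsum t 0 (expr n k)).
pose P2 us := us != [::] -> all branching us -> forall n k, btyped n k (nf_comb us) ->
    eq_pm (ev Pi_gen (nf_comb us) n k) (tsum (Node (Leaf :: us)) 0 (expr n k)).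
pose Q us := P2 us /\ (forall t0 vs, us = t0 :: vs -> P t0 /\ P2 vs).
have PL : P Leaf by [].
have PN ts : Q ts -> P (Node ts).
  move=> [_ Qts] _; case: ts Qts => // t ts /(_ _ _ erefl)[Pt Pts].
  case/andP=> s /andP[bt bts] n k; have ts0 : ts != [::] by case: (ts) s.
  rewrite nf_Node; case: (boolP (nonleaf t)) => nt.
    rewrite nf_succE // => ht; apply: ev_succ => //.
      by apply: Pt => //; exact: typed_self.
    by apply: Pts => //; exact: typed_self.
  by case: (t) nt => //= _ ht; exact: Pts.
have Q0 : Q [::] by [].
have QS t ts : P t -> Q ts -> Q (t :: ts).
  move=> Pt [Pts _]; split; last by move=> _ _ [<- <-].
  move=> _ /andP[bt bts].
  have h : eq_pm (ev Pi_gen (nf_prec t) (bleaves (nf_prec t)) (bdeg (nf_prec t)))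
     (tsum t 1 (fun w => expr (bleaves (nf_prec t)) (bdeg (nf_prec t)) ([:: 1%N] :: w))).
    case: (boolP (nonleaf t)) => nt; last by case: (t) nt => // _; exists 0%N.
    have := ev_prec nt bt _ (Pt nt bt _ _ (typed_self _)).
    by rewrite nf_cell ?typed_self // nf_precE //= !addn0 add1n add0n; apply.
  case: ts Pts bts => [|u us] Pts bts n k.
    case/andP=> /eqP<- /eqP<-; rewrite tsum_comb fsum_cons.
    have -> : tsum t (0 + 1) (fun x => fsum [::] (0 + 1 + leaves t) (fun y => shw (fun w => expr (bleaves (nf_comb [:: t])) (bdeg (nf_comb [:: t])) (starts (0 + 1) [:: t] :: w)) x y)) =
      tsum t 1 (fun w => expr (bleaves (nf_prec t)) (bdeg (nf_prec t)) ([:: 1%N] :: w)).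
      by apply: tsum_ext => w _; exact: shs0.
    exact: h.
  rewrite nf_comb_cons => ht; apply: ev_bar => //.
  by apply: Pts => //; exact: typed_self.
split; first exact: (ptree_ind2 PL PN Q0 QS).
by move=> us; have [] := forest_ind2 PL PN Q0 QS us.
Qed.

(** * Suboperads, kernels and the relations in [Pi] *)

Lemma op_sub_axioms (P : dgop) (S : forall n k, zmodClosed (P n k)) (st : op_stable S) :
  dgop_axioms P -> dgop_axioms (op_sub st).
Proof.
move=> hP; split.
- by move=> *; apply: val_inj; exact: (comp_addl hP).
- by move=> *; apply: val_inj; exact: (comp_addr hP).
- by move=> *; apply: val_inj; exact: (comp_1l hP).
- by move=> *; apply: val_inj; exact: (comp_1r hP).
- by move=> *; apply: val_inj; exact: (comp_seq hP).
- move=> m a n b p e r c s f t g i k h1 h2 h3 h4 x y z ik; apply: val_inj.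
  by rewrite raddfMz; exact: (comp_par hP).
- by move=> *; apply: val_inj; exact: (d_add hP).
- by move=> *; apply: val_inj; exact: (d_d hP).
- move=> m a n b r c i h h1 h2 x y; apply: val_inj.
  by rewrite raddfD raddfMz; exact: (d_comp hP).
Qed.

Notation w_lt := [:: [:: 1%N]; [:: 2%N]].
Notation w_gt := [:: [:: 2%N]; [:: 1%N]].
Notation w_bar := [:: [:: 1%N; 2%N]].

Lemma expr_bar_swap : expr 2 1 [:: [:: 2%N; 1%N]] = - expr 2 1 w_bar.
Proof. exact: (@expr_swapping 2 1 [::] [:: 2%N] [:: 1%N] [::] [::]). Qed.

Lemma dPi_lt : op_d Pi (Pi_gen Glt) = Pi_gen Gbar.
Proof. by rewrite /op_d /= pi_d_expr // /= /sg /= !addr0. Qed.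

Lemma dPi_gt : op_d Pi (Pi_gen Ggt) = - Pi_gen Gbar.
Proof. by rewrite /op_d /= pi_d_expr // /= /sg /= !addr0 -expr_bar_swap. Qed.

Lemma dPi_bar : op_d Pi (Pi_gen Gbar) = 0.
Proof. by rewrite /op_d /= pi_d_expr // /= /sg /= addr0 oppr0. Qed.

Definition phi : op_family F Pi := free_map Pi_gen.

Lemma phi_morphism : op_morphism phi.
Proof. exact: (free_map_morphism Pi_axioms dPi_lt dPi_gt dPi_bar). Qed.

Lemma phi_gen g : phi 2 (gdeg g) (Fgen g) = Pi_gen g.
Proof. exact: (free_map_gen Pi_gen Pi_axioms g). Qed.

Lemma phi_comp2 g h i (hi : (0 < i <= 2)%N) :
  phi 3 (gdeg g + gdeg h) (comp2 hi (Fgen g) (Fgen h)) =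
  pi_comp 3 (gdeg g + gdeg h) i (Pi_gen g) (Pi_gen h).
Proof.
rewrite /comp2 (morph_comp phi_morphism) !phi_gen.
reflexivity.
Qed.

(** Each relation is an identity between at most four expressions of arity 3,
    up to reordering the letters of one block. *)
Lemma phi_relations n k (x : F n k) :
  Frel x ->
  phi n k x = 0.
Proof.
have c2 i d e : (0 < i <= 2)%N -> composable 2 d 2 e 3 (d + e) i.
  by move=> hi; rewrite /composable hi !eqxx.
have E1 := phi_comp2 Ggt Glt (i := 2) isT.
have E2 := phi_comp2 Glt Ggt (i := 1) isT.
have E3 := phi_comp2 Ggt Ggt (i := 2) isT.
have E4 := phi_comp2 Ggt Ggt (i := 1) isT.
have E5 := phi_comp2 Ggt Glt (i := 1) isT.
have E6 := phi_comp2 Glt Glt (i := 1) isT.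
have E7 := phi_comp2 Glt Glt (i := 2) isT.
have E8 := phi_comp2 Glt Ggt (i := 2) isT.
have E9 := phi_comp2 Ggt Gbar (i := 2) isT.
have E10 := phi_comp2 Gbar Ggt (i := 1) isT.
have E11 := phi_comp2 Glt Gbar (i := 1) isT.
have E12 := phi_comp2 Gbar Glt (i := 2) isT.
have E13 := phi_comp2 Gbar Glt (i := 1) isT.
have E14 := phi_comp2 Gbar Ggt (i := 2) isT.
have E15 := phi_comp2 Gbar Gbar (i := 1) isT.
have E16 := phi_comp2 Gbar Gbar (i := 2) isT.
have sortw k' a b t : expr 3 k' ((a ++ b) :: t) = sg (size a * size b) (expr 3 k' ((b ++ a) :: t)).
  exact: (@expr_swapping 3 k' [::] a b t [::]).
pose sub2 (V : zmodType) (u v : V) := u - v.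
pose add2 (V : zmodType) (u v : V) := u + v.
have lin2 d e (u v w : F d e) : phi d e (u - (v + w)) = phi d e u - (phi d e v + phi d e w).
  by rewrite raddfB raddfD.
case=> {n k x}.
- rewrite raddfB; apply: (etrans (congr2 (@sub2 _) E1 E2)); rewrite /sub2.
  rewrite /Pi_gen !pi_comp_expr2 ?c2 // /= ?(sh_cons, shs0, sh0s) /sg /=.
  by rewrite [X in X - _]addrC subrr.
- rewrite lin2; apply: (etrans (congr2 (@sub2 _) E3 (congr2 (@add2 _) E4 E5))); rewrite /sub2 /add2.
  rewrite /Pi_gen !pi_comp_expr2 ?c2 // /= ?(sh_cons, shs0, sh0s) /sg /=.
  by apply/eqP; rewrite subr_eq0 [X in _ == X]addrC.
- rewrite lin2; apply: (etrans (congr2 (@sub2 _) E6 (congr2 (@add2 _) E7 E8))); rewrite /sub2 /add2.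
  rewrite /Pi_gen !pi_comp_expr2 ?c2 // /= ?(sh_cons, shs0, sh0s) /sg /=.
  by apply/eqP; rewrite subr_eq0 [X in _ == X]addrC.
- rewrite raddfB; apply: (etrans (congr2 (@sub2 _) E9 E10)); rewrite /sub2.
  rewrite /Pi_gen !pi_comp_expr2 ?c2 // /= ?(sh_cons, shs0, sh0s) /sg /=.
  rewrite (sortw _ [:: upl 1 2 2] [:: lowl 1 2]) /sg /= opprK; exact: subrr.
- rewrite raddfB; apply: (etrans (congr2 (@sub2 _) E11 E12)); rewrite /sub2.
  rewrite /Pi_gen !pi_comp_expr2 ?c2 // /= ?(sh_cons, shs0, sh0s) /sg /=.
  exact: subrr.
- rewrite raddfB; apply: (etrans (congr2 (@sub2 _) E13 E14)); rewrite /sub2.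
  rewrite /Pi_gen !pi_comp_expr2 ?c2 // /= ?(sh_cons, shs0, sh0s) /sg /=.
  rewrite (sortw _ [:: upl 1 2 2] [:: lowl 1 1]) /sg /= opprK; exact: subrr.
- rewrite raddfB raddfN; apply: (etrans (congr2 (@sub2 _) E15 (congr1 (@GRing.opp _) E16))); rewrite /sub2.
  rewrite /Pi_gen !pi_comp_expr2 ?c2 // /= ?(sh_cons, shs0, sh0s) /sg /=.
  rewrite (sortw _ [:: upl 1 2 2] [:: lowl 1 1; lowl 1 2]) /sg /=; exact: subrr.
Qed.

Section Kernel.
Variables (P Q : dgop) (f : op_family P Q).

Definition ker_pred n k : {pred P n k} := fun x => f n k x == 0.

Lemma ker_closed n k : zmod_closed (@ker_pred n k).
Proof.
split; first by apply/eqP; exact: raddf0.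
by move=> x y /eqP hx /eqP hy; apply/eqP; rewrite raddfB hx hy subrr.
Qed.

HB.instance Definition _ n k := GRing.isZmodClosed.Build (P n k) (@ker_pred n k) (@ker_closed n k).
Definition ker n k : zmodClosed (P n k) := @ker_pred n k.

Lemma in_ker n k (x : P n k) : (x \in ker n k) = (f n k x == 0).
Proof. by []. Qed.

Hypotheses (hQ : dgop_axioms Q) (hf : op_morphism f).

Lemma ker_ideal : op_ideal ker.
Proof.
move=> m a n b r c i h x y; rewrite !in_ker (morph_comp hf) => -[] /eqP->; apply/eqP.
  exact: (raddf0 (compl hQ h (f n b y))).
exact: (raddf0 (compr hQ h (f m a x))).
Qed.

Lemma ker_d_stable : d_stable ker.
Proof.
move=> n a x; rewrite !in_ker (morph_d hf) => /eqP->.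
apply/eqP; have := d_add hQ (0 : Q n a) 0; rewrite addr0 => /eqP.
by rewrite -subr_eq0 opprD addrA subrr sub0r oppr_eq0 => /eqP.
Qed.
End Kernel.

(** * [K'] is the image of the free operad *)

Lemma cell_nonleaf n k t : (0 < n)%N -> is_cell n k t -> nonleaf t.
Proof. by case: t => // n0 /and3P[_ /eqP[e]]; rewrite -e in n0. Qed.

Lemma phi_nf n k t : (0 < n)%N -> is_cell n k t ->
  eq_pm (phi n k (bmono n k (nf t))) (tree_elt n k t).
Proof.
move=> n0 ct; have nt := cell_nonleaf n0 ct; have /and3P[bt _ _] := ct.
rewrite nf_cell // in ct; rewrite tree_elt_tsum.
have [p e] := ev_nf.1 t nt bt n k ct.
by exists p; rewrite -e; exact: free_map_bmono.
Qed.

Lemma tree_elt_arity0 k t : is_cell 0 k t -> tree_elt 0 k t = 0.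
Proof.
case/and3P=> bt /eqP lt _; rewrite /tree_elt big1 // => w _.
by rewrite expr_out // mul0rz.
Qed.

Lemma ker_phi_relations n k (x : F n k) :
  Frel x ->
  x \in ker phi n k.
Proof. by move=> /phi_relations h; rewrite in_ker; apply/eqP. Qed.

Lemma phi_in_K n k (x : F n k) : phi n k x \in K_sub n k.
Proof.
have := spans_all (ker_ideal Pi_axioms phi_morphism) ker_phi_relations x.
elim=> [y|_ [t [nt bt ->]]|y z _ hy _ hz].
- by rewrite in_ker => /eqP->; exact: rpred0.
- case: (boolP (btyped n k (nf t))) => [ht|/bmono_out->]; last by rewrite raddf0; exact: rpred0.
  rewrite -nf_cell // in ht.
  have [p ->] := phi_nf (cell_gt0 nt bt ht) ht.
  by rewrite /sg; case: odd; rewrite ?rpredN; exact: tree_elt_K.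
- by rewrite raddfB; exact: rpredB.
Qed.

Lemma K_sub_phi n k (x : Pi n k) : x \in K_sub n k -> exists y, phi n k y = x.
Proof.
case/asboolP=> s [hs ->]; elim: s hs => [|[c t] s IH] /=.
  by move=> _; exists 0; rewrite big_nil; exact: (raddf0 (phi n k)).
case/andP=> ct /IH[y ey]; rewrite big_cons -ey /=.
case: (posnP n) => n0; last have [p ep] := phi_nf n0 ct.
  by subst n; exists y; rewrite tree_elt_arity0 // mul0rz add0r.
exists (sg p (bmono n k (nf t) : F n k) *~ c + y).
rewrite [LHS](raddfD (phi n k)) (raddfMz (phi n k)) (raddf_sg (phi n k)) ep sg_sg.
by rewrite sg_even // addnn odd_double.
Qed.

Lemma K_stable : op_stable K_sub.
Proof.
split.
- by rewrite -(morph_one phi_morphism); exact: phi_in_K.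
- move=> m a n b r c i h x y /K_sub_phi[x' <-] /K_sub_phi[y' <-].
  by rewrite -(morph_comp phi_morphism); exact: phi_in_K.
- move=> n a x /K_sub_phi[x' <-].
  by rewrite -(morph_d phi_morphism); exact: phi_in_K.
Qed.

Definition Kop : dgop := Kprime K_stable.

Lemma Kop_axioms : dgop_axioms Kop.
Proof. exact: op_sub_axioms Pi_axioms. Qed.

Lemma btyped2 k t : btyped 2 k t -> exists g, t = corolla g /\ gdeg g = k.
Proof.
case: t => // g l r /andP[/eqP b /eqP d].
have := bleaves_gt0 l; have := bleaves_gt0 r; move: b d.
case: l => [|g1 l1 r1]; case: r => [|g2 l2 r2] //=; last 3 first.
- by have := bleaves_gt0 l2; have := bleaves_gt0 r2; lia.
- by have := bleaves_gt0 l1; have := bleaves_gt0 r1; lia.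
- by have := bleaves_gt0 l1; have := bleaves_gt0 r1; lia.
by rewrite !addn0 => _ <-; exists g.
Qed.

(** The binary trees with two leaves are the three corollas. *)
Lemma F2_0 (x : F 2%N 0%N) :
  exists a b, x = rlt *~ a + rgt *~ b.
Proof.
elim/F_ind: x => [|_ _ [a [b ->]] [c [d ->]]|t c /btyped2[[] [->]] // _].
- by exists 0, 0; rewrite !mulr0z addr0.
- by exists (a + c), (b + d); rewrite !mulrzDr addrACA.
- by exists c, 0; rewrite mulr0z addr0.
- by exists 0, c; rewrite mulr0z add0r.
Qed.

Lemma F2_1 (x : F 2%N 1%N) : exists c, x = rbar *~ c.
Proof.
elim/F_ind: x => [|_ _ [a ->] [c ->]|t c /btyped2[[] [->]] // _].
- by exists 0; rewrite mulr0z.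
- by exists (a + c); rewrite mulrzDr.
- by exists c.
Qed.

Lemma F2_2 k (x : F 2%N k.+2) : x = 0.
Proof.
elim/F_ind: x => [//|_ _ -> ->|t c /btyped2[[] [->]]//]; exact: addr0.
Qed.

Lemma pcoef_lt_gt (a b : int) :
  pcoef w_lt ((Pi_gen Glt : Pi 2%N 0%N) *~ a + (Pi_gen Ggt : Pi 2%N 0%N) *~ b) = a /\
  pcoef w_gt ((Pi_gen Glt : Pi 2%N 0%N) *~ a + (Pi_gen Ggt : Pi 2%N 0%N) *~ b) = b.
Proof.
by split; rewrite raddfD !raddfMz /= !pcoef_expr // /delta /= ?mul0rz ?addr0 ?add0r intz.
Qed.

Lemma pcoef_bar (c : int) : pcoef w_bar ((Pi_gen Gbar : Pi 2%N 1%N) *~ c) = c.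
Proof. by rewrite raddfMz /= pcoef_expr // /delta /= intz. Qed.

Lemma val_K2_0 a b :
  val (K_lt *~ a + K_gt *~ b) = (Pi_gen Glt : Pi 2%N 0%N) *~ a + (Pi_gen Ggt : Pi 2%N 0%N) *~ b.
Proof. by rewrite raddfD !raddfMz. Qed.

Lemma val_K2_1 c : val (K_bar *~ c) = (Pi_gen Gbar : Pi 2%N 1%N) *~ c.
Proof. by rewrite raddfMz. Qed.

Lemma K2_0 (x : zsub (K_sub 2 0)) :
  x = K_lt *~ pcoef w_lt (val x) + K_gt *~ pcoef w_gt (val x).
Proof.
apply: val_inj; rewrite raddfD !raddfMz /=.
have [y <-] := K_sub_phi (valP x); have [a [b ->]] := F2_0 y.
rewrite raddfD !raddfMz.
have -> : phi 2%N 0%N rlt = Pi_gen Glt := phi_gen Glt.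
have -> : phi 2%N 0%N rgt = Pi_gen Ggt := phi_gen Ggt.
by have [-> ->] := pcoef_lt_gt a b.
Qed.

Lemma K2_1 (x : zsub (K_sub 2 1)) : x = K_bar *~ pcoef w_bar (val x).
Proof.
apply: val_inj; rewrite raddfMz /=.
have [y <-] := K_sub_phi (valP x); have [a ->] := F2_1 y.
rewrite raddfMz.
have -> : phi 2%N 1%N rbar = Pi_gen Gbar := phi_gen Gbar.
by rewrite pcoef_bar.
Qed.

Lemma K2_2 k (x : zsub (K_sub 2 k.+2)) : x = 0.
Proof.
apply: val_inj; have [y <-] := K_sub_phi (valP x).
by rewrite (F2_2 y) raddf0.
Qed.

(** As [K'(2)] is the image of the arity 2 component of [F], it is generated by
    the three expressions, which are part of a basis of [Pi(2)]. *)
Lemma K2_basisP : K2_basis.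
Proof.
split=> [x|x|]; last exact: K2_2.
- exists (pcoef w_lt (val x), pcoef w_gt (val x)); split; first exact: K2_0.
  move=> [a b] /= ->; rewrite val_K2_0; have [e1 e2] := pcoef_lt_gt a b.
  by apply: congr2; [exact: e1 | exact: e2].
- exists (pcoef w_bar (val x)); split; first exact: K2_1.
  by move=> c ->; rewrite val_K2_1; exact: pcoef_bar.
Qed.

(** * The free operad on the arity 2 component of [K'] *)

Definition K_gen g : Kop 2%N (gdeg g) :=
  match g with Glt => K_lt | Ggt => K_gt | Gbar => K_bar end.

Lemma val_K_gen g : val (K_gen g) = Pi_gen g.
Proof. by case: g. Qed.

Lemma dK_lt : op_d Kop (K_gen Glt) = K_gen Gbar.
Proof. by apply: val_inj; exact: dPi_lt. Qed.

Lemma dK_gt : op_d Kop (K_gen Ggt) = - K_gen Gbar.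
Proof. by apply: val_inj; rewrite raddfN; exact: dPi_gt. Qed.

Lemma dK_bar : op_d Kop (K_gen Gbar) = 0.
Proof. by apply: val_inj; exact: dPi_bar. Qed.

Definition psi : op_family F Kop := free_map K_gen.

Lemma psi_morphism : op_morphism psi.
Proof. exact: (free_map_morphism Kop_axioms dK_lt dK_gt dK_bar). Qed.

Lemma psi_gen g : psi 2%N (gdeg g) (Fgen g) = K_gen g.
Proof. exact: (free_map_gen K_gen Kop_axioms g). Qed.

Lemma val_psi n k (x : F n k) : val (psi n k x) = phi n k x.
Proof.
have hB m j : additive (fun x : F m j => val (psi m j x)).
  by move=> y z; rewrite !raddfB.
pose f : op_family F Pi := fun m j => pack_additive (hB m j).
rewrite -[LHS]/(f n k x); apply: free_map_unique.
  split.
  - by apply: (etrans (congr1 val (morph_one psi_morphism))).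
  - move=> m a n' b r c i h y z.
    by apply: (etrans (congr1 val (morph_comp psi_morphism h y z))).
  - by move=> m a y; apply: (etrans (congr1 val (morph_d psi_morphism y))).
by move=> g; apply: (etrans (congr1 val (psi_gen g))); rewrite val_K_gen.
Qed.

Lemma psi_surj n k (x : Kop n k) : exists y, psi n k y = x.
Proof.
have [y e] := K_sub_phi (valP x).
by exists y; apply: val_inj; rewrite val_psi.
Qed.

(** The coordinates are read off by [pcoef]; the result is the inverse of [psi]
    in arity 2. *)
Definition incl_fun k : Kop 2%N k -> F 2%N k :=
  match k with
  | 0 => fun x => rlt *~ pcoef w_lt (zval x)
                  + rgt *~ pcoef w_gt (zval x)
  | 1 => fun x => rbar *~ pcoef w_bar (zval x)
  | _ => fun=> 0
  end.

Lemma incl_funB k : additive (@incl_fun k).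
Proof.
have e w d (y z : Kop 2%N d) : pcoef w (zval (y - z)) = pcoef w (zval y) - pcoef w (zval z).
  exact: (raddfB (@pcoef 2 d w) (zval y) (zval z)).
case: k => [|[|k]] x y /=; last by rewrite subrr.
- by rewrite !e !mulrzBr opprD addrACA.
- by rewrite e mulrzBr.
Qed.

Definition incl k : {additive Kop 2%N k -> F 2%N k} := pack_additive (@incl_funB k).

Lemma psi_gen0 a b :
  psi 2%N 0%N (rlt *~ a + rgt *~ b) = K_lt *~ a + K_gt *~ b.
Proof.
rewrite raddfD !raddfMz.
by rewrite (psi_gen Glt : psi 2%N 0%N _ = _) (psi_gen Ggt : psi 2%N 0%N _ = _).
Qed.

Lemma psi_gen1 c : psi 2%N 1%N (rbar *~ c) = K_bar *~ c.
Proof. by rewrite raddfMz (psi_gen Gbar : psi 2%N 1%N _ = _). Qed.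

Lemma inclK k : cancel (incl k) (psi 2%N k).
Proof.
case: k => [|[|k]] x.
- by rewrite [RHS]K2_0; exact: psi_gen0.
- by rewrite [RHS]K2_1; exact: psi_gen1.
- by rewrite [LHS]K2_2 [RHS]K2_2.
Qed.

Lemma psi2K k : cancel (psi 2%N k) (incl k).
Proof.
case: k => [|[|k]] x; last by rewrite [LHS]F2_2 [RHS]F2_2.
- have [a [b ->]] := F2_0 x; rewrite psi_gen0.
  have [e1 e2] := pcoef_lt_gt a b; rewrite -val_K2_0 in e1 e2.
  by rewrite -[LHS]/(incl_fun _) /= e1 e2.
- have [c ->] := F2_1 x; rewrite psi_gen1.
  by rewrite -[LHS]/(incl_fun _) /= -[zval _]/(val _) val_K2_1 pcoef_bar.
Qed.

Lemma incl_K_gen g : incl (gdeg g) (K_gen g) = Fgen g.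
Proof. by rewrite -psi_gen psi2K. Qed.

Lemma incl_chain : chain_map (@op_d Kop 2) incl.
Proof.
by move=> k x; rewrite -[LHS]psi2K (morph_d psi_morphism) inclK.
Qed.

Lemma F_free : free_dgop (@op_d Kop 2) incl.
Proof.
split; [exact: F_axioms | exact: incl_chain |] => Q g hQ hg.
pose v h : Q 2%N (gdeg h) := g (gdeg h) (K_gen h).
have dl : op_d Q (v Glt) = v Gbar by rewrite /v hg -dK_lt.
have dg : op_d Q (v Ggt) = - v Gbar by rewrite /v hg -raddfN -dK_gt.
have db : op_d Q (v Gbar) = 0 by rewrite /v hg [X in g _ X]dK_bar raddf0.
exists (free_map v); split; first exact: free_map_morphism.
  move=> k x; rewrite -[x in RHS]inclK; move: (incl k x) => {}x.
  case: k x => [|[|k]] x; last by rewrite (F2_2 x) !raddf0.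
  - have [a [b ->]] := F2_0 x; rewrite psi_gen0 !raddfD !raddfMz.
    rewrite (free_map_gen v hQ Glt : free_map v 2%N 0%N _ = _).
    by rewrite (free_map_gen v hQ Ggt : free_map v 2%N 0%N _ = _).
  - have [c ->] := F2_1 x; rewrite psi_gen1 !raddfMz.
    by rewrite (free_map_gen v hQ Gbar : free_map v 2%N 1%N _ = _).
move=> f' hf' e; apply: free_map_unique => // h.
by rewrite -incl_K_gen e.
Qed.

(** * The kernel is generated by the relations *)

Lemma inclE : (incl 0 K_lt = Fgen Glt :> F 2%N 0%N) *
  (incl 0 K_gt = Fgen Ggt :> F 2%N 0%N) * (incl 1 K_bar = Fgen Gbar :> F 2%N 1%N).
Proof. by split; [split|]; rewrite -incl_K_gen. Qed.

Lemma in_ker_psi n k (x : F n k) : (x \in ker psi n k) = (phi n k x == 0).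
Proof. by rewrite in_ker -val_psi. Qed.

Section Minimal.
Variable J : forall n k, zmodClosed (F n k).
Hypothesis hJ : op_ideal J.
Hypothesis relJ : forall n k (x : F n k),
  Frel x -> x \in J n k.

(** The reduction to normal forms is carried out modulo this smaller ideal, so
    that it can be followed in [Pi]. *)
Definition meet_pred n k : {pred F n k} := fun x => (x \in J n k) && (phi n k x == 0).

Lemma meet_closed n k : zmod_closed (@meet_pred n k).
Proof.
split; first by apply/andP; split; [exact: rpred0 | apply/eqP; exact: raddf0].
move=> x y /andP[xJ /eqP hx] /andP[yJ /eqP hy]; apply/andP; split; first exact: rpredB.
by apply/eqP; rewrite raddfB hx hy subrr.
Qed.

HB.instance Definition _ n k := GRing.isZmodClosed.Build (F n k) (@meet_pred n k) (@meet_closed n k).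
Definition meet n k : zmodClosed (F n k) := @meet_pred n k.

Lemma meet_ideal : op_ideal meet.
Proof.
move=> m a n b r c i h x y hxy; apply/andP; split.
  by apply: hJ; case: hxy => /andP[xJ _]; [left | right].
apply: (ker_ideal Pi_axioms phi_morphism); rewrite !in_ker.
by case: hxy => /andP[_ e]; [left | right].
Qed.

Lemma meet_relations n k (x : F n k) :
  Frel x ->
  x \in meet n k.
Proof. by move=> h; apply/andP; split; [exact: relJ | rewrite phi_relations]. Qed.

(** The coefficient of [nf t] in an element with image [z]. The first factor
    is the sign relating [phi (nf t)] to [tree_elt n k t]. *)
Definition coord n k (t : ptree) (z : Pi n k) : int :=
  pcoef (dfs_word 0 t) (phi n k (bmono n k (nf t))) * pcoef (dfs_word 0 t) z.

Lemma coordB n k t (y z : Pi n k) : coord t (y - z) = coord t y - coord t z.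
Proof. by rewrite /coord raddfB mulrBr. Qed.

Lemma coord_nf n k t t' : (0 < n)%N -> is_cell n k t -> is_cell n k t' ->
  coord t' (phi n k (bmono n k (nf t))) = (t == t')%:R.
Proof.
move=> n0 ct ct'; rewrite /coord.
have [p ep] := phi_nf n0 ct; rewrite [X in _ * X](congr1 _ ep) raddf_sg /= pcoef_tree //.
have [<-|_] := eqVneq t t'; last by rewrite sg_0 mulr0.
rewrite [X in X * _](congr1 _ ep) raddf_sg /= pcoef_tree // eqxx.
by rewrite /sg; case: odd.
Qed.

(** The list [L] is kept arbitrary above [s], so that the expansions of two
    elements can be subtracted over a common list of trees. *)
Lemma normal_form n k (x : F n k) : exists2 s : seq ptree, all (is_cell n k) s &
  forall L, uniq L -> all (is_cell n k) L -> {subset s <= L} ->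
    x - \sum_(t <- L) (bmono n k (nf t) : F n k) *~ coord t (phi n k x) \in meet n k.
Proof.
elim: (spans_all meet_ideal meet_relations x) => {x} [x xJ|_ [t [nt bt ->]]|x y _ [s hs es] _ [s' hs' es']].
- exists [::] => // L _ _ _; have /andP[_ /eqP->] := xJ.
  by rewrite big1 ?subr0 // => t _; rewrite /coord raddf0 mulr0 mulr0z.
- case: (boolP (btyped n k (nf t))) => ht; last first.
    rewrite (bmono_out ht); exists [::] => // L _ _ _.
    rewrite big1 ?subr0 ?rpred0 // => u _.
    by rewrite /coord !raddf0 mulr0 mulr0z.
  rewrite -nf_cell // in ht; have n0 := cell_gt0 nt bt ht.
  exists [:: t]; first by rewrite /= ht.
  move=> L uL nestl tL; rewrite (bigD1_seq t) ?tL ?mem_head //=.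
  rewrite coord_nf // eqxx mulr1z big_seq_cond big1 ?addr0 ?subrr ?rpred0 // => u /andP[uL' ut].
  rewrite coord_nf //; last exact: (allP nestl).
  by rewrite eq_sym (negbTE ut) mulr0z.
- exists (s ++ s'); first by rewrite all_cat hs.
  move=> L uL nestl sL.
  have -> : x - y - \sum_(t <- L) (bmono n k (nf t) : F n k) *~ coord t (phi n k (x - y)) =
    (x - \sum_(t <- L) (bmono n k (nf t) : F n k) *~ coord t (phi n k x)) -
    (y - \sum_(t <- L) (bmono n k (nf t) : F n k) *~ coord t (phi n k y)).
    rewrite (eq_bigr _ (fun t _ => congr1 _ (etrans (congr1 _ (raddfB (phi n k) x y)) (coordB _ _ _)))).
    rewrite (eq_bigr _ (fun t _ => mulrzBr _ _ _)) sumrB.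
    by rewrite !opprB addrACA [RHS]addrACA [- y - _]addrC.
  by apply: rpredB; [apply: es | apply: es'] => // t ht; apply: sL; rewrite mem_cat ht ?orbT.
Qed.

Lemma ker_phi_min n k (x : F n k) : phi n k x = 0 -> x \in J n k.
Proof.
move=> e; have [s hs /(_ (undup s))] := normal_form x.
rewrite e undup_uniq all_undup => /(_ isT hs) h.
have /h : {subset s <= undup s} by move=> t; rewrite mem_undup.
rewrite big1 ?subr0 => [/andP[]//|t _].
by rewrite /coord raddf0 mulr0 mulr0z.
Qed.
End Minimal.

Lemma ker_psi_generated :
  generated_by (K_relations (incl 0 K_lt) (incl 0 K_gt) (incl 1 K_bar)) (ker psi).
Proof.
rewrite !inclE; split; first exact: ker_ideal Kop_axioms psi_morphism.
  by move=> n k x /phi_relations h; rewrite in_ker_psi h.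
move=> J hJ relJ n k x; rewrite in_ker_psi => /eqP; exact: ker_phi_min.
Qed.

Section Quotient.
Variables (P Q : dgop) (f : op_family P Q).
Hypotheses (hQ : dgop_axioms Q) (hf : op_morphism f).
Hypothesis f_surj : forall n k (y : Q n k), exists x, f n k x = y.
Local Notation I := (ker f).

Lemma repr_proj n k (x : P n k) : f n k (repr (op_proj I x)) = f n k x.
Proof.
apply/eqP; rewrite -subr_eq0 -raddfB -in_ker Quotient.idealrBE reprK; exact/eqP.
Qed.

Lemma quot_mapB n k : additive (fun q : op_quot I n k => f n k (repr q)).
Proof.
move=> x y; rewrite -raddfB -[RHS]repr_proj; congr (f n k (repr _)).
by rewrite /op_proj raddfB /= !reprK.
Qed.

Definition quot_map : op_family (op_quot I) Q := fun n k => pack_additive (@quot_mapB n k).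

Lemma quot_map_proj n k (x : P n k) : quot_map n k (op_proj I x) = f n k x.
Proof. exact: repr_proj. Qed.

(** The first isomorphism theorem for operads. *)
Lemma quot_map_iso : op_isomorphism quot_map.
Proof.
split.
  split.
  - by rewrite -(morph_one hf); exact: quot_map_proj.
  - move=> m a n b r c i h x y; rewrite -(morph_comp hf); exact: quot_map_proj.
  - move=> n a x; rewrite -(morph_d hf); exact: quot_map_proj.
move=> n k; have [g gK] := choice (@f_surj n k).
exists (fun y => op_proj I (g y)) => [q|y]; last first.
  by rewrite quot_map_proj.
rewrite -[RHS]reprK; apply/eqP; rewrite -Quotient.idealrBE in_ker raddfB gK.
by rewrite /quot_map pack_additiveE subrr.
Qed.
End Quotient.

Lemma Kop_binary_quadratic : binary_quadratic Kop.
Proof.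
exists (Kop 2%N), (@op_d Kop 2), F, incl,
  (K_relations (incl 0 K_lt) (incl 0 K_gt) (incl 1 K_bar)), (ker psi); split.
- split=> k x; [move=> y; exact: (d_add Kop_axioms) | exact: (d_d Kop_axioms)].
- exact: F_free.
- by move=> n k x; case.
- by split; [exact: ker_psi_generated | exact: (ker_d_stable Kop_axioms psi_morphism)].
- by exists (quot_map psi); exact: (quot_map_iso psi_morphism psi_surj).
Qed.

Theorem proposition9 :
  exists st : op_stable K_sub,
  [/\ dgop_axioms (Kprime st),
      K2_basis,
      exists (F : dgop)
             (iota : forall k, {additive Kprime st 2 k -> F 2 k})
             (I : forall n k, zmodClosed (F n k)),
        [/\ free_dgop (@op_d (Kprime st) 2) iota,
            generated_by
              (K_relations (iota 0 K_lt) (iota 0 K_gt) (iota 1 K_bar)) I,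
            d_stable I
          & exists f : op_family (op_quot I) (Kprime st),
              op_isomorphism f /\
              forall k (x : Kprime st 2 k), f 2 k (op_proj I (iota k x)) = x]
    & binary_quadratic (Kprime st)].
Proof.
exists K_stable; split; [exact: Kop_axioms | exact: K2_basisP | | exact: Kop_binary_quadratic].
exists F, incl, (ker psi); split.
- exact: F_free.
- exact: ker_psi_generated.
- exact: (ker_d_stable Kop_axioms psi_morphism).
exists (quot_map psi); split; first exact: (quot_map_iso psi_morphism psi_surj).
by move=> k x; rewrite quot_map_proj; exact: inclK.
Qed.
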